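(* Let $A$ be a pseudomatricial C$^*$-algebra with unique tracial state $\mathrm{tr}$, and let $K_0(\mathrm{tr}):K_0(A)\to\mathbb{R}$ be the induced homomorphism. Then $\ker(K_0(\mathrm{tr}))$ is the subgroup of $K_0(A)$ generated by the classes of the trace-zero projections, and, as an ordered group, it is isomorphic to a subgroup of $\mathbb{R}^{\eta}$, the group of real-valued functions on $\eta$ with well-ordered support equipped with the lexicographical ordering, where $\eta$ is the set of Archimedean equivalence classes of (classes in $K_0(A)$ of) nonzero trace-zero projections.
   Context: $K_0(A)$ has positive cone $\{[p]_0: p\text{ a projection in some }M_n(A)\}$; for pseudomatricial $A$ it is a totally ordered abelian group. $K_0(\mathrm{tr})$ sends $[p]_0$, for a projection $p=(p_{ij})\in M_n(A)$, to $\sum_i\mathrm{tr}(p_{ii})$. In a totally ordered abelian group, $|g|=\max\{g,-g\}$; $g\ll h$ means $n|g|\le|h|$ for all $n\in\mathbb{N}$; $g$ and $h$ are Archimedean equivalent if there are $n,m\in\mathbb{N}$ with $n|g|\ge|h|$ and $m|h|\ge|g|$. The set $\eta$ is totally ordered by letting the class of $h$ precede the class of $g$ when $g\ll h$. $\mathbb{R}^\eta$ is the Hahn group: functions $f:\eta\to\mathbb{R}$ with support $\{x:f(x)\ne0\}$ well-ordered in this order, under pointwise addition, where $f>0$ iff $f\neq0$ and $f$ is positive at the first element of its support. $M_n$ denotes the C$^*$-algebra of complex $n\times n$ matrices, $n\ge1$. Continuous logic for C$^*$-algebras: atomic formulae are norms $\|P(x_1,\dots,x_k)\|$ of $*$-polynomials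 with complex coefficients (a constant $I$ for the identity may be used when the algebras are unital); formulae are built from these by applying continuous real-valued functions to finitely many formulae and by taking $\sup$ or $\inf$ of a variable over the closed unit ball. A sentence is a formula without free variables; $\varphi^A\in\mathbb{R}$ is its value in $A$. $A\equiv B$ (elementarily equivalent) if $\varphi^A=\varphi^B$ for every sentence $\varphi$. The ultraproduct $\prod_{\mathcal{U}}A_i$ is the C$^*$-algebra of bounded families $(a_i)$ modulo those with $\lim_{\mathcal{U}}\|a_i\|=0$. A C$^*$-algebra is pseudomatricial if it is elementarily equivalent to an ultraproduct of matrix algebras $M_n$; such algebras are unital with a unique tracial state. *)

(* Defs.v *)
From HB Require Import structures.
From mathcomp Require Import all_boot all_order all_algebra.
From mathcomp Require Import generic_quotient sesquilinear spectral.
From mathcomp Require Import complex lra.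
From mathcomp Require Import boolp classical_sets functions filter reals.
From mathcomp Require Import topology normedtype sequences.

Set Implicit Arguments.
Unset Strict Implicit.
Unset Printing Implicit Defensive.

Import Order.TTheory GRing.Theory Num.Theory.
Import numFieldNormedType.Exports.
Import ComplexField.Normc.

Local Open Scope classical_set_scope.
Local Open Scope complex_scope.
Local Open Scope ring_scope.

(* Throughout, the real numbers are an arbitrary R : realType and the complex
   numbers are R[i], with modulus normc : R[i] -> R. *)

(* Unital nonzero C*-algebras. The norm is R-valued and primitive: a ring that
   is also a normedModType over R[i] has no join in the MathComp hierarchy
   compatible with numDomainType. *)
HB.mixin Record isCStarAlgebra (R : realType) A & GRing.Algebra R[i] A := {
  star : A -> A;
  cnorm : A -> R;
  starK : involutive star;
  starD : {morph star : a b / a + b};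
  starM : forall a b, star (a * b) = star b * star a;
  starZ : forall c a, star (c *: a) = Num.conj c *: star a;
  cnorm0_eq0 : forall a, cnorm a = 0 -> a = 0;
  cnormZ : forall c a, cnorm (c *: a) = normc c * cnorm a;
  cnormD_le : forall a b, cnorm (a + b) <= cnorm a + cnorm b;
  cnormM_le : forall a b, cnorm (a * b) <= cnorm a * cnorm b;
  cnorm_starM : forall a, cnorm (star a * a) = cnorm a ^+ 2;
  cnorm_complete : forall u : nat -> A,
    (forall e : R, 0 < e -> exists N, forall m n,
       (N <= m)%N -> (N <= n)%N -> cnorm (u m - u n) < e) ->
    exists l, forall e : R, 0 < e -> exists N, forall n,
       (N <= n)%N -> cnorm (u n - l) < e
}.

#[short(type="cstarAlgType")]
HB.structure Definition CStarAlgebra (R : realType) :=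
  {A of GRing.Algebra R[i] A & isCStarAlgebra R A}.

Section CStarTheory.
Variables (R : realType) (A : cstarAlgType R).
Implicit Types a b : A.

Lemma cnorm0 : cnorm (0 : A) = 0.
Proof. by rewrite -(scale0r 0) cnormZ normc0 mul0r. Qed.

Lemma cnormN a : cnorm (- a) = cnorm a.
Proof. by rewrite -scaleN1r cnormZ (normcN (1 : Rcomplex R)) normc1 mul1r. Qed.

Lemma cnorm_ge0 a : 0 <= cnorm a.
Proof.
have := cnormD_le a (- a); rewrite subrr cnorm0 cnormN -mulr2n.
by rewrite pmulrn_lge0.
Qed.

Lemma cnormB a b : cnorm (a - b) = cnorm (b - a).
Proof. by rewrite -cnormN opprB. Qed.

Lemma cnorm_dist a b c : cnorm (a - c) <= cnorm (a - b) + cnorm (b - c).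
Proof. by rewrite (le_trans _ (cnormD_le _ _))// addrA subrK. Qed.

Lemma star0 : star (0 : A) = 0.
Proof. by apply: (addrI (star (0 : A))); rewrite -starD !addr0. Qed.

Lemma star_sum I (r : seq I) (P : pred I) (F : I -> A) :
  star (\sum_(i <- r | P i) F i) = \sum_(i <- r | P i) star (F i).
Proof. exact: (big_morph _ starD star0). Qed.

Lemma star1 : star (1 : A) = 1.
Proof. by rewrite -[RHS](starK 1) -[in RHS](mulr1 (star 1)) starM starK mulr1. Qed.

Lemma cnorm1 : cnorm (1 : A) = 1.
Proof.
have := cnorm_starM (1 : A); rewrite star1 mulr1 expr2 => /esym/eqP.
rewrite -subr_eq0 -{3}[cnorm 1]mulr1 -mulrBr mulf_eq0 subr_eq0.
by case/orP => /eqP// /cnorm0_eq0/eqP; rewrite oner_eq0.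
Qed.

Lemma cnorm_star a : cnorm (star a) = cnorm a.
Proof.
suff H b : cnorm b <= cnorm (star b).
  by apply/le_anti; rewrite H andbT -{2}(starK a) H.
have [->|b0] := eqVneq (cnorm b) 0; first exact: cnorm_ge0.
rewrite -(@ler_pM2r _ (cnorm b)) ?lt_def ?b0 ?cnorm_ge0// -expr2 -cnorm_starM.
exact: cnormM_le.
Qed.

End CStarTheory.

Lemma normc_ge0 (R : realType) (z : R[i]) : 0 <= normc z.
Proof. by have := normr_ge0 z; rewrite lecE/= => /andP[]. Qed.

Lemma real_cauchy (R : realType) (u : nat -> R) :
  (forall e : R, 0 < e -> exists N, forall m n,
     (N <= m)%N -> (N <= n)%N -> `|u m - u n| < e) ->
  exists l, forall e : R, 0 < e -> exists N, forall n,
     (N <= n)%N -> `|u n - l| < e.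
Proof.
move=> cu.
have : cauchy_ex (u @ \oo).
  move=> e e0; have [N uN] := cu _ e0; exists (u N).
  by exists N => // n /= Nn; rewrite /ball/=; exact: uN.
move=> /cauchy_exP /cauchy_cvg /cvg_ex[l /cvgrPdist_lt ul].
exists l => e /ul[N _ uN]; exists N => n Nn.
by rewrite distrC; exact: uN.
Qed.

Lemma complex_cauchy (R : realType) (u : nat -> R[i]) :
  (forall e : R, 0 < e -> exists N, forall m n,
     (N <= m)%N -> (N <= n)%N -> normc (u m - u n) < e) ->
  exists l, forall e : R, 0 < e -> exists N, forall n,
     (N <= n)%N -> normc (u n - l) < e.
Proof.
have ReB (z w : R[i]) : complex.Re (z - w) = complex.Re z - complex.Re w.
  by case: z w => a b [c d].
have ImB (z w : R[i]) : complex.Im (z - w) = complex.Im z - complex.Im w.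
  by case: z w => a b [c d].
have leRe (z : R[i]) : `|complex.Re z| <= normc z.
  by case: z => a b /=; rewrite -sqrtr_sqr ler_sqrt ?lerDl ?addr_ge0 ?sqr_ge0.
have leIm (z : R[i]) : `|complex.Im z| <= normc z.
  by case: z => a b /=; rewrite -sqrtr_sqr ler_sqrt ?lerDr ?addr_ge0 ?sqr_ge0.
have leN (z : R[i]) : normc z <= `|complex.Re z| + `|complex.Im z|.
  case: z => a b /=; rewrite -[leRHS]ger0_norm ?addr_ge0// -sqrtr_sqr.
  rewrite ler_sqrt ?sqr_ge0// sqrrD !real_normK ?num_real//.
  by rewrite addrAC lerDl mulrn_wge0 ?mulr_ge0.
move=> cu.
have [e e0|l1 u1] := real_cauchy (u := fun n => complex.Re (u n)).
  have [N uN] := cu _ e0; exists N => m n Nm Nn.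
  by rewrite -ReB (le_lt_trans (leRe _)) ?uN.
have [e e0|l2 u2] := real_cauchy (u := fun n => complex.Im (u n)).
  have [N uN] := cu _ e0; exists N => m n Nm Nn.
  by rewrite -ImB (le_lt_trans (leIm _)) ?uN.
exists (l1 +i* l2) => e e0; have e20 : 0 < e / 2 by rewrite divr_gt0.
have [N1 h1] := u1 _ e20; have [N2 h2] := u2 _ e20.
exists (maxn N1 N2) => n; rewrite geq_max => /andP[n1 n2].
rewrite (le_lt_trans (leN _))// ReB ImB/= [e]splitr ltrD ?h1 ?h2//.
Qed.

(* The operator norm on square complex matrices acting on Euclidean column
   vectors, and the C*-algebra axioms for it. *)
Section MatrixNorm.
Variables (R : realType) (n : nat).
Implicit Types (x y : 'cV[R[i]]_n) (a b : 'M[R[i]]_n).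

Definition enorm x : R := Num.sqrt (\sum_i normc (x i 0) ^+ 2).

Definition opnorm a : R :=
  sup [set enorm (a *m x) | x in [set x | enorm x <= 1]].

Definition mxadj a : 'M[R[i]]_n := (map_mx Num.conj a)^T.

Let cdot x y : R[i] := dotmx x^T y^T.

Let cdotE x y : cdot x y = \sum_i x i 0 * (y i 0)^*%R.
Proof. by rewrite /cdot dotmxE mxE; apply: eq_bigr => i _; rewrite !mxE. Qed.

Let sq_ge0 x : 0 <= \sum_i normc (x i 0) ^+ 2.
Proof. by apply: sumr_ge0 => i _; exact: sqr_ge0. Qed.

Let cdotxx x : cdot x x = (enorm x ^+ 2)%:C.
Proof.
rewrite cdotE /enorm sqr_sqrtr// rmorph_sum/=; apply: eq_bigr => i _.
by rewrite -normCK rmorphXn.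
Qed.

Lemma enorm_ge0 x : 0 <= enorm x. Proof. exact: sqrtr_ge0. Qed.
Hint Resolve enorm_ge0 : core.

Let sqrt_cdot x : sqrtC (cdot x x) = (enorm x)%:C.
Proof. by rewrite cdotxx rmorphXn/= sqrCK ?ler0c. Qed.

Let enorm_CS x y : normc (cdot x y) <= enorm x * enorm y.
Proof.
rewrite -lecR rmorphM/= -!sqrt_cdot.
by have [] := CauchySchwarz_sqrt (@dotmx R[i] n) x^T y^T.
Qed.

Lemma enormD x y : enorm (x + y) <= enorm x + enorm y.
Proof.
rewrite -lecR rmorphD/= -!sqrt_cdot /cdot linearD/=.
by have [] := triangle_lerif (@dotmx R[i] n) x^T y^T.
Qed.

Lemma enormZ c x : enorm (c *: x) = normc c * enorm x.
Proof.
rewrite /enorm -[normc c]ger0_norm ?normc_ge0// -sqrtr_sqr -sqrtrM ?sqr_ge0//.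
rewrite mulr_sumr; congr Num.sqrt; apply: eq_bigr => i _.
by rewrite mxE normcM exprMn.
Qed.

Lemma enorm0 : enorm 0 = 0.
Proof. by rewrite -(scale0r 0) enormZ normc0 mul0r. Qed.

Lemma normc_le_enorm x i : normc (x i 0) <= enorm x.
Proof.
rewrite -[leLHS]ger0_norm ?normc_ge0// -sqrtr_sqr ler_sqrt//.
by rewrite (bigD1 i)//= lerDl sumr_ge0// => j _; rewrite sqr_ge0.
Qed.

Lemma enorm0_eq0 x : enorm x = 0 -> x = 0.
Proof.
move=> x0; apply/colP => i; rewrite mxE; apply: eq0_normc.
by apply/le_anti; rewrite normc_ge0 -{1}x0 normc_le_enorm.
Qed.

Lemma enorm_delta j : enorm (delta_mx j 0) = 1.
Proof.
rewrite /enorm (bigD1 j)//= mxE !eqxx normc1 expr1n big1 ?addr0 ?sqrtr1// => i ij.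
by rewrite mxE (negPf ij) normc0 expr0n.
Qed.

Lemma enorm_le_sum x : enorm x <= \sum_i normc (x i 0).
Proof.
have -> : x = \sum_i x i 0 *: delta_mx i 0.
  by rewrite {1}[x]matrix_sum_delta; apply: eq_bigr => i _; rewrite big_ord1.
apply: (le_trans (y := \sum_i enorm (x i 0 *: delta_mx i 0))).
  elim/big_ind2 : _ => [|u1 u2 v1 v2 h1 h2|//]; first by rewrite enorm0.
  by rewrite (le_trans (enormD _ _))// lerD.
apply: ler_sum => i _; rewrite enormZ enorm_delta mulr1 summxE (bigD1 i)//=.
rewrite !mxE !eqxx mulr1 big1 ?addr0// => j ji.
by rewrite !mxE eq_sym (negPf ji) mulr0.
Qed.

Let normcD (z w : R[i]) : normc (z + w) <= normc z + normc w.
Proof. exact: (le_normcD (z : Rcomplex R) w). Qed.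

Let normc_sum I (r : seq I) (P : pred I) (F : I -> R[i]) :
  normc (\sum_(i <- r | P i) F i) <= \sum_(i <- r | P i) normc (F i).
Proof.
elim/big_ind2 : _ => [|u1 u2 v1 v2 h1 h2|//]; first by rewrite normc0.
by rewrite (le_trans (normcD _ _))// lerD.
Qed.

Lemma enorm_mulmx_le a x :
  enorm (a *m x) <= (\sum_i \sum_j normc (a i j)) * enorm x.
Proof.
rewrite (le_trans (enorm_le_sum _))// mulr_suml; apply: ler_sum => i _.
rewrite mxE (le_trans (normc_sum _ _ _))// mulr_suml; apply: ler_sum => j _.
by rewrite normcM ler_wpM2l ?normc_ge0 ?normc_le_enorm.
Qed.

Let opset a := [set enorm (a *m x) | x in [set x | enorm x <= 1]].

Let opset_sup a : has_sup (opset a).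
Proof.
split; first by exists (enorm (a *m 0)), 0 => //=; rewrite enorm0.
exists (\sum_i \sum_j normc (a i j)) => _ [x /= x1 <-].
rewrite (le_trans (enorm_mulmx_le _ _))// ler_piMr//.
by do 2!apply: sumr_ge0 => ? _; exact: normc_ge0.
Qed.

Lemma enorm_le_opnorm a x : enorm (a *m x) <= opnorm a * enorm x.
Proof.
have [/enorm0_eq0->|x0] := eqVneq (enorm x) 0.
  by rewrite mulmx0 enorm0 mulr0.
have xp : 0 < enorm x by rewrite lt_def x0 enorm_ge0.
have nV : normc (enorm x)^-1%:C = (enorm x)^-1.
  by rewrite /= expr0n addr0 sqrtr_sqr ger0_norm ?invr_ge0.
rewrite -ler_pdivrMr// mulrC -{1}nV -enormZ scalemxAr.
apply: ub_le_sup; first by case: (opset_sup a).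
exists ((enorm x)^-1%:C *: x) => //=.
by rewrite enormZ nV mulVf.
Qed.

Lemma opnorm_ge0 a : 0 <= opnorm a.
Proof.
apply: (le_trans (y := enorm (a *m 0))) => //.
apply: ub_le_sup; first by case: (opset_sup a).
by exists 0 => //=; rewrite enorm0.
Qed.

Lemma opnorm_le a c : 0 <= c -> (forall x, enorm (a *m x) <= c * enorm x) ->
  opnorm a <= c.
Proof.
move=> c0 ac; apply: ge_sup; first by case: (opset_sup a).
by move=> _ [x /= x1 <-]; rewrite (le_trans (ac x))// ler_piMr.
Qed.

Lemma opnormD a b : opnorm (a + b) <= opnorm a + opnorm b.
Proof.
apply: opnorm_le; first by rewrite addr_ge0 ?opnorm_ge0.
move=> x; rewrite mulmxDl (le_trans (enormD _ _))// mulrDl.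
by rewrite lerD ?enorm_le_opnorm.
Qed.

Lemma opnormM a b : opnorm (a *m b) <= opnorm a * opnorm b.
Proof.
apply: opnorm_le; first by rewrite mulr_ge0 ?opnorm_ge0.
move=> x; rewrite -mulmxA (le_trans (enorm_le_opnorm _ _))// -mulrA.
by rewrite ler_wpM2l ?opnorm_ge0 ?enorm_le_opnorm.
Qed.

Lemma normc_le_opnorm a i j : normc (a i j) <= opnorm a.
Proof.
have := enorm_le_opnorm a (delta_mx j 0); rewrite enorm_delta mulr1.
apply: le_trans; rewrite -colE.
by have := normc_le_enorm (col j a) i; rewrite mxE.
Qed.

Lemma opnorm_le_sum a : opnorm a <= \sum_i \sum_j normc (a i j).
Proof.
apply: opnorm_le; last exact: enorm_mulmx_le.
by do 2!apply: sumr_ge0 => ? _; exact: normc_ge0.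
Qed.

Lemma opnorm0_eq0 a : opnorm a = 0 -> a = 0.
Proof.
move=> a0; apply/matrixP => i j; rewrite mxE; apply: eq0_normc.
by apply/le_anti; rewrite normc_ge0 -{1}a0 normc_le_opnorm.
Qed.

Lemma opnormZ c a : opnorm (c *: a) = normc c * opnorm a.
Proof.
have H d b : opnorm (d *: b) <= normc d * opnorm b.
  apply: opnorm_le; first by rewrite mulr_ge0 ?opnorm_ge0 ?normc_ge0.
  move=> x; rewrite -scalemxAl enormZ -mulrA.
  by rewrite ler_wpM2l ?normc_ge0 ?enorm_le_opnorm.
apply/le_anti; rewrite H/=; have [->|c0] := eqVneq c 0.
  by rewrite normc0 mul0r opnorm_ge0.
have nc0 : normc c != 0 by apply: contra c0 => /eqP/eq0_normc->.
rewrite -{1}[a](scalerK c0) -ler_pdivlMl ?lt_def ?nc0 ?normc_ge0//.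
by rewrite -normcV H.
Qed.

Lemma mxadjK : involutive mxadj.
Proof. by move=> a; apply/matrixP => i j; rewrite !mxE conjCK. Qed.

Lemma mxadjD : {morph mxadj : a b / a + b}.
Proof. by move=> a b; rewrite /mxadj map_mxD linearD. Qed.

Lemma mxadjM a b : mxadj (a *m b) = mxadj b *m mxadj a.
Proof. by rewrite /mxadj map_mxM trmx_mul. Qed.

Lemma mxadjZ c a : mxadj (c *: a) = Num.conj c *: mxadj a.
Proof. by rewrite /mxadj map_mxZ linearZ. Qed.

Let cdot_adj a x y : cdot (a *m x) y = cdot x (mxadj a *m y).
Proof.
rewrite !cdotE /mxadj.
under eq_bigr do rewrite mxE mulr_suml.
rewrite exchange_big/=; apply: eq_bigr => i _.
rewrite mxE rmorph_sum mulr_sumr/=; apply: eq_bigr => j _.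
by rewrite !mxE rmorphM/= conjCK mulrCA mulrA.
Qed.

Lemma opnorm_adjM a : opnorm (mxadj a *m a) = opnorm a ^+ 2.
Proof.
have H b : opnorm b ^+ 2 <= opnorm (mxadj b *m b).
  have p0 := opnorm_ge0 (mxadj b *m b).
  rewrite -[leRHS]sqr_sqrtr// ler_sqr ?nnegrE ?opnorm_ge0 ?sqrtr_ge0//.
  apply: opnorm_le => [|x]; first exact: sqrtr_ge0.
  rewrite -ler_sqr ?nnegrE ?mulr_ge0 ?sqrtr_ge0// exprMn (sqr_sqrtr p0).
  have -> : enorm (b *m x) ^+ 2 = normc (cdot (b *m x) (b *m x)).
    by rewrite cdotxx/= expr0n addr0 sqrtr_sqr ger0_norm ?sqr_ge0.
  rewrite cdot_adj mulmxA (le_trans (enorm_CS _ _))// mulrC expr2 mulrA.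
  by rewrite ler_wpM2r// enorm_le_opnorm.
have H1 b : opnorm b <= opnorm (mxadj b).
  have [->|b0] := eqVneq (opnorm b) 0; first exact: opnorm_ge0.
  rewrite -(@ler_pM2r _ (opnorm b)) ?lt_def ?b0 ?opnorm_ge0// -expr2.
  by rewrite (le_trans (H b))// opnormM.
apply/le_anti; rewrite H andbT (le_trans (opnormM _ _))// expr2.
by rewrite ler_wpM2r ?opnorm_ge0// -{2}(mxadjK a).
Qed.

Lemma opnorm_complete (u : nat -> 'M[R[i]]_n) :
  (forall e : R, 0 < e -> exists N, forall m k,
     (N <= m)%N -> (N <= k)%N -> opnorm (u m - u k) < e) ->
  exists l, forall e : R, 0 < e -> exists N, forall k,
     (N <= k)%N -> opnorm (u k - l) < e.
Proof.
move=> cu.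
have /choice[l ul] (ij : 'I_n * 'I_n) : exists l : R[i],
    forall e : R, 0 < e -> exists N, forall k,
     (N <= k)%N -> normc (u k ij.1 ij.2 - l) < e.
  apply: complex_cauchy => e /cu[N uN]; exists N => m k Nm Nk.
  apply: le_lt_trans (uN _ _ Nm Nk).
  by have := normc_le_opnorm (u m - u k) ij.1 ij.2; rewrite !mxE.
exists (\matrix_(i, j) l (i, j)) => e e0.
pose d := e / (n * n).+1%:R.
have d0 : 0 < d by rewrite divr_gt0.
have /choice[N uN] := fun ij => ul ij d d0.
exists (\max_ij N ij) => k Nk.
rewrite (le_lt_trans (opnorm_le_sum _))//.
apply: (le_lt_trans (y := \sum_(i < n) \sum_(j < n) d)).
  apply: ler_sum => i _; apply: ler_sum => j _; rewrite !mxE ltW//.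
  by apply: uN (i, j) _ _; rewrite (leq_trans (leq_bigmax (i, j))).
rewrite !sumr_const card_ord -mulrnA -mulr_natr /d mulrAC ltr_pdivrMr//.
by rewrite ltr_pM2l// ltr_nat.
Qed.

End MatrixNorm.

(* M_{n+1}(C): the index is shifted so that the algebra is never trivial. *)
Definition matrix_cstar (R : realType) (n : nat) : Type := 'M[R[i]]_n.+1.
HB.instance Definition _ R n := GRing.Algebra.on (matrix_cstar R n).
HB.instance Definition _ (R : realType) n :=
  @isCStarAlgebra.Build R (matrix_cstar R n) (@mxadj R n.+1) (@opnorm R n.+1)
    (@mxadjK R n.+1) (@mxadjD R n.+1) (@mxadjM R n.+1) (@mxadjZ R n.+1)
    (@opnorm0_eq0 R n.+1) (@opnormZ R n.+1) (@opnormD R n.+1) (@opnormM R n.+1)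
    (@opnorm_adjM R n.+1) (@opnorm_complete R n.+1).

Lemma cnorm_fast (R : realType) (A : cstarAlgType R) (s : nat -> A) :
  (forall k, cnorm (s k.+1 - s k) <= 2 ^- k) ->
  exists b, forall k, cnorm (s k - b) <= 2 * 2 ^- k.
Proof.
move=> sk.
have S p k : cnorm (s (k + p)%N - s k) <= 2 * 2 ^- k - 2 * 2 ^- (k + p)%N.
  elim: p => [|p IH]; first by rewrite addn0 !subrr cnorm0.
  rewrite addnS (le_trans (cnorm_dist _ (s (k + p)%N) _))//.
  rewrite (le_trans (lerD (sk _) IH))// [2 ^+ (k + p).+1]exprS invfM.
  by move: (2 ^- (k + p)%N) (2 ^- k) => x y; lra.
have S2 m k : (k <= m)%N -> cnorm (s m - s k) <= 2 * 2 ^- k.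
  move=> km; rewrite -(subnKC km) (le_trans (S _ _))// gerBl.
  by rewrite mulr_ge0// invr_ge0 exprn_ge0.
have small (e : R) : 0 < e -> exists N, forall k, (N <= k)%N -> 2 * 2 ^- k < e.
  move=> e0; have := @cvg_geometric R 2 (2^-1).
  have h2 : `|2^-1 : R| < 1 by rewrite ger0_norm ?invr_ge0//; lra.
  move=> /(_ h2) /cvgrPdist_lt/(_ _ e0)[N _ h].
  exists N => k /h /=; rewrite /geometric/= sub0r normrN exprVn ger0_norm//.
  by rewrite mulr_ge0// invr_ge0 exprn_ge0.
have [|b sb] := cnorm_complete s.
  move=> e e0; have e20 : 0 < e / 2 by rewrite divr_gt0.
  have [N hN] := small _ e20; exists N => m n Nm Nn.
  rewrite (le_lt_trans (cnorm_dist _ (s N) _))// [e]splitr ltrD//.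
    by rewrite (le_lt_trans (S2 _ _ Nm))// hN.
  by rewrite cnormB (le_lt_trans (S2 _ _ Nn))// hN.
exists b => k; apply/ler_addgt0Pr => e /sb[N hN].
have M := leq_maxl k N.
rewrite (le_trans (cnorm_dist _ (s (maxn k N)) _))// lerD//.
  by rewrite cnormB S2.
by rewrite ltW// hN ?leq_maxr.
Qed.

(* Bounded families modulo those whose norm tends to 0 along U. *)
Section Ultraproduct.
Variables (R : realType) (I : Type) (B : I -> cstarAlgType R).
Variables (U : set_system I) (UU : UltraFilter U).

Record bfamily := BFamily {
  bfun :> forall i, B i;
  bfun_bounded : exists M : R, forall i, cnorm (bfun i) <= M
}.

HB.instance Definition _ := gen_eqMixin bfamily.
HB.instance Definition _ := gen_choiceMixin bfamily.

Lemma bfamilyP (a b : bfamily) : (forall i, a i = b i) -> a = b.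
Proof.
case: a b => [f fb] [g gb] /= fg.
have {}fg : f = g by apply: functional_extensionality_dep.
by case: _ / fg gb => gb; rewrite (Prop_irrelevance fb gb).
Qed.

Definition bnull (a b : bfamily) : bool :=
  `[< (fun i => cnorm (a i - b i)) @ U --> (0 : R) >].

Lemma bnullP (a b : bfamily) :
  reflect (forall e : R, 0 < e -> U [set i | cnorm (a i - b i) < e])
          (bnull a b).
Proof.
rewrite /bnull; apply: (iffP (asboolP _)) => [/cvgrPdist_lt ab e e0|ab].
  apply: filterS (ab e e0) => i /=.
  by rewrite sub0r normrN ger0_norm ?cnorm_ge0.
apply/cvgrPdist_lt => e e0; apply: filterS (ab e e0) => i /=.
by rewrite sub0r normrN ger0_norm ?cnorm_ge0.
Qed.

Lemma bnull_refl : reflexive bnull.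
Proof.
move=> a; apply/bnullP => e e0; apply: filterS (filterT) => i _ /=.
by rewrite subrr cnorm0.
Qed.

Lemma bnull_sym : symmetric bnull.
Proof.
suff H a b : bnull a b -> bnull b a by move=> a b; apply/idP/idP; exact: H.
move=> /bnullP ab; apply/bnullP => e /ab; apply: filterS => i /=.
by rewrite cnormB.
Qed.

Lemma bnull_trans : transitive bnull.
Proof.
move=> b a c /bnullP ab /bnullP bc; apply/bnullP => e e0.
have e20 : 0 < e / 2 by rewrite divr_gt0.
apply: filterS (filterI (ab _ e20) (bc _ e20)) => i /= [h1 h2].
by rewrite (le_lt_trans (cnorm_dist _ (b i) _))// [e]splitr ltrD.
Qed.

Canonical bnull_equiv := EquivRel bnull bnull_refl bnull_sym bnull_trans.

Definition ultraproduct : Type := {eq_quot bnull}%qT.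

HB.instance Definition _ := Choice.on ultraproduct.

Definition uclass (a : bfamily) : ultraproduct := \pi_({eq_quot bnull})%qT a.
Definition urepr (x : ultraproduct) : bfamily := repr x.

Lemma ureprK x : uclass (urepr x) = x. Proof. exact: reprK. Qed.

Lemma uclassP a b : uclass a = uclass b <-> bnull a b.
Proof. by split=> [/eqmodP|/eqmodP]. Qed.

Lemma uclassW (P : ultraproduct -> Prop) :
  (forall a, P (uclass a)) -> forall x, P x.
Proof. by move=> Pa x; rewrite -(ureprK x). Qed.

Lemma urepr_class a : bnull (urepr (uclass a)) a.
Proof. by apply/uclassP; rewrite ureprK. Qed.

Fact bzero_bounded : exists M : R, forall i, cnorm (0 : B i) <= M.
Proof. by exists 0 => i; rewrite cnorm0. Qed.
Fact bone_bounded : exists M : R, forall i, cnorm (1 : B i) <= M.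
Proof. by exists 1 => i; rewrite cnorm1. Qed.
Fact badd_bounded (a b : bfamily) :
  exists M : R, forall i, cnorm (a i + b i) <= M.
Proof.
case: a b => [a [M aM]] [b [N bN]] /=; exists (M + N) => i.
by rewrite (le_trans (cnormD_le _ _))// lerD.
Qed.
Fact bmul_bounded (a b : bfamily) :
  exists M : R, forall i, cnorm (a i * b i) <= M.
Proof.
case: a b => [a [M aM]] [b [N bN]] /=; exists (M * N) => i.
by rewrite (le_trans (cnormM_le _ _))// ler_pM ?cnorm_ge0.
Qed.
Fact bscale_bounded (c : R[i]) (a : bfamily) :
  exists M : R, forall i, cnorm (c *: a i) <= M.
Proof.
case: a => [a [M aM]] /=; exists (normc c * M) => i.
by rewrite cnormZ ler_wpM2l ?normc_ge0.
Qed.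
Fact bopp_bounded (a : bfamily) : exists M : R, forall i, cnorm (- a i) <= M.
Proof. by case: a => [a [M aM]] /=; exists M => i; rewrite cnormN. Qed.
Fact bstar_bounded (a : bfamily) :
  exists M : R, forall i, cnorm (star (a i)) <= M.
Proof. by case: a => [a [M aM]] /=; exists M => i; rewrite cnorm_star. Qed.

Definition bzero := BFamily bzero_bounded.
Definition bone := BFamily bone_bounded.
Definition badd a b := BFamily (badd_bounded a b).
Definition bmul a b := BFamily (bmul_bounded a b).
Definition bscale c a := BFamily (bscale_bounded c a).
Definition bopp a := BFamily (bopp_bounded a).
Definition bstar a := BFamily (bstar_bounded a).

Definition uadd x y := uclass (badd (urepr x) (urepr y)).
Definition umul x y := uclass (bmul (urepr x) (urepr y)).
Definition uscale c x := uclass (bscale c (urepr x)).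
Definition uopp x := uclass (bopp (urepr x)).
Definition ustar x := uclass (bstar (urepr x)).
Definition unorm x : R := lim ((fun i => cnorm (urepr x i)) @ U).

Lemma uadd_class a b : uadd (uclass a) (uclass b) = uclass (badd a b).
Proof.
apply/uclassP/bnullP => e e0; have e20 : 0 < e / 2 by rewrite divr_gt0.
have /bnullP/(_ _ e20) h1 := urepr_class a.
have /bnullP/(_ _ e20) h2 := urepr_class b.
apply: filterS (filterI h1 h2) => i /= [{}h1 {}h2].
by rewrite opprD addrACA (le_lt_trans (cnormD_le _ _))// [e]splitr ltrD.
Qed.

Lemma uopp_class a : uopp (uclass a) = uclass (bopp a).
Proof.
apply/uclassP/bnullP => e e0; have /bnullP/(_ _ e0) := urepr_class a.
by apply: filterS => i /=; rewrite -opprD cnormN.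
Qed.

Lemma ustar_class a : ustar (uclass a) = uclass (bstar a).
Proof.
apply/uclassP/bnullP => e e0; have /bnullP/(_ _ e0) := urepr_class a.
apply: filterS => i /=; rewrite -[- star (a i)]scaleN1r.
have -> : -1 *: star (a i) = star (- a i) :> B i.
  by rewrite -[- a i]scaleN1r starZ rmorphN1.
by rewrite -starD cnorm_star.
Qed.

Lemma uscale_class c a : uscale c (uclass a) = uclass (bscale c a).
Proof.
apply/uclassP/bnullP => e e0.
have d0 : 0 < e / (normc c + 1) by rewrite divr_gt0 ?ltr_wpDl ?normc_ge0.
have /bnullP/(_ _ d0) := urepr_class a.
apply: filterS => i /=; rewrite -scalerBr cnormZ.
rewrite ltr_pdivlMr ?ltr_wpDl ?normc_ge0// mulrC; apply: le_lt_trans.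
by rewrite ler_wpM2r ?cnorm_ge0// lerDl.
Qed.

Lemma umul_class a b : umul (uclass a) (uclass b) = uclass (bmul a b).
Proof.
apply/uclassP/bnullP => e e0; have e20 : 0 < e / 2 by rewrite divr_gt0.
have [M aM] := bfun_bounded (urepr (uclass a)).
have [N bN] := bfun_bounded b.
pose K := `|M| + `|N| + 1.
have K0 : 0 < K by rewrite ltr_wpDl ?addr_ge0.
have d0 : 0 < e / 2 / K by rewrite divr_gt0.
have /bnullP/(_ _ d0) h1 := urepr_class a.
have /bnullP/(_ _ d0) h2 := urepr_class b.
apply: filterS (filterI h1 h2) => i /= [{}h1 {}h2].
set x := urepr _ i in h1 *; set y := urepr _ i in h2 *.
have -> : x * y - a i * b i = x * (y - b i) + (x - a i) * b i.
  by rewrite mulrBr mulrBl addrA subrK.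
rewrite (le_lt_trans (cnormD_le _ _))// [e]splitr ltrD//.
  rewrite (le_lt_trans (cnormM_le _ _))//.
  rewrite (@le_lt_trans _ _ (K * cnorm (y - b i)))//.
    rewrite ler_wpM2r ?cnorm_ge0// (le_trans (aM _))// (le_trans (ler_norm _))//.
    by rewrite /K -addrA lerDl addr_ge0.
  by rewrite mulrC -ltr_pdivlMr.
rewrite (le_lt_trans (cnormM_le _ _))//.
rewrite (@le_lt_trans _ _ (cnorm (x - a i) * K))//.
  rewrite ler_wpM2l ?cnorm_ge0// (le_trans (bN _))// (le_trans (ler_norm _))//.
  by rewrite /K addrAC lerDr addr_ge0.
by rewrite -ltr_pdivlMr.
Qed.

Lemma ubounded_cvg (f : I -> R) (M : R) :
  (forall i, `|f i| <= M) -> cvg (f @ U).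
Proof.
move=> fM; have := @segment_compact R (- M) M.
rewrite compact_ultra => /(_ (f @ U)).
case=> [||l [_ fl]]; last by apply/cvg_ex; exists l.
  split=> [|G GF sG]; first exact: fmap_proper_filter.
  apply/seteqP; split=> [A GA|//].
  have [//|nA] := in_ultra_setVsetC (f @^-1` A) UU.
  have GI : G (A `&` ~` A) by apply: filterI => //; apply: sG; exact: nA.
  by case/filter_ex: GI => x [].
rewrite /fmap/=; apply: filterS filterT => i _ /=;
  rewrite in_itv/= -ler_norml; exact: fM.
Qed.

Lemma unorm_cvg (a : bfamily) :
  (fun i => cnorm (a i)) @ U --> unorm (uclass a).
Proof.
have [M aM] := bfun_bounded (urepr (uclass a)).
have : cvg ((fun i => cnorm (urepr (uclass a) i)) @ U).
  by apply: (@ubounded_cvg _ M) => i; rewrite ger0_norm ?cnorm_ge0.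
move=> /cvgrPdist_lt cv; apply/cvgrPdist_lt => e e0.
have e20 : 0 < e / 2 by rewrite divr_gt0.
have /bnullP/(_ _ e20) h := urepr_class a.
apply: filterS (filterI h (cv _ e20)) => i /= [h1 h2].
rewrite -/(unorm _) in h2.
rewrite (le_lt_trans (ler_distD (cnorm (urepr (uclass a) i)) _ _))//.
rewrite [e]splitr ltrD// (le_lt_trans _ h1)//.
rewrite ler_norml; apply/andP; split.
  rewrite lerNl opprB lerBlDr cnormB.
  by rewrite -{1}[a i](subrK (urepr (uclass a) i)) cnormD_le.
by rewrite lerBlDr -{1}[X in cnorm X <= _](subrK (a i)) cnormD_le.
Qed.

Arguments unorm_cvg : clear implicits.

Let ulim_le (f g : I -> R) (l m : R) :
  f @ U --> l -> g @ U --> m -> (forall i, f i <= g i) -> l <= m.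
Proof.
move=> fl gm fg; rewrite -subr_ge0.
have h : (fun i => g i - f i) @ U --> m - l by exact: cvgB gm fl.
rewrite -(cvg_lim _ h)//.
apply: limr_ge; first by apply/cvg_ex; eexists; exact: h.
by apply: filterS filterT => i _ /=; rewrite subr_ge0.
Qed.

Let ulim_eq (f g : I -> R) (l m : R) :
  f @ U --> l -> g @ U --> m -> (forall i, f i = g i) -> l = m.
Proof.
move=> fl gm fg; apply/le_anti.
by rewrite (ulim_le fl gm) ?(ulim_le gm fl)// => i; rewrite fg.
Qed.

Lemma unorm_le (a : bfamily) (c : R) :
  (forall i, cnorm (a i) <= c) -> unorm (uclass a) <= c.
Proof.
move=> ac; have cc : (fun=> c) @ U --> c by exact: cvg_cst.
exact: (ulim_le (unorm_cvg a) cc ac).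
Qed.

Fact uaddA : associative uadd.
Proof.
elim/uclassW => a; elim/uclassW => b; elim/uclassW => c.
by rewrite !uadd_class; congr uclass; apply: bfamilyP => i; exact: addrA.
Qed.
Fact uaddC : commutative uadd.
Proof.
elim/uclassW => a; elim/uclassW => b.
by rewrite !uadd_class; congr uclass; apply: bfamilyP => i; exact: addrC.
Qed.
Fact uadd0 : left_id (uclass bzero) uadd.
Proof.
elim/uclassW => a.
by rewrite !uadd_class; congr uclass; apply: bfamilyP => i; exact: add0r.
Qed.
Fact uaddN : left_inverse (uclass bzero) uopp uadd.
Proof.
elim/uclassW => a.
rewrite uopp_class uadd_class; congr uclass; apply: bfamilyP => i.
exact: addNr.
Qed.

HB.instance Definition _ :=
  GRing.isZmodule.Build ultraproduct uaddA uaddC uadd0 uaddN.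

Fact umulA : associative umul.
Proof.
elim/uclassW => a; elim/uclassW => b; elim/uclassW => c.
by rewrite !umul_class; congr uclass; apply: bfamilyP => i; exact: mulrA.
Qed.
Fact umul1l : left_id (uclass bone) umul.
Proof.
elim/uclassW => a.
by rewrite umul_class; congr uclass; apply: bfamilyP => i; exact: mul1r.
Qed.
Fact umul1r : right_id (uclass bone) umul.
Proof.
elim/uclassW => a.
by rewrite umul_class; congr uclass; apply: bfamilyP => i; exact: mulr1.
Qed.
Fact umulDl : left_distributive umul +%R.
Proof.
elim/uclassW => a; elim/uclassW => b; elim/uclassW => c.
rewrite /GRing.add/= !(umul_class, uadd_class); congr uclass.
by apply: bfamilyP => i; exact: mulrDl.
Qed.
Fact umulDr : right_distributive umul +%R.
Proof.
elim/uclassW => a; elim/uclassW => b; elim/uclassW => c.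
rewrite /GRing.add/= !(umul_class, uadd_class); congr uclass.
by apply: bfamilyP => i; exact: mulrDr.
Qed.
Fact uone_neq0 : uclass bone != 0 :> ultraproduct.
Proof.
apply/eqP => /uclassP/bnullP/(_ 1 ltr01)/filter_ex[i /=].
by rewrite subr0 cnorm1 ltxx.
Qed.

HB.instance Definition _ := GRing.Zmodule_isNzRing.Build ultraproduct
  umulA umul1l umul1r umulDl umulDr uone_neq0.

Fact uscaleA c d x : uscale c (uscale d x) = uscale (c * d) x.
Proof.
elim/uclassW: x => a; rewrite !uscale_class; congr uclass.
by apply: bfamilyP => i; exact: scalerA.
Qed.
Fact uscale1 : left_id 1 uscale.
Proof.
elim/uclassW => a; rewrite uscale_class; congr uclass.
by apply: bfamilyP => i; exact: scale1r.
Qed.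
Fact uscaleDr : right_distributive uscale +%R.
Proof.
move=> c; elim/uclassW => a; elim/uclassW => b.
rewrite /GRing.add/= !(uscale_class, uadd_class); congr uclass.
by apply: bfamilyP => i; exact: scalerDr.
Qed.
Fact uscaleDl x : {morph uscale^~ x : c d / c + d}.
Proof.
elim/uclassW: x => a c d.
rewrite [in RHS]/GRing.add/= !(uscale_class, uadd_class); congr uclass.
by apply: bfamilyP => i; exact: scalerDl.
Qed.

HB.instance Definition _ := GRing.Zmodule_isLmodule.Build R[i] ultraproduct
  uscaleA uscale1 uscaleDr uscaleDl.

Fact uscaleAl c (x y : ultraproduct) : c *: (x * y) = (c *: x) * y.
Proof.
elim/uclassW: x => a; elim/uclassW: y => b.
rewrite /GRing.scale/GRing.mul/= !(uscale_class, umul_class); congr uclass.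
by apply: bfamilyP => i; exact: scalerAl.
Qed.
HB.instance Definition _ :=
  GRing.Lmodule_isLalgebra.Build R[i] ultraproduct uscaleAl.

Fact uscaleAr c (x y : ultraproduct) : c *: (x * y) = x * (c *: y).
Proof.
elim/uclassW: x => a; elim/uclassW: y => b.
rewrite /GRing.scale/GRing.mul/= !(uscale_class, umul_class); congr uclass.
by apply: bfamilyP => i; exact: scalerAr.
Qed.
HB.instance Definition _ :=
  GRing.Lalgebra_isAlgebra.Build R[i] ultraproduct uscaleAr.

Fact ustarK : involutive ustar.
Proof.
elim/uclassW => a; rewrite !ustar_class; congr uclass.
by apply: bfamilyP => i; exact: starK.
Qed.
Fact ustarD : {morph ustar : x y / x + y}.
Proof.
elim/uclassW => a; elim/uclassW => b.
rewrite /GRing.add/= !(ustar_class, uadd_class); congr uclass.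
by apply: bfamilyP => i; exact: starD.
Qed.
Fact ustarM x y : ustar (x * y) = ustar y * ustar x.
Proof.
elim/uclassW: x => a; elim/uclassW: y => b.
rewrite /GRing.mul/= !(ustar_class, umul_class); congr uclass.
by apply: bfamilyP => i; exact: starM.
Qed.
Fact ustarZ c x : ustar (c *: x) = Num.conj c *: ustar x.
Proof.
elim/uclassW: x => a.
rewrite /GRing.scale/= !(ustar_class, uscale_class); congr uclass.
by apply: bfamilyP => i; exact: starZ.
Qed.
Fact unorm0_eq0 x : unorm x = 0 -> x = 0.
Proof.
elim/uclassW: x => a a0; apply/uclassP/bnullP => e e0.
have /cvgrPdist_lt/(_ _ e0) := unorm_cvg a; apply: filterS => i /=.
by rewrite a0 sub0r normrN ger0_norm ?cnorm_ge0// subr0.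
Qed.
Fact unormZ c x : unorm (c *: x) = normc c * unorm x.
Proof.
elim/uclassW: x => a; rewrite /GRing.scale/= uscale_class.
have h : (fun i => normc c * cnorm (a i)) @ U --> normc c * unorm (uclass a).
  by apply: cvgM (unorm_cvg a); exact: cvg_cst.
apply: (ulim_eq (unorm_cvg _) h) => i.
exact: cnormZ.
Qed.
Fact unormD x y : unorm (x + y) <= unorm x + unorm y.
Proof.
elim/uclassW: x => a; elim/uclassW: y => b; rewrite /GRing.add/= uadd_class.
have h := cvgD (unorm_cvg a) (unorm_cvg b).
apply: (ulim_le (unorm_cvg _) (h _)) => i.
exact: cnormD_le.
Qed.
Fact unormM x y : unorm (x * y) <= unorm x * unorm y.
Proof.
elim/uclassW: x => a; elim/uclassW: y => b; rewrite /GRing.mul/= umul_class.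
have h := cvgM (unorm_cvg a) (unorm_cvg b).
apply: (ulim_le (unorm_cvg _) (h _)) => i.
exact: cnormM_le.
Qed.
Fact unorm_starM x : unorm (ustar x * x) = unorm x ^+ 2.
Proof.
elim/uclassW: x => a; rewrite /GRing.mul/= ustar_class umul_class.
have h := cvgM (unorm_cvg a) (unorm_cvg a).
apply: (ulim_eq (unorm_cvg _) (h _)) => i.
by rewrite /= -expr2; exact: cnorm_starM.
Qed.


Fact unorm_complete (u : nat -> ultraproduct) :
  (forall e : R, 0 < e -> exists N, forall m n,
     (N <= m)%N -> (N <= n)%N -> unorm (u m - u n) < e) ->
  exists l, forall e : R, 0 < e -> exists N, forall n,
     (N <= n)%N -> unorm (u n - l) < e.
Proof.
have pow0 k : 0 < 2 ^- k :> R by rewrite invr_gt0 exprn_gt0.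
move=> cu; have /choice[N hN] k := cu _ (pow0 k).
pose N' k := (\max_(j < k.+1) N j)%N.
have leN k : (N k <= N' k)%N by exact: (leq_bigmax (ord_max : 'I_k.+1)).
have leN' k : (N k <= N' k.+1)%N.
  exact: (leq_bigmax (widen_ord (leqnSn k.+1) ord_max : 'I_k.+2)).
pose v k := u (N' k).
have /choice[d dP] k : exists d : bfamily,
    uclass d = v k.+1 - v k /\ forall i, cnorm (d i) <= 2 ^- k.
  pose r := urepr (v k.+1 - v k).
  pose df i := if cnorm (r i) <= 2 ^- k then r i else 0.
  have dfle i : cnorm (df i) <= 2 ^- k.
    by rewrite /df; case: ifP => // _; rewrite cnorm0 ltW.
  exists (BFamily (ex_intro _ (2 ^- k) dfle)); split=> //.
  rewrite -[RHS]ureprK; apply/uclassP/bnullP => e e0.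
  have : unorm (v k.+1 - v k) < 2 ^- k by rewrite hN.
  rewrite -subr_gt0 => h0; have /cvgrPdist_lt/(_ _ h0) := unorm_cvg r.
  rewrite /r ureprK; apply: filterS => i /= h.
  rewrite /df ifT ?subrr ?cnorm0//.
  move: h; rewrite ltr_norml => /andP[h _].
  by move: h; rewrite ltrNl opprB ltrD2r => /ltW.
pose s k : bfamily := iteri k (fun j a => badd a (d j)) (urepr (v 0)).
have sv k : uclass (s k) = v k.
  elim: k => [|k IH]; first by rewrite ureprK.
  rewrite /= -uadd_class IH (dP k).1.
  by rewrite -[uadd _ _]/(v k + (v k.+1 - v k)) addrC subrK.
have hb i : exists b : B i, forall k, cnorm (s k i - b) <= 2 * 2 ^- k.
  by apply: cnorm_fast => k /=; rewrite addrAC subrr add0r (dP k).2.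
pose b i := projT1 (cid (hb i)).
have bP i k : cnorm (s k i - b i) <= 2 * 2 ^- k := projT2 (cid (hb i)) k.
have [M sM] := bfun_bounded (s 0).
have b_bounded : exists M : R, forall i, cnorm (b i) <= M.
  exists (M + 2) => i; rewrite -[b i](subrK (s 0 i)) addrC.
  rewrite (le_trans (cnormD_le _ _))// lerD// cnormB (le_trans (bP i 0))//.
  by rewrite expr0 invr1 mulr1.
exists (uclass (BFamily b_bounded)) => e e0.
have vb k : unorm (v k - uclass (BFamily b_bounded)) <= 2 * 2 ^- k.
  rewrite -sv -[_ - _]/(uadd _ (uopp _)) uopp_class uadd_class.
  by apply: unorm_le => i; exact: bP.
have [k hk] : exists k, 3 * 2 ^- k < e.
  have h2 : `|2^-1 : R| < 1 by rewrite ger0_norm ?invr_ge0//; lra.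
  have /cvgrPdist_lt/(_ _ e0)[k _ /(_ k (leqnn k))] := cvg_geometric 3 h2.
  rewrite /= /geometric/= sub0r normrN exprVn ger0_norm; first by exists k.
  by rewrite mulr_ge0// ltW.
exists (N k) => n kn; apply: le_lt_trans hk.
rewrite -(subrK (v k) (u n)) -addrA (le_trans (unormD _ _))//.
have -> : 3 / 2 ^+ k = 2 ^- k + 2 / 2 ^+ k :> R.
  by move: (2 ^- k) => x; lra.
by apply: lerD (vb k); apply: ltW; apply: hN => //; exact: leN.
Qed.

HB.instance Definition _ := isCStarAlgebra.Build R ultraproduct
  ustarK ustarD ustarM ustarZ unorm0_eq0 unormZ unormD unormM
  unorm_starM unorm_complete.

End Ultraproduct.

(* Formulae are well scoped: the free variables of an element of formula R n
   are indexed by 'I_n, and FSup/FInf bind variable 0 (see extend).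
   POne is the constant I; a constant coefficient c is PScale c POne, so 0 and
   opposites are also available through PScale. *)
Inductive star_polynomial (R : realType) (n : nat) : Type :=
  | PVar of 'I_n
  | POne
  | PAdd of star_polynomial R n & star_polynomial R n
  | PMul of star_polynomial R n & star_polynomial R n
  | PScale of R[i] & star_polynomial R n
  | PStar of star_polynomial R n.

Inductive formula (R : realType) : nat -> Type :=
  | FNorm n of star_polynomial R n : formula R n
  | FConn n k (f : 'rV[R]_k -> R) of continuous f & ('I_k -> formula R n) :
      formula R n
  | FSup n of formula R n.+1 : formula R n
  | FInf n of formula R n.+1 : formula R n.

Section Semantics.
Variables (R : realType) (A : cstarAlgType R).

Fixpoint peval n (P : star_polynomial R n) (v : 'I_n -> A) : A :=
  match P with
  | PVar i => v i
  | POne => 1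
  | PAdd P Q => peval P v + peval Q v
  | PMul P Q => peval P v * peval Q v
  | PScale c P => c *: peval P v
  | PStar P => star (peval P v)
  end.

(* a is assigned to variable 0, and variable j of v becomes variable j + 1. *)
Definition extend n (v : 'I_n -> A) (a : A) : 'I_n.+1 -> A :=
  fun i => if unlift ord0 i is Some j then v j else a.

Fixpoint feval n (phi : formula R n) : ('I_n -> A) -> R :=
  match phi in formula _ n return ('I_n -> A) -> R with
  | FNorm _ P => fun v => cnorm (peval P v)
  | FConn _ _ f _ phis => fun v => f (\row_j feval (phis j) v)
  | FSup _ phi => fun v =>
      sup [set feval phi (extend v a) | a in [set a | cnorm a <= 1]]
  | FInf _ phi => fun v =>
      inf [set feval phi (extend v a) | a in [set a | cnorm a <= 1]]
  end.

Definition sentence_value (phi : formula R 0) : R :=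
  feval phi (fun i : 'I_0 => 0).

End Semantics.

Definition elementarily_equivalent (R : realType) (A B : cstarAlgType R) :=
  forall phi : formula R 0, sentence_value A phi = sentence_value B phi.

Definition pseudomatricial (R : realType) (A : cstarAlgType R) : Prop :=
  exists (I : Type) (U : set_system I) (UU : UltraFilter U) (n : I -> nat),
    elementarily_equivalent A
      (ultraproduct (fun i => matrix_cstar R (n i)) UU).

(* The Grothendieck group of a commutative monoid: (x1, x2) stands for the
   formal difference x1 - x2. *)
Section Grothendieck.
Variable M : nmodType.

Definition groth_rel (x y : M * M) : bool :=
  `[< exists r, x.1 + y.2 + r = y.1 + x.2 + r >].

Lemma groth_refl : reflexive groth_rel.
Proof. by move=> x; apply/asboolP; exists 0. Qed.

Lemma groth_sym : symmetric groth_rel.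
Proof.
by move=> x y; apply/asboolP/asboolP => -[r xy]; exists r; rewrite xy.
Qed.

Lemma groth_trans : transitive groth_rel.
Proof.
move=> y x z /asboolP[r xy] /asboolP[s yz]; apply/asboolP.
exists (y.1 + y.2 + r + s).
rewrite [LHS](AC (2*4) ((1*4*5)*(3*2*6)))%AC.
rewrite /= xy yz.
by rewrite [LHS](AC (3*3) ((4*2)*(1*5*3*6)))%AC.
Qed.

Canonical groth_equiv := EquivRel groth_rel groth_refl groth_sym groth_trans.

Definition grothendieck : Type := {eq_quot groth_rel}%qT.
HB.instance Definition _ := Choice.on grothendieck.

Definition groth_class (x : M * M) : grothendieck :=
  \pi_({eq_quot groth_rel})%qT x.
Definition groth_repr (g : grothendieck) : M * M := repr g.

Lemma groth_reprK g : groth_class (groth_repr g) = g. Proof. exact: reprK. Qed.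

Lemma groth_classP x y : groth_class x = groth_class y <->
  exists r, x.1 + y.2 + r = y.1 + x.2 + r.
Proof. by split=> [/eqmodP/asboolP//|xy]; apply/eqmodP/asboolP. Qed.

Lemma groth_classW (P : grothendieck -> Prop) :
  (forall x, P (groth_class x)) -> forall g, P g.
Proof. by move=> Px g; rewrite -(groth_reprK g). Qed.

Definition groth_add g h := groth_class
  ((groth_repr g).1 + (groth_repr h).1, (groth_repr g).2 + (groth_repr h).2).
Definition groth_opp g := groth_class ((groth_repr g).2, (groth_repr g).1).

Lemma groth_add_class x y :
  groth_add (groth_class x) (groth_class y) =
  groth_class (x.1 + y.1, x.2 + y.2).
Proof.
apply/groth_classP => /=.
have /groth_classP[r] := groth_reprK (groth_class x).
have /groth_classP[s] := groth_reprK (groth_class y).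
move: (groth_repr _) (groth_repr _) => x' y' ys xr; exists (r + s).
rewrite [LHS](AC (2*2*2) ((1*3*5)*(2*4*6)))%AC/= xr ys.
by rewrite [LHS](AC (3*3) ((1*4)*(2*5)*(3*6)))%AC.
Qed.

Lemma groth_opp_class x :
  groth_opp (groth_class x) = groth_class (x.2, x.1).
Proof.
apply/groth_classP => /=.
have /groth_classP[r xr] := groth_reprK (groth_class x); exists r.
by rewrite [_ + x.1]addrC -xr [x.2 + _]addrC.
Qed.

Fact groth_addA : associative groth_add.
Proof.
elim/groth_classW => x; elim/groth_classW => y; elim/groth_classW => z.
by rewrite !groth_add_class /= !addrA.
Qed.
Fact groth_addC : commutative groth_add.
Proof.
elim/groth_classW => x; elim/groth_classW => y.
by rewrite !groth_add_class [x.1 + _]addrC [x.2 + _]addrC.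
Qed.
Fact groth_add0 : left_id (groth_class (0, 0)) groth_add.
Proof.
by elim/groth_classW => -[x y]; rewrite groth_add_class /= !add0r.
Qed.
Fact groth_addN : left_inverse (groth_class (0, 0)) groth_opp groth_add.
Proof.
elim/groth_classW => x; rewrite groth_opp_class groth_add_class.
by apply/groth_classP; exists 0; rewrite /= !addr0 add0r addrC.
Qed.

HB.instance Definition _ := GRing.isZmodule.Build grothendieck
  groth_addA groth_addC groth_add0 groth_addN.

Definition groth_in (x : M) : grothendieck := groth_class (x, 0).

Lemma groth_inD : {morph groth_in : x y / x + y}.
Proof.
by move=> x y; rewrite /GRing.add/= groth_add_class /= addr0.
Qed.

Lemma groth_classE x : groth_class x = groth_in x.1 - groth_in x.2.
Proof.
rewrite /GRing.add/GRing.opp/= groth_opp_class groth_add_class/= addr0 add0r.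
by case: x.
Qed.

End Grothendieck.

Section GrothendieckLift.
Variables (M : nmodType) (G : zmodType) (f : M -> G).
Hypotheses (f0 : f 0 = 0) (fD : {morph f : x y / x + y}).

Definition groth_lift (g : grothendieck M) : G :=
  f (groth_repr g).1 - f (groth_repr g).2.

Lemma groth_lift_class x : groth_lift (groth_class x) = f x.1 - f x.2.
Proof.
have /groth_classP[r] := groth_reprK (groth_class x); rewrite /groth_lift.
move: (groth_repr _) => y /(congr1 f); rewrite !fD => /addIr yx.
by apply/eqP; rewrite subr_eq addrAC eq_sym subr_eq yx.
Qed.

Lemma groth_lift_in x : groth_lift (groth_in x) = f x.
Proof. by rewrite groth_lift_class /= f0 subr0. Qed.

Lemma groth_liftD : {morph groth_lift : g h / g + h}.
Proof.
elim/groth_classW => x; elim/groth_classW => y.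
rewrite [in LHS]/GRing.add/= groth_add_class !groth_lift_class/= !fD.
by rewrite opprD addrACA.
Qed.

End GrothendieckLift.

Section KTheory.
Variables (R : realType) (A : cstarAlgType R).

Definition adjmx m n (v : 'M[A]_(m, n)) : 'M[A]_(n, m) :=
  (map_mx star v)^T.

Lemma adjmxK m n : cancel (@adjmx m n) (@adjmx n m).
Proof. by move=> v; apply/matrixP => i j; rewrite !mxE starK. Qed.

Lemma adjmxM m n k (v : 'M[A]_(m, n)) (w : 'M[A]_(n, k)) :
  adjmx (v *m w) = adjmx w *m adjmx v.
Proof.
apply/matrixP => i j; rewrite !mxE star_sum; apply: eq_bigr => l _.
by rewrite !mxE starM.
Qed.

Lemma adjmx0 m n : adjmx (0 : 'M[A]_(m, n)) = 0.
Proof. by apply/matrixP => i j; rewrite !mxE star0. Qed.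

Lemma adjmx_block m1 m2 n1 n2 (a : 'M[A]_(m1, n1)) (b : 'M[A]_(m1, n2))
    (c : 'M[A]_(m2, n1)) (d : 'M[A]_(m2, n2)) :
  adjmx (block_mx a b c d) = block_mx (adjmx a) (adjmx c) (adjmx b) (adjmx d).
Proof. by rewrite /adjmx map_block_mx tr_block_mx. Qed.

Definition is_projection n (p : 'M[A]_n) := adjmx p = p /\ p *m p = p.

Record projection := Projection {
  pdim : nat;
  pmx :> 'M[A]_pdim;
  pmxP : is_projection pmx
}.

HB.instance Definition _ := gen_eqMixin projection.
HB.instance Definition _ := gen_choiceMixin projection.

(* Murray-von Neumann equivalence of projections of possibly different sizes. *)
Definition mvn (p q : projection) : bool :=
  `[< exists v : 'M[A]_(pdim q, pdim p), adjmx v *m v = p /\ v *m adjmx v = q >].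

Lemma mvn_refl : reflexive mvn.
Proof.
by move=> p; apply/asboolP; exists p; case: (pmxP p) => -> ->.
Qed.

Lemma mvn_sym : symmetric mvn.
Proof.
suff H p q : mvn p q -> mvn q p by move=> p q; apply/idP/idP; exact: H.
move=> /asboolP[v [vp vq]]; apply/asboolP; exists (adjmx v).
by rewrite adjmxK.
Qed.

Lemma mvn_trans : transitive mvn.
Proof.
move=> q p r /asboolP[v [vp vq]] /asboolP[w [wq wr]]; apply/asboolP.
exists (w *m v); rewrite adjmxM; split.
  rewrite mulmxA -(mulmxA _ _ w) wq -vq mulmxA vp -mulmxA vp.
  by case: (pmxP p).
rewrite mulmxA -(mulmxA w) vq -wq mulmxA wr -mulmxA wr.
by case: (pmxP r).
Qed.

Canonical mvn_equiv := EquivRel mvn mvn_refl mvn_sym mvn_trans.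

Fact dsum_projection (p q : projection) : is_projection (block_mx p 0 0 q).
Proof.
case: (pmxP p) (pmxP q) => [ps pp] [qs qq]; split.
  by rewrite adjmx_block ps qs !adjmx0.
by rewrite mulmx_block !mulmx0 !mul0mx !addr0 add0r pp qq.
Qed.

Definition dsum (p q : projection) := Projection (dsum_projection p q).

Fact projection0_proof : is_projection (0 : 'M[A]_0).
Proof. by rewrite /is_projection adjmx0 mul0mx. Qed.

Definition projection0 := Projection projection0_proof.

(* Projections of all sizes modulo Murray-von Neumann equivalence; as A is
   unital, K_0(A) is the Grothendieck group of this monoid. *)
Definition Vmonoid : Type := {eq_quot mvn}%qT.
HB.instance Definition _ := Choice.on Vmonoid.

Definition Vclass (p : projection) : Vmonoid := \pi_({eq_quot mvn})%qT p.
Definition Vrepr (x : Vmonoid) : projection := repr x.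

Lemma VreprK x : Vclass (Vrepr x) = x. Proof. exact: reprK. Qed.

Lemma VclassP p q : Vclass p = Vclass q <->
  exists v : 'M[A]_(pdim q, pdim p), adjmx v *m v = p /\ v *m adjmx v = q.
Proof. by split=> [/eqmodP/asboolP//|pq]; apply/eqmodP/asboolP. Qed.

Lemma VclassW (P : Vmonoid -> Prop) : (forall p, P (Vclass p)) -> forall x, P x.
Proof. by move=> Pp x; rewrite -(VreprK x). Qed.

Definition Vadd x y := Vclass (dsum (Vrepr x) (Vrepr y)).

Lemma Vadd_class p q : Vadd (Vclass p) (Vclass q) = Vclass (dsum p q).
Proof.
apply/VclassP; have /VclassP[v [vp vp']] := VreprK (Vclass p).
have /VclassP[w [wq wq']] := VreprK (Vclass q).
exists (block_mx v 0 0 w); rewrite adjmx_block !adjmx0 !mulmx_block.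
by rewrite !mulmx0 !mul0mx !addr0 !add0r vp vp' wq wq'.
Qed.

Lemma Vclass_cast (p q : projection) (e : pdim q = pdim p) :
  castmx (e, e) q = p -> Vclass p = Vclass q.
Proof.
case: p q e => m p Pp [n q Pq] /= e; case: _ / e p Pp => p Pp.
rewrite castmx_id => qp; move: Pq; rewrite qp => Pq.
by rewrite (Prop_irrelevance Pp Pq).
Qed.

Fact VaddA : associative Vadd.
Proof.
elim/VclassW => p; elim/VclassW => q; elim/VclassW => r.
rewrite !Vadd_class; 
have e := esym (addnA (pdim p) (pdim q) (pdim r)).
apply: (@Vclass_cast (dsum p (dsum q r)) (dsum (dsum p q) r) e) => /=.
have := @block_mxA A _ _ _ _ _ _ p 0 0 0 q 0 0 0 r.
by rewrite !row_mx0 !col_mx0 => ->; congr castmx; congr pair;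
  exact: eq_irrelevance.
Qed.

Fact VaddC : commutative Vadd.
Proof.
elim/VclassW => p; elim/VclassW => q; rewrite !Vadd_class; apply/VclassP.
case: (pmxP p) (pmxP q) => [ps pp] [qs qq].
exists (block_mx 0 (q : 'M_(_)) (p : 'M_(_)) 0).
rewrite adjmx_block ps qs !adjmx0 !mulmx_block.
by rewrite !mulmx0 !mul0mx !addr0 !add0r pp qq.
Qed.

Fact Vadd0 : left_id (Vclass projection0) Vadd.
Proof.
elim/VclassW => p; rewrite Vadd_class.
apply: esym; apply: (@Vclass_cast p (dsum projection0 p) (erefl (pdim p))).
rewrite castmx_id.
apply/matrixP => i j /=; rewrite !mxE.
case: splitP => [[]//|i' ii]; rewrite !mxE; case: splitP => [[]//|j' jj].
by congr (p _ _); apply: val_inj.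
Qed.

HB.instance Definition _ := GRing.isNmodule.Build Vmonoid VaddA VaddC Vadd0.

Definition K0 : Type := grothendieck Vmonoid.
HB.instance Definition _ := GRing.Zmodule.on K0.

Definition K0_class (p : projection) : K0 := groth_in (Vclass p).

(* The relation defined by the positive cone { [p]_0 : p a projection }. It is
   an order only under hypotheses on A (e.g. A pseudomatricial). *)
Definition K0_le (g h : K0) : Prop := exists p, h - g = K0_class p.

(* This is max(g, -g) when K0_le is a total order. *)
Definition K0_abs (g : K0) : K0 := if `[< K0_le 0 g >] then g else - g.

Definition much_less (g h : K0) : Prop :=
  forall n : nat, K0_le (K0_abs g *+ n) (K0_abs h).

Definition arch_equiv (g h : K0) : Prop := exists n m : nat,
  K0_le (K0_abs h) (K0_abs g *+ n) /\ K0_le (K0_abs g) (K0_abs h *+ m).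

(* Projections of A itself, seen as 1 x 1 matrices to define their class. *)
Definition is_elt_projection (p : A) := star p = p /\ p * p = p.

Fact elt_projection_proof (p : A) :
  is_elt_projection p -> is_projection (p%:M : 'M[A]_1).
Proof.
case=> ps pp; split; last by rewrite -scalar_mxM pp.
by apply/matrixP => i j; rewrite !ord1 !mxE !eqxx !mulr1n.
Qed.

Definition elt_projection (p : A) (hp : is_elt_projection p) : projection :=
  Projection (elt_projection_proof hp).

Record tracial_state := TracialState {
  tr_fun :> {scalar A};
  tr_ge0 : forall a, 0 <= tr_fun (star a * a);
  tr_1 : tr_fun 1 = 1;
  tr_mulC : forall a b, tr_fun (a * b) = tr_fun (b * a)
}.

Section Trace.
Variable tr : tracial_state.

(* The sum of the tr(p_ii) is real, being a sum of values of tr at elements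
   star a * a, so taking the real part loses nothing. *)
Definition projection_tr (p : projection) : R := complex.Re (\sum_i tr (p i i)).

Definition K0_tr : K0 -> R := groth_lift (fun x => projection_tr (Vrepr x)).

Lemma projection_tr_mvn p : projection_tr (Vrepr (Vclass p)) = projection_tr p.
Proof.
have /VclassP[v [vp vq]] := VreprK (Vclass p).
rewrite /projection_tr -vp -vq; congr complex.Re.
under eq_bigr do rewrite mxE linear_sum.
under [RHS]eq_bigr do rewrite mxE linear_sum.
rewrite exchange_big/=; apply: eq_bigr => i _; apply: eq_bigr => j _.
by rewrite !mxE tr_mulC.
Qed.

Let trD : {morph (fun x : Vmonoid => projection_tr (Vrepr x)) : x y / x + y}.
Proof.
elim/VclassW => p; elim/VclassW => q.
have ReD (z w : R[i]) : complex.Re (z + w) = complex.Re z + complex.Re w.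
  by case: z w => ? ? [].
rewrite -[Vclass p + _]/(Vadd _ _) Vadd_class !projection_tr_mvn.
rewrite /projection_tr -ReD big_split_ord/=; congr (complex.Re (_ + _)).
  by apply: eq_bigr => i _; rewrite block_mxEul.
by apply: eq_bigr => i _; rewrite block_mxEdr.
Qed.

Lemma K0_tr_class p : K0_tr (K0_class p) = projection_tr p.
Proof.
rewrite /K0_tr groth_lift_in// ?projection_tr_mvn//.
by rewrite /projection_tr big_ord0.
Qed.

Lemma K0_trD : {morph K0_tr : g h / g + h}.
Proof. by move=> g h; rewrite /K0_tr (groth_liftD trD). Qed.

Definition trace_zero_class : set K0 :=
  [set g | exists (p : A) (hp : is_elt_projection p),
     tr p = 0 /\ g = K0_class (elt_projection hp)].

Definition nonzero_trace_zero_class : set K0 :=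
  [set g | exists (p : A) (hp : is_elt_projection p),
     [/\ p != 0, tr p = 0 & g = K0_class (elt_projection hp)]].

(* The set of Archimedean equivalence classes of classes of nonzero trace-zero
   projections, each given as the set of its members. *)
Record eta := Eta {
  eta_members : set K0;
  eta_membersP : exists2 g, nonzero_trace_zero_class g &
    eta_members = [set h | nonzero_trace_zero_class h /\ arch_equiv g h]
}.

(* The class of the larger element comes first. *)
Definition eta_lt (C D : eta) : Prop :=
  exists h g, [/\ eta_members C h, eta_members D g & much_less g h].

End Trace.
End KTheory.

(* The Hahn group of real-valued functions on a set totally ordered by lt, as a
   set of functions under the pointwise addition of T -> R. *)
Section Hahn.
Variables (R : realType) (T : Type) (lt : T -> T -> Prop).

Definition is_first (X : set T) (x : T) : Prop :=
  X x /\ forall y, X y -> y = x \/ lt x y.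

Definition well_ordered (X : set T) : Prop :=
  forall Y, Y `<=` X -> Y !=set0 -> exists x, is_first Y x.

Definition hahn_supp (f : T -> R) : set T := [set x | f x != 0].

Definition hahn_group : set (T -> R) := [set f | well_ordered (hahn_supp f)].

Definition hahn_pos (f : T -> R) : Prop :=
  exists2 x, is_first (hahn_supp f) x & 0 < f x.

Definition hahn_le (f g : T -> R) : Prop := f = g \/ hahn_pos (g - f).

End Hahn.

Definition is_subgroup (V : zmodType) (H : set V) : Prop :=
  H 0 /\ forall x y, H x -> H y -> H (x - y).

(* Main.v *)
Require Import Defs.
From mathcomp Require Import all_boot all_order all_algebra.
From mathcomp Require Import sesquilinear spectral complex ring lra.
From mathcomp Require Import boolp classical_sets functions filter reals.
From mathcomp Require Import topology normedtype sequences.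

Set Implicit Arguments.
Unset Strict Implicit.
Unset Printing Implicit Defensive.

Import Order.TTheory GRing.Theory Num.Theory.
Import numFieldNormedType.Exports.
Import ComplexField.Normc.

Local Open Scope classical_set_scope.
Local Open Scope complex_scope.
Local Open Scope ring_scope.

(** Write K for K_0(A), ordered by the cone of classes of projections.

    Everything about A that is used is first proved for the algebras M_n(C) and
    then transferred: for every k, any two projections of M_k(A) are comparable
    ([projection_comparison]), and every isometry of M_k(A) is unitary
    ([isometry_unitary]).  In M_k(M_n(C)) both are facts of linear algebra, by
    rank and dimension.  They pass to A because they are robust: for each eps
    there is a delta, the same for all n, such that matrices satisfying the
    hypothesis up to delta satisfy the conclusion up to eps.  A statement of
    that form is equivalent to a bound on a sup-inf sentence, and the bound
    survives ultraproducts and elementary equivalence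
    ([pseudomatricial_transfer]).  The robustness, and the return from an
    approximate solution in A to an exact one, both come from one quadratically
    convergent iteration for the partial isometry in the polar decomposition
    ([polar]); it only uses that M_k(A) is a Banach *-algebra.

    Comparison makes the order on K total and finiteness makes it antisymmetric
    ([K0_total_cone]).  An element of the kernel of the trace is then plus or
    minus the class of some projection p of trace zero; comparing p with the
    unit of A, which has trace 1, shows that p is equivalent to a projection of A
    itself ([K0_class_trace_zero]).  This is the first assertion, and it also
    shows that the Archimedean classes of nonzero elements of ker K_0(tr) are
    exactly the points of eta.

    The second assertion is then the Hahn embedding theorem.  For a positive e,
    let the Hoelder ratio of g to e be the supremum of the fractions m / n with
    m e <= n g; it is additive on the convex subgroup generated by e and vanishes
    on the elements infinitely small with respect to e.  Choose a representative
    e t in each class t and ask that phi g have the ratio of g to e t as its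
    coordinate at t whenever g is at most comparable with e t.  This fixes the
    coordinates of g up to and including its own class, hence the sign of phi g,
    so that an additive phi with this property is automatically an order
    embedding.  Zorn's lemma gives a maximal partial phi, and it is total
    because the same requirement dictates how to extend phi by one element
    ([extended_partial]). *)

(** * Totally ordered abelian groups and the Hoelder ratio *)

Record total_cone (K : zmodType) (pos : set K) : Prop := TotalCone {
  coneD : forall x y, pos x -> pos y -> pos (x + y);
  cone_anti : forall x, pos x -> pos (- x) -> x = 0;
  cone_total : forall x, pos x \/ pos (- x)
}.

(** The Archimedean property, in the form in which it turns estimates at every
    scale 1 / (n + 1) into an identity. *)
Lemma eq0_archi (R : realType) (d c : R) :
  (forall n, `|d| <= c / n.+1%:R) -> d = 0.
Proof.
move=> dn; apply/eqP; rewrite -normr_eq0 eq_le normr_ge0 andbT leNgt.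
apply/negP => d0.
have d2 : 0 <= c / `|d|.
  by have := le_trans (normr_ge0 d) (dn 0%N); rewrite divr1 => /divr_ge0->.
have h2 := archimedean.Num.Theory.archi_boundP d2.
have := dn (archimedean.Num.Def.archi_bound (c / `|d|)).
rewrite ler_pdivlMr ?ltr0n// mulrC -ler_pdivlMr// => h1.
by have := le_lt_trans h1 h2; rewrite ltr_nat ltnNge leqnSn.
Qed.

Lemma mulrz_mulrn (K : zmodType) (x : K) m n : x *~ (m *+ n) = x *~ m *+ n.
Proof. by rewrite -mulr_natr mulrzA pmulrn natz. Qed.

Section Cone.
Variables (K : zmodType) (pos : set K).
Hypothesis posC : total_cone pos.

Definition cle (x y : K) := pos (y - x).

Lemma cone0 : pos 0.
Proof. by case: (cone_total posC 0); rewrite ?oppr0. Qed.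

Lemma cle_refl x : cle x x.
Proof. by rewrite /cle subrr; exact: cone0. Qed.

Lemma cle_trans y x z : cle x y -> cle y z -> cle x z.
Proof. by move=> xy yz; rewrite /cle -(subrKA y); exact: coneD. Qed.

Lemma cle_anti x y : cle x y -> cle y x -> x = y.
Proof.
rewrite /cle -(opprB y x) => yx xy; apply/eqP; rewrite eq_sym -subr_eq0.
by apply/eqP; exact: cone_anti yx xy.
Qed.

Lemma cle_total x y : cle x y \/ cle y x.
Proof. by rewrite /cle -(opprB y x); exact: cone_total. Qed.

Lemma cle0 x : cle 0 x = pos x.
Proof. by rewrite /cle subr0. Qed.

Lemma cleD x y z t : cle x y -> cle z t -> cle (x + z) (y + t).
Proof. by move=> xy zt; rewrite /cle opprD addrACA; exact: coneD. Qed.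

Lemma cleN x y : cle x y -> cle (- y) (- x).
Proof. by rewrite /cle opprK addrC. Qed.

Lemma cle_mulrn x y n : cle x y -> cle (x *+ n) (y *+ n).
Proof.
move=> xy; elim: n => [|n IH]; first by rewrite !mulr0n; exact: cle_refl.
by rewrite !mulrS; exact: cleD.
Qed.

Lemma cone_mulrn x n : pos x -> pos (x *+ n).
Proof. by rewrite -!cle0 => px; have := cle_mulrn n px; rewrite mul0rn. Qed.

(** Totally ordered groups are torsion-free: if x is positive and (n+1) x = 0
    then - x = n x is positive too. *)
Lemma cone_mulrn_eq0 x n : pos x -> x *+ n.+1 = 0 -> x = 0.
Proof.
move=> px xn; apply: (cone_anti posC px); rewrite -[- x]add0r -xn mulrSr addrK.
exact: cone_mulrn.
Qed.

Lemma cle_mulrn_cancel x y n : cle (x *+ n.+1) (y *+ n.+1) -> cle x y.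
Proof.
move=> h; have [//|yx] := cle_total x y.
have /(@cone_mulrn_eq0 _ n yx)/eqP : (x - y) *+ n.+1 = 0.
  by rewrite mulrnBl (cle_anti h (cle_mulrn n.+1 yx)) subrr.
by rewrite subr_eq0 => /eqP ->; exact: cle_refl.
Qed.

Lemma cle_mulrn_mono x m n : pos x -> (m <= n)%N -> cle (x *+ m) (x *+ n).
Proof.
by move=> px mn; rewrite /cle -mulrnBr//; exact: cone_mulrn.
Qed.

Lemma cle_mulrz x (m n : int) : pos x -> x != 0 ->
  cle (x *~ m) (x *~ n) <-> (m <= n)%R.
Proof.
move=> px x0; rewrite /cle -mulrzBr -subr_ge0; case: (n - m) => k.
  by split=> // _; exact: cone_mulrn.
split=> //; rewrite NegzE mulrNz => pk.
have /eqP : x = 0; last by rewrite (negPf x0).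
apply: (@cone_mulrn_eq0 _ k px); apply: (cone_anti posC) pk.
exact: cone_mulrn.
Qed.

(** The convex subgroup generated by [e]. *)
Definition dominated (e g : K) :=
  exists n, cle (- (e *+ n)) g /\ cle g (e *+ n).

Lemma dominated0 e : dominated e 0.
Proof. by exists 0%N; rewrite mulr0n oppr0; split; exact: cle_refl. Qed.

Lemma dominatedD e g h : dominated e g -> dominated e h -> dominated e (g + h).
Proof.
move=> [m [m1 m2]] [n [n1 n2]]; exists (m + n)%N.
by rewrite mulrnDr opprD; split; exact: cleD.
Qed.

Lemma dominatedN e g : dominated e g -> dominated e (- g).
Proof.
move=> [n [n1 n2]]; exists n; split; first exact: cleN.
by rewrite -[e *+ n]opprK; exact: cleN.
Qed.

Lemma dominatedB e g h : dominated e g -> dominated e h -> dominated e (g - h).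
Proof. by move=> eg /dominatedN; exact: dominatedD. Qed.

Lemma dominated_mulrn e g n : dominated e g -> dominated e (g *+ n).
Proof.
move=> eg; elim: n => [|n IH]; first by rewrite mulr0n; exact: dominated0.
by rewrite mulrS; exact: dominatedD.
Qed.

Lemma dominated_pos e g n : pos e -> pos g -> cle g (e *+ n) -> dominated e g.
Proof.
move=> pe pg gn; exists n; split=> //; apply: (@cle_trans 0).
  by rewrite -oppr0; apply: cleN; rewrite cle0; exact: cone_mulrn.
by rewrite cle0.
Qed.

Variable R : realType.

Definition hoelder_set (e g : K) : set R :=
  [set q | exists (m : int) (n : nat),
     cle (e *~ m) (g *+ n.+1) /\ q = m%:~R / n.+1%:R].

(** Hoelder's map: the real number at which the multiples of [e] cut those of
    [g]. *)
Definition hoelder (e g : K) : R := sup (hoelder_set e g).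

Section Ratio.
Variable e : K.
Hypotheses (pe : pos e) (e0 : e != 0).

Let hoelder_ub g m n : cle (g *+ n.+1) (e *~ m) ->
  ubound (hoelder_set e g) (m%:~R / n.+1%:R).
Proof.
move=> gm _ [m' [n' [mg ->]]].
have : (m' *+ n.+1 <= m *+ n'.+1)%R.
  apply/(cle_mulrz _ _ pe e0); rewrite !mulrz_mulrn.
  apply: cle_trans (cle_mulrn n.+1 mg) _; rewrite mulrnAC.
  exact: cle_mulrn.
rewrite ler_pdivrMr ?ltr0n// mulrAC ler_pdivlMr ?ltr0n//.
by rewrite -(ler_int R) !mulrz_mulrn !mulr_natr.
Qed.

Lemma hoelder_has_sup g : dominated e g -> has_sup (hoelder_set e g).
Proof.
move=> [n [n1 n2]]; split.
  exists ((- n%:Z)%:~R / 1%:R), (- n%:Z), 0%N; split=> //.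
  by rewrite mulr1n mulrNz.
by exists (n%:Z%:~R / 1%:R); apply: hoelder_ub; rewrite mulr1n.
Qed.

Lemma hoelder_ge g m n : dominated e g -> cle (e *~ m) (g *+ n.+1) ->
  m%:~R / n.+1%:R <= hoelder e g.
Proof.
move=> eg h; apply: ub_le_sup; first by case: (hoelder_has_sup eg).
by exists m, n.
Qed.

Lemma hoelder_le g m n : dominated e g -> cle (g *+ n.+1) (e *~ m) ->
  hoelder e g <= m%:~R / n.+1%:R.
Proof.
by move=> eg h; apply: ge_sup; [case: (hoelder_has_sup eg)|exact: hoelder_ub].
Qed.

(** The least n with g <= (n - k) e exists because g lies between - k e and k e;
    it locates g between two consecutive multiples of e. *)
Lemma dominated_floor g : dominated e g ->
  exists m : int, cle (e *~ m) g /\ cle g (e *~ (m + 1)).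
Proof.
move=> [k [k1 k2]].
pose P n := `[< cle g (e *~ (n%:Z - k%:Z)) >].
have [|n /asboolP ng nmin] := @ex_minnP P.
  by exists (k + k)%N; apply/asboolP; rewrite PoszD addrK.
case: n ng nmin => [|n] ng nmin.
  exists (- k%:Z); split; first by rewrite mulrNz.
  rewrite add0r in ng; apply: cle_trans ng _.
  by apply/(cle_mulrz _ _ pe e0); rewrite lerDl.
exists (n%:Z - k%:Z); split; last by rewrite addrAC -PoszD addn1.
have [//|gn] := cle_total (e *~ (n%:Z - k%:Z)) g.
by have /nmin := asboolT gn; rewrite ltnn.
Qed.

(** Bracketing (n+1) g and (n+1) h between consecutive multiples of e brackets
    their sum as well, so additivity holds up to 2 / (n+1) for every n. *)
Lemma hoelderD g h : dominated e g -> dominated e h ->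
  hoelder e (g + h) = hoelder e g + hoelder e h.
Proof.
move=> eg eh; apply/eqP; rewrite -subr_eq0; apply/eqP.
set d := (X in X = 0).
have dn (n : nat) : `|d| <= 2 / n.+1%:R.
  have [m [m1 m2]] := dominated_floor (dominated_mulrn n.+1 eg).
  have [p [p1 p2]] := dominated_floor (dominated_mulrn n.+1 eh).
  have a1 := hoelder_ge eg m1; have a2 := hoelder_le eg m2.
  have b1 := hoelder_ge eh p1; have b2 := hoelder_le eh p2.
  have egh := dominatedD eg eh.
  have c1 : (m + p)%:~R / n.+1%:R <= hoelder e (g + h).
    by apply: hoelder_ge => //; rewrite mulrnDl mulrzDr; exact: cleD.
  have c2 : hoelder e (g + h) <= (m + 1 + (p + 1))%:~R / n.+1%:R.
    by apply: hoelder_le => //; rewrite mulrnDl mulrzDr; exact: cleD.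
  move: a1 a2 b1 b2 c1 c2; rewrite !intrD !mulrDl /d ler_norml.
  move: (hoelder e g) (hoelder e h) (hoelder e (g + h)) => x y z.
  move: (m%:~R / _) (p%:~R / _) (1%:~R / _) => q r t.
  by move=> *; apply/andP; split; lra.
exact: eq0_archi dn.
Qed.

Lemma hoelder0 : hoelder e 0 = 0.
Proof.
by apply: (addrI (hoelder e 0)); rewrite -hoelderD ?addr0//; exact: dominated0.
Qed.

Lemma hoelderN g : dominated e g -> hoelder e (- g) = - hoelder e g.
Proof.
move=> eg; apply: (addrI (hoelder e g)).
by rewrite -hoelderD ?subrr ?hoelder0//; exact: dominatedN.
Qed.

Lemma hoelderB g h : dominated e g -> dominated e h ->
  hoelder e (g - h) = hoelder e g - hoelder e h.
Proof. by move=> eg eh; rewrite hoelderD ?hoelderN//; exact: dominatedN. Qed.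

Lemma hoelder_mulrn g n :
  dominated e g -> hoelder e (g *+ n) = hoelder e g *+ n.
Proof.
move=> eg; elim: n => [|n IH]; first by rewrite !mulr0n hoelder0.
by rewrite !mulrS hoelderD ?IH//; exact: dominated_mulrn.
Qed.

Lemma hoelder_gt0 g n :
  dominated e g -> cle e (g *+ n) -> pos g -> 0 < hoelder e g.
Proof.
move=> eg en pg; apply: (@lt_le_trans _ _ (1%:~R / n.+1%:R)).
  by rewrite divr_gt0.
apply: hoelder_ge => //; rewrite mulr1z; apply: cle_trans en _.
exact: cle_mulrn_mono.
Qed.

Lemma hoelder_small g : pos g -> (forall n, cle (g *+ n) e) -> hoelder e g = 0.
Proof.
move=> pg ge.
have eg : dominated e g.
  by apply: (@dominated_pos _ _ 1%N) => //; have := ge 1%N.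
apply: (@eq0_archi _ _ 1) => n; have h : cle (g *+ n.+1) (e *~ 1).
  by rewrite mulr1z.
rewrite ger0_norm; first exact: hoelder_le h.
rewrite -[0](@mul0r _ (1%:R)^-1); apply: (@hoelder_ge _ 0 0) => //.
by rewrite mulr0z cle0.
Qed.

End Ratio.
End Cone.

(** * The Hahn embedding theorem *)

Section HahnGroup.
Variables (R : realType) (T : Type) (lt : T -> T -> Prop).
Hypothesis lt_trans : forall s t u, lt s t -> lt t u -> lt s u.
Hypothesis lt_total : forall s t, [\/ s = t, lt s t | lt t s].

Lemma well_orderedS (X Y : set T) :
  X `<=` Y -> well_ordered lt Y -> well_ordered lt X.
Proof. by move=> XY wY Z ZX; apply: wY => t /ZX; exact: XY. Qed.

(** To minimize over Y, pick t in Y: either t is the first element of Y or the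
    elements of Y before t, which have a first element, come before the rest. *)
Lemma well_ordered_segments (X : set T) :
  (forall t, X t -> well_ordered lt (X `&` [set s | lt s t])) ->
  well_ordered lt X.
Proof.
move=> Xt Y YX [t Yt].
have [[s [Ys st]]|nY] := pselect (exists s, Y s /\ lt s t).
  have [|r [[Yr rt] rmin]] := @Xt t (YX _ Yt) (Y `&` [set s | lt s t]) _
    (ex_intro _ s (conj Ys st)).
    by move=> u [/YX].
  exists r; split=> // u Yu; have [->|ut|tu] := lt_total u t.
  - by right.
  - exact: rmin.
  - by right; exact: lt_trans rt tu.
exists t; split=> // u Yu; have [->|ut|tu] := lt_total u t; [by left| |by right].
by case: nY; exists u.
Qed.

Lemma well_orderedU (X Y : set T) :
  well_ordered lt X -> well_ordered lt Y -> well_ordered lt (X `|` Y).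
Proof.
move=> wX wY Z ZXY [t Zt].
have [[s Zs]|nX] := pselect (Z `&` X !=set0); last first.
  apply: wY; last by exists t.
  by move=> s Zs; have [Xs|//] := ZXY _ Zs; case: nX; exists s.
have [[r Zr]|nY] := pselect (Z `&` Y !=set0); last first.
  apply: wX; last by exists t.
  by move=> u Zu; have [//|Yu] := ZXY _ Zu; case: nY; exists u.
have [|a [[Za Xa] amin]] := wX (Z `&` X) _ (ex_intro _ s Zs); first by move=> ? [].
have [|b [[Zb Yb] bmin]] := wY (Z `&` Y) _ (ex_intro _ r Zr); first by move=> ? [].
have [ab|ba] : (a = b \/ lt a b) \/ lt b a.
    by case: (lt_total a b); [left; left|left; right|right].
- exists a; split=> // u Zu; have [Xu|Yu] := ZXY _ Zu; first exact: amin.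
  have [->|bu] := bmin _ (conj Zu Yu); first by case: ab => [->|]; [left|right].
  by right; case: ab => [->//|ab]; exact: lt_trans ab bu.
- exists b; split=> // u Zu; have [Xu|Yu] := ZXY _ Zu; last exact: bmin.
  have [->|au] := amin _ (conj Zu Xu); first by right.
  by right; exact: lt_trans ba au.
Qed.

Lemma hahn_group0 : hahn_group lt (0 : T -> R).
Proof. by move=> Y YX [t /YX]; rewrite /hahn_supp/= eqxx. Qed.

Lemma hahn_groupD (f g : T -> R) :
  hahn_group lt f -> hahn_group lt g -> hahn_group lt (f + g).
Proof.
move=> hf hg; apply: (well_orderedS _ (well_orderedU hf hg)) => t.
rewrite /hahn_supp/= fctE; have [->|? _] := eqVneq (f t) 0; last by left.
by rewrite add0r; right.
Qed.

Lemma hahn_groupN (f : T -> R) : hahn_group lt f -> hahn_group lt (- f).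
Proof. by apply: well_orderedS => t; rewrite /hahn_supp/= fctE oppr_eq0. Qed.

Lemma hahn_group_mulrz (f : T -> R) m : hahn_group lt f -> hahn_group lt (f *~ m).
Proof.
move=> hf; case: m => n; rewrite ?NegzE ?mulrNz -pmulrn; last first.
  apply: hahn_groupN; elim: n.+1 => [|k IH]; first exact: hahn_group0.
  by rewrite mulrS; exact: hahn_groupD.
elim: n => [|k IH]; first exact: hahn_group0.
by rewrite mulrS; exact: hahn_groupD.
Qed.

End HahnGroup.

(** The index set T stands for a set of Archimedean classes and e for a choice
    of positive representatives; a class that comes first has the larger
    representative. *)
Section HahnEmbedding.
Variables (R : realType) (K : zmodType) (pos : set K).
Hypothesis posC : total_cone pos.
Variables (T : Type) (lt : T -> T -> Prop) (e : T -> K).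
Hypothesis e_pos : forall t, pos (e t).
Hypothesis e_neq0 : forall t, e t != 0.
Hypothesis lt_e : forall s t, lt s t <-> forall n, cle pos (e t *+ n) (e s).
Hypothesis e_inj : forall s t,
  (exists n, cle pos (e s) (e t *+ n)) -> (exists n, cle pos (e t) (e s *+ n)) ->
  s = t.

Lemma index_trans s t u : lt s t -> lt t u -> lt s u.
Proof.
move=> /lt_e st /lt_e tu; apply/lt_e => n.
by apply: (cle_trans posC (tu n)); have := st 1%N; rewrite mulr1n.
Qed.

Lemma index_total s t : [\/ s = t, lt s t | lt t s].
Proof.
have H a b : lt a b \/ exists n, cle pos (e a) (e b *+ n).
  have [h|] := pselect (lt a b); [by left|move=> lab; right].
  apply: contra_notP lab => nab; apply/lt_e => n.
  by have [//|ab] := cle_total posC (e b *+ n) (e a); case: nab; exists n.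
have [|st] := H s t; first by constructor 2.
have [|ts] := H t s; first by constructor 3.
by constructor 1; exact: e_inj.
Qed.

(** An element at most comparable with the smaller e t is infinitely small with
    respect to e s. *)
Lemma dominated_lt s t g : lt s t -> dominated pos (e t) g ->
  dominated pos (e s) g /\ hoelder pos R (e s) g = 0.
Proof.
move=> /lt_e st tg.
wlog pg : g tg / pos g => [H|].
  have [/H|pg] := cone_total posC g; first exact.
  have [sg h] := H _ (dominatedN tg) pg; rewrite -(opprK g); split.
    exact: dominatedN.
  by rewrite hoelderN// h oppr0.
have [k [_ gk]] := tg.
have gs n : cle pos (g *+ n) (e s).
  apply: (cle_trans posC (cle_mulrn posC n gk)).
  by rewrite -mulrnA; exact: st.
split; last exact: hoelder_small.
apply: (@dominated_pos _ _ posC _ _ 1%N) => //.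
by have := gs 1%N; rewrite !mulr1n.
Qed.

(** For g of Archimedean class t this gives f a positive or negative coordinate
    at t, according to the sign of g, and zeros before t, since g is infinitely
    small with respect to the earlier representatives. *)
Definition conform (a : K * (T -> R)) : Prop :=
  hahn_group lt a.2 /\
  forall t, dominated pos (e t) a.1 -> a.2 t = hoelder pos R (e t) a.1.

(** A partial homomorphism is encoded by its graph, so that unions of chains are
    plain unions; the graph is single-valued because conformity at g = 0 forces
    every coordinate to vanish. Allowing the empty graph covers the empty
    chain. *)
Definition partial_embedding (G : set (K * (T -> R))) : Prop :=
  (forall a b, G a -> G b -> G (a - b)) /\ (forall a, G a -> conform a).

Section Extension.
Variable G : set (K * (T -> R)).
Hypotheses (GP : partial_embedding G) (G0 : G 0).
Variable x : K.

Let GB a b : G a -> G b -> G (a - b). Proof. by case: GP => h _; exact: h. Qed.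
Let GN a : G a -> G (- a). Proof. by rewrite -[- a]add0r; exact: GB. Qed.
Let GD a b : G a -> G b -> G (a + b).
Proof. by move=> Ga Gb; rewrite -(opprK b); apply: GB => //; exact: GN. Qed.
Let Gmulrn a n : G a -> G (a *+ n).
Proof.
by move=> Ga; elim: n => [|n IH]; rewrite ?mulr0n// mulrS; exact: GD.
Qed.

Let mulrn1 (a : K * (T -> R)) n : (a *+ n).1 = a.1 *+ n.
Proof. by elim: n => // n IH; rewrite !mulrS -IH. Qed.
Let mulrn2 (a : K * (T -> R)) n t : (a *+ n).2 t = a.2 t *+ n.
Proof. by elim: n => // n IH; rewrite !mulrS -IH. Qed.

(* The pair (n, w) approximates x at t: (n+1) x differs from the element w.1 of
   the domain by something at most comparable with e t. The shift in n keeps the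
   multiplier positive. *)
Let witness t (nw : nat * (K * (T -> R))) :=
  G nw.2 /\ dominated pos (e t) (x *+ nw.1.+1 - nw.2.1).

(* What (n+1) times the t-th coordinate of the image of x has to be. *)
Let value t (nw : nat * (K * (T -> R))) :=
  nw.2.2 t + hoelder pos R (e t) (x *+ nw.1.+1 - nw.2.1).

(** Where x has no approximation at t, conformity of the elements m x + g puts
    no constraint on the coordinate at t, and 0 keeps the support small. *)
Definition extension (t : T) : R :=
  if pselect (exists nw, witness t nw) is left h
  then let nw := projT1 (cid h) in value t nw / nw.1.+1%:R else 0.

(* Cross-multiplying, the two approximants differ by an element of the domain
   that is at most comparable with e t, whose coordinate at t is its ratio. *)
Let value_unique t a b : witness t a -> witness t b ->
  value t a *+ b.1.+1 = value t b *+ a.1.+1.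
Proof.
case: a b => [n v] [m w]; rewrite /witness/value/= => -[Gv dv] [Gw dw].
have dv' := dominated_mulrn posC m.+1 dv.
have dw' := dominated_mulrn posC n.+1 dw.
have Gu := GB (Gmulrn m.+1 Gv) (Gmulrn n.+1 Gw).
have eu : (v *+ m.+1 - w *+ n.+1).1 =
    (x *+ m.+1 - w.1) *+ n.+1 - (x *+ n.+1 - v.1) *+ m.+1.
  rewrite [LHS]/= !mulrn1 !mulrnBl -!mulrnA [(m.+1 * _)%N]mulnC.
  by rewrite [- (x *+ _ - _)]opprB [RHS]addrC subrKA.
have := GP.2 _ Gu; rewrite /conform => -[_ /(_ t)]; rewrite eu.
move=> /(_ (dominatedB posC dw' dv')).
rewrite -[_.2 t]/((v *+ m.+1).2 t - (w *+ n.+1).2 t) !mulrn2.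
rewrite hoelderB// !hoelder_mulrn// !mulrnDl.
move: (v.2 t *+ _) (w.2 t *+ _) (hoelder _ _ _ _ *+ _) (hoelder _ _ _ _ *+ _).
by move=> p q r s h; lra.
Qed.

Let extensionE t nw : witness t nw -> extension t *+ nw.1.+1 = value t nw.
Proof.
move=> h; rewrite /extension; case: pselect => [h'|[]]; last by exists nw.
case: cid => nw' hw' /=; rewrite -[LHS]mulr_natr mulrAC mulr_natr.
by rewrite (value_unique hw' h) -[_ *+ _]mulr_natr mulfK// pnatr_eq0.
Qed.

(* If w approximates x at t, it does so at every earlier s with an error
   infinitely small with respect to e s. So before t the extension is a rational
   multiple of the coordinates of w, whose support is well-ordered. *)
Let extension_hahn : hahn_group lt extension.
Proof.
apply: (well_ordered_segments index_trans index_total) => t.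
rewrite {1}/hahn_supp/= {1}/extension.
case: pselect => [[nw [Gw dw]] _|]; last by rewrite eqxx.
apply: (@well_orderedS _ _ _ (hahn_supp nw.2.2)); last by case: (GP.2 _ Gw).
move=> s [/=]; rewrite /hahn_supp/= => fs st.
have [dws hoelder0] := dominated_lt st dw.
have := @extensionE s nw (conj Gw dws); rewrite /value hoelder0 addr0 => <-.
by rewrite mulrn_eq0 negb_or.
Qed.

Definition extended : set (K * (T -> R)) :=
  [set a | exists w (m : int), G w /\ a = w + (x, extension) *~ m].

Let mulrz1 (a : K * (T -> R)) (m : int) : (a *~ m).1 = a.1 *~ m.
Proof. by case: m => n; rewrite ?NegzE ?mulrNz -?pmulrn /= mulrn1. Qed.
Let mulrz2 (a : K * (T -> R)) (m : int) : (a *~ m).2 = a.2 *~ m.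
Proof.
have H n : (a *+ n).2 = a.2 *+ n by elim: n => // n IH; rewrite !mulrS -IH.
by case: m => n; rewrite ?NegzE ?mulrNz -?pmulrn /= H.
Qed.

(** If w + m x is at most comparable with e t and m is not 0, then - w or w,
    according to the sign of m, approximates x at t, and the definition of the
    extension gives w + m x the required coordinate. *)
Lemma extended_partial : partial_embedding extended.
Proof.
split.
  move=> _ _ [v [m [Gv ->]]] [w [p [Gw ->]]]; exists (v - w), (m - p).
  by split; [exact: GB|rewrite mulrzBr opprD addrACA].
move=> _ [w [m [Gw ->]]]; have [hw cw] := GP.2 _ Gw.
split; rewrite /= ?mulrz1 ?mulrz2 /=.
  apply: hahn_groupD => //; [exact: index_trans|exact: index_total|].
  by apply: hahn_group_mulrz => //; [exact: index_trans|exact: index_total].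
move=> t dt; rewrite fctE.
have -> : (extension *~ m) t = extension t *~ m.
  by case: m {dt} => n; rewrite ?NegzE ?mulrNz -!pmulrn ?fctE ?natmulfctE.
case: m dt => [[|n]|n] dt.
- by rewrite !mulr0z !addr0 in dt *; exact: cw.
- have /extensionE : witness t (n, - w).
    by split; [exact: GN|rewrite /= opprK addrC].
  rewrite /value /= opprK -pmulrn => ->.
  by rewrite addrA [w.2 t + _]addrN add0r addrC.
- have dt' : dominated pos (e t) (x *+ n.+1 - w.1).
    by rewrite -opprB; apply: dominatedN; rewrite NegzE mulrNz -pmulrn in dt.
  have /extensionE : witness t (n, w) by [].
  rewrite /value /= NegzE !mulrNz -!pmulrn => ->.
  by rewrite opprD addrA addrN add0r -hoelderN// opprB.
Qed.

Lemma extended_sub : G `<=` extended.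
Proof. by move=> w Gw; exists w, 0; rewrite mulr0z addr0. Qed.

Lemma extended_mem : extended (x, extension).
Proof. by exists 0, 1; rewrite mulr1z add0r. Qed.

End Extension.

(** A graph that is maximal among partial embeddings contains every x, since
    otherwise the extension by x would be larger. *)
Lemma total_embedding : exists phi : K -> T -> R,
  {morph phi : g h / g + h} /\ forall g, conform (g, phi g).
Proof.
have [|G [GP Gmax]] := @Zorn_bigcup _ partial_embedding.
  move=> F FP Ftot; split=> [a b [X FX Xa] [Y FY Yb]|a [X FX Xa]]; last first.
    exact: (FP _ FX).2.
  have [XY|YX] := Ftot _ _ FX FY.
    by exists Y => //; apply: (FP _ FY).1 => //; exact: XY.
  by exists X => //; apply: (FP _ FX).1 => //; exact: YX.
have conform0 : conform 0.
  split=> [|t _]; first exact: hahn_group0.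
  by rewrite hoelder0.
have G0 : G 0.
  have [[a Ga]|nG] := pselect (exists a, G a).
    by rewrite -(subrr a); exact: GP.1.
  case: (Gmax [set 0]).
    split; first by move=> a Ga; case: nG; exists a.
    by move=> /(_ 0 erefl) ?; apply: nG; exists 0.
  by split=> [a b -> ->|a ->//]; rewrite subr0.
have /choice[phi phiG] : forall x, exists f, G (x, f).
  move=> x; apply: contrapT => nx.
  apply: (Gmax (extended G x)); last exact: extended_partial.
  split; first exact: extended_sub.
  by move=> /(_ _ (extended_mem G0 x)) h; apply: nx; eexists; exact: h.
exists phi; split=> [g h|g]; last exact: GP.2.
have z : g + h - g - h = 0 by rewrite addrAC addrK subrr.
have [_] := GP.2 _ (GP.1 _ _ (GP.1 _ _ (phiG (g + h)) (phiG g)) (phiG h)).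
rewrite [X in forall t, dominated _ _ X -> _ = hoelder _ _ _ X]z => c.
apply/funext => t; have /eqP := c t (dominated0 posC _).
rewrite hoelder0// [X in X == 0](_ : _ = phi (g + h) t - phi g t - phi h t)//.
by rewrite !subr_eq add0r => /eqP->; rewrite addrC.
Qed.

(** The first coordinate of f is the one at the Archimedean class of g, and it is
    the ratio of g to the representative of that class. *)
Lemma hahn_pos_conform g f t : conform (g, f) -> pos g ->
  (exists n, cle pos g (e t *+ n)) -> (exists n, cle pos (e t) (g *+ n)) ->
  hahn_pos lt f.
Proof.
move=> [_ /= cf] pg [n gn] [m em].
have dg := dominated_pos posC (e_pos t) pg gn.
have ft : 0 < f t by rewrite cf//; exact: hoelder_gt0 em _.
exists t => //; split=> [|s]; first by rewrite /hahn_supp/= gt_eqF.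
rewrite /hahn_supp/=; have [->|st|] := index_total s t; [by left| |by right].
by have [ds rs] := dominated_lt st dg; rewrite cf// rs eqxx.
Qed.

Lemma hahn_pos_conformN g f t : conform (g, f) -> pos (- g) ->
  (exists n, cle pos (- g) (e t *+ n)) -> (exists n, cle pos (e t) (- g *+ n)) ->
  ~ hahn_pos lt f.
Proof.
move=> [_ /= cf] pg [n gn] [m em] [s [sf smin] fs].
have dg' := dominated_pos posC (e_pos t) pg gn.
have dg : dominated pos (e t) g by rewrite -(opprK g); exact: dominatedN.
have := hoelder_gt0 posC R (e_pos t) (e_neq0 t) dg' em pg.
rewrite hoelderN// -cf// oppr_gt0 => ft.
have ft0 : hahn_supp f t by rewrite /hahn_supp/= lt_eqF.
have [ts|st] := smin t ft0.
  by move: fs; rewrite -ts ltNge (ltW ft).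
by have [ds rs] := dominated_lt st dg; move: fs; rewrite cf// rs ltxx.
Qed.

End HahnEmbedding.

(** * Newton iteration for polar decompositions over a C*-algebra *)

Section MatrixNorm.
Variables (R : realType) (A : cstarAlgType R).

(** A Banach *-algebra norm on the square matrices that is a sum of values of
    atomic formulae, as opposed to the C*-norm. *)
Definition mxnorm m n (X : 'M[A]_(m, n)) : R := \sum_i \sum_j cnorm (X i j).

Section Basic.
Variables (m n : nat).
Implicit Types X Y : 'M[A]_(m, n).

Lemma mxnorm_ge0 X : 0 <= mxnorm X.
Proof. by do 2!apply: sumr_ge0 => ? _; exact: cnorm_ge0. Qed.

Lemma mxnorm0 : mxnorm (0 : 'M[A]_(m, n)) = 0.
Proof. by do 2!apply: big1 => ? _; rewrite mxE cnorm0. Qed.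

Lemma cnorm_le_mxnorm X i j : cnorm (X i j) <= mxnorm X.
Proof.
rewrite /mxnorm (bigD1 i)//= (bigD1 j)//= -addrA lerDl addr_ge0//.
  by apply: sumr_ge0 => ? _; exact: cnorm_ge0.
by do 2!apply: sumr_ge0 => ? _; exact: cnorm_ge0.
Qed.

Lemma mxnorm_eq0 X : mxnorm X <= 0 -> X = 0.
Proof.
move=> X0; apply/matrixP => i j; rewrite mxE; apply: cnorm0_eq0.
by apply/le_anti; rewrite cnorm_ge0 (le_trans (cnorm_le_mxnorm X i j)).
Qed.

Lemma mxnormD X Y : mxnorm (X + Y) <= mxnorm X + mxnorm Y.
Proof.
rewrite /mxnorm -big_split/=; apply: ler_sum => i _.
by rewrite -big_split/=; apply: ler_sum => j _; rewrite mxE cnormD_le.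
Qed.

Lemma mxnormN X : mxnorm (- X) = mxnorm X.
Proof. by do 2!apply: eq_bigr => ? _; rewrite mxE cnormN. Qed.

Lemma mxnormB X Y : mxnorm (X - Y) <= mxnorm X + mxnorm Y.
Proof. by rewrite -(mxnormN Y); exact: mxnormD. Qed.

Lemma mxnorm_sym X Y : mxnorm (X - Y) = mxnorm (Y - X).
Proof. by rewrite -mxnormN opprB. Qed.

Lemma mxnorm_dist Y X Z : mxnorm (X - Z) <= mxnorm (X - Y) + mxnorm (Y - Z).
Proof. by rewrite (le_trans _ (mxnormD _ _))// addrA subrK. Qed.

Lemma scale_algE (c : R[i]) X i j : (c%:A *: X) i j = c *: X i j.
Proof. by rewrite mxE mulr_algl. Qed.

Lemma mxnormZ (c : R[i]) X : mxnorm (c%:A *: X) = normc c * mxnorm X.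
Proof.
rewrite /mxnorm mulr_sumr; apply: eq_bigr => i _.
by rewrite mulr_sumr; apply: eq_bigr => j _; rewrite scale_algE cnormZ.
Qed.

Lemma mxnorm_adj X : mxnorm (adjmx X) = mxnorm X.
Proof.
rewrite /mxnorm exchange_big/=; apply: eq_bigr => i _; apply: eq_bigr => j _.
by rewrite !mxE cnorm_star.
Qed.

Lemma adjmxD X Y : adjmx (X + Y) = adjmx X + adjmx Y.
Proof. by apply/matrixP => i j; rewrite !mxE starD. Qed.

Lemma adjmxZ (c : R[i]) X : adjmx (c%:A *: X) = (Num.conj c)%:A *: adjmx X.
Proof. by apply/matrixP => i j; rewrite !mxE !mulr_algl starZ. Qed.

Lemma adjmxN X : adjmx (- X) = - adjmx X.
Proof.
by apply/eqP; rewrite -addr_eq0 -adjmxD addNr adjmx0.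
Qed.

Lemma adjmxB X Y : adjmx (X - Y) = adjmx X - adjmx Y.
Proof. by rewrite adjmxD adjmxN. Qed.

End Basic.

Lemma adjmx1 n : adjmx (1%:M : 'M[A]_n) = 1%:M.
Proof.
apply/matrixP => i j; rewrite !mxE eq_sym.
by case: eqP => _; rewrite ?star1 ?star0.
Qed.

Lemma mxnormM m n k (X : 'M[A]_(m, n)) (Y : 'M_(n, k)) :
  mxnorm (X *m Y) <= mxnorm X * mxnorm Y.
Proof.
rewrite /mxnorm mulr_suml; apply: ler_sum => i _.
apply: (@le_trans _ _ (\sum_l \sum_j cnorm (X i j) * cnorm (Y j l))).
  apply: ler_sum => l _; rewrite mxE.
  elim/big_ind2 : _ => [|u1 u2 v1 v2 h1 h2|j _]; first by rewrite cnorm0.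
    by rewrite (le_trans (cnormD_le _ _))// lerD.
  exact: cnormM_le.
rewrite exchange_big mulr_suml; apply: ler_sum => j _; rewrite -mulr_sumr.
rewrite ler_wpM2l ?cnorm_ge0// (bigD1 j)//= lerDl.
by do 2!apply: sumr_ge0 => ? _; exact: cnorm_ge0.
Qed.

Lemma scale_algAr m n k (c : R[i]) (X : 'M[A]_(m, n)) (Y : 'M_(n, k)) :
  X *m (c%:A *: Y) = c%:A *: (X *m Y).
Proof.
apply/matrixP => i j; rewrite scale_algE !mxE scaler_sumr.
by apply: eq_bigr => l _; rewrite scale_algE scalerAr.
Qed.

Lemma geometric_small (c e : R) : 0 < e -> exists t, c * 2 ^- t < e.
Proof.
move=> e0; have h2 : `|2^-1 : R| < 1 by rewrite ger0_norm ?invr_ge0//; lra.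
have /cvgrPdist_lt/(_ _ e0)[k _ /(_ k (leqnn k))] := cvg_geometric c h2.
rewrite /= /geometric/= sub0r normrN exprVn => h.
by exists k; exact: le_lt_trans (ler_norm _) h.
Qed.

Lemma le0_geometric (c y : R) : (forall t, y <= c * 2 ^- t) -> y <= 0.
Proof.
move=> h; rewrite leNgt; apply/negP => /(geometric_small c)[t].
by rewrite ltNge h.
Qed.

Lemma normc_real (r : R) : 0 <= r -> normc r%:C = r.
Proof. by move=> r0; rewrite /= expr0n addr0 sqrtr_sqr ger0_norm. Qed.

(** The limit is taken entry by entry, after rescaling the steps by 1 / c. The
    bound is linear in c so that small steps give a close limit. *)
Lemma mxnorm_fast m n (s : nat -> 'M[A]_(m, n)) (c : R) :
  (forall t, mxnorm (s t.+1 - s t) <= c * 2 ^- t) ->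
  exists w, forall t, mxnorm (s t - w) <= (m * n)%:R * (2 * c) * 2 ^- t.
Proof.
move=> sc; have c0 : 0 <= c.
  by have := le_trans (mxnorm_ge0 _) (sc 0%N); rewrite invr1 mulr1.
have [c00|cn0] := eqVneq c 0.
  exists (s 0) => t; rewrite c00 !(mulr0, mul0r).
  elim: t => [|t IH]; first by rewrite subrr mxnorm0.
  rewrite (le_trans (mxnorm_dist (s t) _ _))//.
  by have := sc t; rewrite c00 mul0r; lra.
have cp : 0 < c by rewrite lt_def cn0.
have nc : normc (c^-1)%:C = c^-1 by rewrite normc_real ?invr_ge0.
have /choice[b bP] : forall ij : 'I_m * 'I_n, exists b, forall t,
    cnorm ((c^-1)%:C *: s t ij.1 ij.2 - b) <= 2 * 2 ^- t.
  move=> [i j]; apply: cnorm_fast => t /=; rewrite -scalerBr cnormZ nc.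
  rewrite ler_pdivrMl// (le_trans _ (sc t))//.
  by have := cnorm_le_mxnorm (s t.+1 - s t) i j; rewrite !mxE.
exists (\matrix_(i, j) (c%:C *: b (i, j))) => t.
rewrite /mxnorm (@le_trans _ _ (\sum_(i < m) \sum_(j < n) (2 * c * 2 ^- t)))//.
  apply: ler_sum => i _; apply: ler_sum => j _; rewrite !mxE.
  have -> : s t i j = c%:C *: ((c^-1)%:C *: s t i j).
    by rewrite scalerA -rmorphM/= divff ?scale1r.
  rewrite -scalerBr cnormZ normc_real// mulrAC mulrC.
  by rewrite ler_wpM2r// (bP (i, j)).
rewrite !sumr_const !card_ord -mulrnA [(n * m)%N]mulnC.
by rewrite -[X in X <= _]mulr_natl !mulrA.
Qed.

Lemma scale_half2 (V : lmodType A) (v : V) :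
  ((2^-1)%:C : R[i])%:A *: (v + v) = v.
Proof.
rewrite scalerDr -scalerDl -scalerDl -rmorphD/=.
have -> : 2^-1 + 2^-1 = 1 :> R by lra.
by rewrite !scale1r.
Qed.

Section Polar.
Variables (m n : nat).
Implicit Types (x : 'M[A]_(m, n)) (p : 'M[A]_n).

Let h : R[i] := (2^-1)%:C.

Definition defect p x := p - adjmx x *m x.
(** One step of Newton's method for x (x^* x)^(-1/2) in the corner cut out by p,
    where (p - d)^(-1/2) is p + d / 2 to first order. *)
Definition polar_step p x := x + h%:A *: (x *m defect p x).

(** The terms of first order in d cancel in (p + d/2) (p - d) (p + d/2). *)
Lemma polar_step_defect p x (d := defect p x) :
  adjmx p = p -> p *m p = p -> x *m p = x ->
  defect p (polar_step p x) = d *m d - (h * h)%:A *: (d *m d - d *m d *m d).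
Proof.
move=> ps pp xp; have ds : adjmx d = d.
  by rewrite /d /defect adjmxB ps adjmxM adjmxK.
have px : p *m adjmx x = adjmx x by rewrite -{1}ps -adjmxM xp.
have dp : d *m p = d by rewrite /d /defect mulmxBl pp -mulmxA xp.
have pd : p *m d = d by rewrite /d /defect mulmxBr pp mulmxA px.
have S : adjmx x *m x = p - d by rewrite /d /defect opprB addrC subrK.
rewrite {1}/defect /polar_step -/d adjmxD adjmxZ adjmxM ds.
have -> : Num.conj h = h by rewrite /h conj_Creal// complex_real.
clearbody d.
have e1 : adjmx x *m (x *m d) = d - d *m d by rewrite mulmxA S mulmxBl pd.
have e2 : d *m adjmx x *m x = d - d *m d by rewrite -mulmxA S mulmxBr dp.
have e3 : d *m adjmx x *m (x *m d) = d *m d - d *m d *m d.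
  by rewrite mulmxA -(mulmxA d) S mulmxBr dp mulmxBl.
rewrite mulmxDl !mulmxDr -!scalemxAl !scale_algAr S e1 e2 e3.
rewrite [h%:A *: (h%:A *: _)]scalerA mulr_algl scalerA.
set E := (h * h)%:A *: _; rewrite addrA -[p - d + _ + _]addrA.
rewrite -[h%:A *: _ + _]scalerDr scale_half2.
by rewrite subrKA opprD addrA subKr.
Qed.

(** The quadratic bound, weakened to a geometric rate: 1/8 is small enough for
    5/4 u^2 + u^3 / 4 <= u / 4. *)
Lemma mxnorm_polar_step p x : adjmx p = p -> p *m p = p -> x *m p = x ->
  mxnorm (defect p x) <= 8^-1 ->
  mxnorm (defect p (polar_step p x)) <= mxnorm (defect p x) / 4.
Proof.
move=> ps pp xp; rewrite polar_step_defect//; set d := defect p x => d8.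
have d0 := mxnorm_ge0 d.
have b2 := mxnormM d d; have b3 := mxnormM (d *m d) d.
have := mxnormB (d *m d) ((h * h)%:A *: (d *m d - d *m d *m d)).
have := mxnormB (d *m d) (d *m d *m d).
rewrite mxnormZ normcM normc_real ?invr_ge0//.
move: (mxnorm _) (mxnorm _) (mxnorm _) (mxnorm _) (mxnorm _) b2 b3 d8 d0.
move=> m1 m2 m3 u m5 h5 h3 u8 u0 h2 h1.
(* u is the norm of d, m5 that of d^2 and m3 that of d^3. *)
have k5 : m5 <= u / 8 by nra.
have k3 : m3 <= u / 64 by nra.
by lra.
Qed.

Definition polar_iter p x t := iter t (polar_step p) x.

(** The factor 2 - 2^-t is an explicit increasing bound for the partial products
    of the 1 + 4^-t / 16, by which the norm of the iterates can grow. *)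
Lemma polar_iterP p x t : adjmx p = p -> p *m p = p -> x *m p = x ->
  mxnorm (defect p x) <= 8^-1 -> let y := polar_iter p x t in
  [/\ y *m p = y,
      mxnorm (defect p y) <= mxnorm (defect p x) * 4 ^- t &
      mxnorm y <= mxnorm x * (2 - 2 ^- t)].
Proof.
move=> ps pp xp d8; elim: t => [|t].
  by rewrite /= !invr1 mulr1; split=> //; lra.
rewrite [polar_iter p x t.+1]iterS -/(polar_iter p x t) /=.
move: (polar_iter p x t) => y [yp dy ny].
have d0 := mxnorm_ge0 (defect p x); have x0 := mxnorm_ge0 x.
have dyd : mxnorm (defect p y) <= mxnorm (defect p x).
  by rewrite (le_trans dy)// ler_piMr// invf_le1 ?exprn_gt0// exprn_ege1//; lra.
split.
- have dp : defect p y *m p = defect p y.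
    by rewrite /defect mulmxBl pp -mulmxA yp.
  by rewrite /polar_step mulmxDl yp -scalemxAl -mulmxA dp.
- rewrite (le_trans (mxnorm_polar_step ps pp yp (le_trans dyd d8)))//.
  by rewrite exprS invfM mulrCA mulrC ler_wpM2l ?invr_ge0.
- rewrite (le_trans (mxnormD _ _))// mxnormZ normc_real ?invr_ge0//.
  have := mxnormM y (defect p y); rewrite exprS invfM.
  have : mxnorm (defect p y) <= 8^-1 * 2 ^- t.
    rewrite (le_trans dy)// ler_pM// ?invr_ge0 ?exprn_ge0//.
    rewrite lef_pV2 ?posrE ?exprn_gt0// lerXn2r ?nnegrE//; lra.
  have : 0 <= (2 ^- t : R) by rewrite invr_ge0 exprn_ge0.
  have := mxnorm_ge0 y; have := mxnorm_ge0 (defect p y).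
  move: (mxnorm (defect p y)) (mxnorm (y *m _)) (mxnorm y) (mxnorm x) (2 ^- t)
    x0 ny => e z u v q v0 uv e0 u0 q0 eq ze.
  have : z <= v * (2 - q) * (8^-1 * q) by apply: le_trans ze _; apply: ler_pM.
  nra.
Qed.

Lemma mxnorm_lim_eq0 k l (Y : 'M[A]_(k, l)) (c : R) :
  (forall t, mxnorm Y <= c * 2 ^- t) -> Y = 0.
Proof. by move=> Yc; apply: mxnorm_eq0; exact: le0_geometric Yc. Qed.

(** The partial isometry of the polar decomposition of an x with x^* x close to
    a projection. The rate of convergence is part of the conclusion so that
    closed conditions on the iterates can be passed on to the limit. *)
Lemma polar p x : adjmx p = p -> p *m p = p -> x *m p = x ->
  mxnorm (defect p x) <= 8^-1 ->
  exists w, [/\ adjmx w *m w = p, w *m p = w,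
    mxnorm (x - w) <= (m * n)%:R * (2 * (mxnorm x * mxnorm (defect p x))) &
    forall t, mxnorm (polar_iter p x t - w) <=
      (m * n)%:R * (2 * (mxnorm x * mxnorm (defect p x))) * 2 ^- t].
Proof.
move=> ps pp xp d8.
have [|w hw] := @mxnorm_fast _ _ (polar_iter p x)
    (mxnorm x * mxnorm (defect p x)).
  move=> t; have [yp dy ny] := polar_iterP t ps pp xp d8.
  rewrite [polar_iter p x t.+1]iterS -/(polar_iter p x t) /=.
  move: (polar_iter p x t) yp dy ny => y yp dy ny.
  rewrite /polar_step addrAC subrr add0r mxnormZ normc_real ?invr_ge0//.
  have : (4 ^- t : R) <= 2 ^- t.
    by rewrite lef_pV2 ?posrE ?exprn_gt0// lerXn2r ?nnegrE//; lra.
  have : 0 <= (2 ^- t : R) by rewrite invr_ge0 exprn_ge0.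
  have := mxnormM y (defect p y); have := mxnorm_ge0 y.
  have := mxnorm_ge0 (defect p y).
  have := mxnorm_ge0 (defect p x); have := mxnorm_ge0 x; move: dy ny.
  move: (mxnorm (y *m _)) (mxnorm (defect p y)) (mxnorm y) (mxnorm x)
    (mxnorm (defect p x)) (2 ^- t) (4 ^- t).
  move=> z e u v d q r er uv v0 d0 e0 u0 zue q0 rq.
  have : z <= (v * 2) * (d * q).
    apply: le_trans zue _; apply: ler_pM => //.
      by apply: le_trans uv _; rewrite ler_wpM2l//; lra.
    by apply: le_trans er _; rewrite ler_wpM2l.
  by rewrite -!mulrA; lra.
set c := (m * n)%:R * _ in hw *.
have c0 : 0 <= c by do 2!rewrite mulr_ge0//; rewrite mulr_ge0 ?mxnorm_ge0.
have hw0 : mxnorm (x - w) <= c by have := hw 0%N; rewrite invr1 mulr1.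
exists w; split=> //.
- apply/eqP; rewrite eq_sym -subr_eq0; apply/eqP.
  apply: (@mxnorm_lim_eq0 _ _ _
    (mxnorm (defect p x) + mxnorm x * 2 * c + c * mxnorm w)).
  move=> t; have [yp dy ny] := polar_iterP t ps pp xp d8.
  move: (polar_iter p x t) yp dy ny (hw t) => y yp dy ny yw.
  have -> : p - adjmx w *m w =
      defect p y + (adjmx y *m (y - w) + (adjmx (y - w) *m w)).
    by rewrite adjmxB mulmxBr mulmxBl /defect !addrA !subrK.
  have q0 : 0 <= (2 ^- t : R) by rewrite invr_ge0 exprn_ge0.
  rewrite (le_trans (mxnormD _ _))// !mulrDl -addrA lerD//.
    rewrite (le_trans dy)// ler_wpM2l ?mxnorm_ge0//.
    by rewrite lef_pV2 ?posrE ?exprn_gt0// lerXn2r ?nnegrE//; lra.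
  rewrite (le_trans (mxnormD _ _))// lerD//.
    rewrite (le_trans (mxnormM _ _))// mxnorm_adj -mulrA.
    rewrite ler_pM ?mxnorm_ge0// (le_trans ny)//.
    by rewrite ler_wpM2l ?mxnorm_ge0//; lra.
  rewrite (le_trans (mxnormM _ _))// mxnorm_adj mulrAC.
  by rewrite ler_wpM2r ?mxnorm_ge0.
- apply/eqP; rewrite -subr_eq0; apply/eqP.
  apply: (@mxnorm_lim_eq0 _ _ _ (c * mxnorm p + c)) => t.
  have [yp _ _] := polar_iterP t ps pp xp d8.
  move: (polar_iter p x t) yp (hw t) => y yp yw.
  have -> : w *m p - w = (y - w) - (y - w) *m p.
    by rewrite mulmxBl yp opprB [RHS]addrC subrKA.
  rewrite (le_trans (mxnormB _ _))// mulrDl addrC lerD//.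
  rewrite (le_trans (mxnormM _ _))// mulrAC.
  by rewrite ler_wpM2r ?mxnorm_ge0.
Qed.

End Polar.

(** Every iterate lies in q M p when x does, and q M p is closed. *)
Lemma polar_left m n (p : 'M[A]_n) (q : 'M[A]_m) (x : 'M[A]_(m, n)) :
  adjmx p = p -> p *m p = p -> x *m p = x -> q *m x = x ->
  mxnorm (defect p x) <= 8^-1 ->
  exists w : 'M[A]_(m, n), [/\ adjmx w *m w = p, w *m p = w & q *m w = w].
Proof.
move=> ps pp xp qx d8; have [w [ww wp _ hw]] := polar ps pp xp d8.
exists w; split=> //; apply/eqP; rewrite -subr_eq0; apply/eqP.
set c := (m * n)%:R * _ in hw.
apply: (@mxnorm_lim_eq0 _ _ _ (mxnorm q * c + c)) => t.
have : q *m polar_iter p x t = polar_iter p x t.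
  elim: t => // t IH; rewrite [polar_iter p x t.+1]iterS -/(polar_iter p x t).
  by rewrite /polar_step mulmxDr IH scale_algAr mulmxA IH.
move: (polar_iter p x t) (hw t) => y yw qy.
have -> : q *m w - w = (y - w) - q *m (y - w).
  by rewrite mulmxBr qy opprB [RHS]addrC subrKA.
rewrite (le_trans (mxnormB _ _))// mulrDl addrC lerD//.
by rewrite (le_trans (mxnormM _ _))// -mulrA ler_wpM2l ?mxnorm_ge0.
Qed.

(** Compress the approximate partial isometry by the two projections and take
    the partial isometry of the polar decomposition of q v p. *)
Lemma approx_subequivalence m n (p : 'M[A]_n) (q : 'M[A]_m)
    (v : 'M[A]_(m, n)) (eps : R) :
  adjmx p = p -> p *m p = p -> adjmx q = q -> q *m q = q ->
  mxnorm (adjmx v *m v - p) <= eps -> mxnorm (q *m v - v) <= eps ->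
  mxnorm p * (eps + mxnorm v * eps) * mxnorm p <= 8^-1 ->
  exists w : 'M[A]_(m, n), [/\ adjmx w *m w = p, w *m p = w & q *m w = w].
Proof.
move=> ps pp qs qq vp qv small.
apply: (@polar_left _ _ p q (q *m v *m p)) => //; rewrite ?mulmxA ?qq//.
  by rewrite -mulmxA pp.
apply: le_trans small; rewrite /defect.
have -> : p - adjmx (q *m v *m p) *m (q *m v *m p) =
    p *m ((p - adjmx v *m v) + adjmx v *m (v - q *m v)) *m p.
  rewrite !adjmxM ps qs mulmxBr addrA subrK mulmxBr mulmxBl !mulmxA pp pp.
  by rewrite -(mulmxA _ q q) qq.
have p0 := mxnorm_ge0 p.
rewrite (le_trans (mxnormM _ _))// ler_wpM2r// (le_trans (mxnormM _ _))//.
rewrite ler_wpM2l// (le_trans (mxnormD _ _))// lerD// 1?mxnorm_sym//.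
rewrite (le_trans (mxnormM _ _))// mxnorm_adj ler_wpM2l ?mxnorm_ge0//.
by rewrite mxnorm_sym.
Qed.

(** The iteration at p = 1, which preserves selfadjointness. Through s = 2 p - 1
    it turns almost projections into projections. *)
Lemma symmetry_perturbation n (s : 'M[A]_n) : adjmx s = s ->
  mxnorm (1%:M - s *m s) <= 8^-1 ->
  exists u : 'M[A]_n, [/\ adjmx u = u, u *m u = 1%:M &
    mxnorm (s - u) <= (n * n)%:R * (2 * (mxnorm s * mxnorm (1%:M - s *m s)))].
Proof.
move=> ss; have dE : 1%:M - s *m s = defect 1%:M s by rewrite /defect ss.
rewrite dE => d8.
have [w [w1 _ sw hw]] := polar (adjmx1 n) (mul1mx 1%:M) (mulmx1 s) d8.
suff ws : adjmx w = w by exists w; split=> //; rewrite -{1}ws.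
apply/eqP; rewrite -subr_eq0; apply/eqP.
set c := (n * n)%:R * _ in hw.
apply: (@mxnorm_lim_eq0 _ _ _ (c + c)) => t.
have : adjmx (polar_iter 1%:M s t) = polar_iter 1%:M s t.
  elim: t => // t.
  rewrite [polar_iter 1%:M s t.+1]iterS -/(polar_iter 1%:M s t).
  move: (polar_iter 1%:M s t) => y ys.
  rewrite /polar_step adjmxD adjmxZ adjmxM ys; congr (_ + _).
  rewrite conj_Creal ?complex_real//; congr (_ *: _).
  rewrite /defect ys adjmxB adjmxM ys adjmx1.
  by rewrite mulmxBl mulmxBr mul1mx mulmx1 mulmxA.
move: (polar_iter 1%:M s t) (hw t) => y yw ys.
have -> : adjmx w - w = (y - w) - adjmx (y - w).
  by rewrite adjmxB ys opprB [RHS]addrC subrKA.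
by rewrite (le_trans (mxnormB _ _))// mxnorm_adj mulrDl lerD.
Qed.

(** The iteration at p = 1 again. *)
Lemma isometry_perturbation n (v : 'M[A]_n) :
  mxnorm (1%:M - adjmx v *m v) <= 8^-1 ->
  exists u : 'M[A]_n, adjmx u *m u = 1%:M /\
    mxnorm (v - u) <=
      (n * n)%:R * (2 * (mxnorm v * mxnorm (1%:M - adjmx v *m v))).
Proof.
move=> d8.
have [w [w1 _ vw _]] := polar (adjmx1 n) (mul1mx 1%:M) (mulmx1 v) d8.
by exists w.
Qed.

End MatrixNorm.

(** * Transfer of robust statements from matrix algebras *)

Section Blocks.
Variable R : realType.

Definition join T l m (y : 'I_l -> T) (x : 'I_m -> T) (i : 'I_(l + m)) : T :=
  match fintype.split i with inl j => y j | inr k => x k end.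

Lemma join_lshift T l m (y : 'I_l -> T) (x : 'I_m -> T) j :
  join y x (lshift m j) = y j.
Proof. by rewrite /join -[lshift m j]/(unsplit (inl j)) unsplitK. Qed.

Lemma join_rshift T l m (y : 'I_l -> T) (x : 'I_m -> T) j :
  join y x (rshift l j) = x j.
Proof. by rewrite /join -[rshift l j]/(unsplit (inr j)) unsplitK. Qed.

(** The existential variables are numbered before the universal ones because a
    quantifier binds variable 0: a formula in [join y x] becomes a sentence by
    infima over y followed by suprema over x. *)
Fixpoint close_sup m : formula R m -> formula R 0 :=
  match m with
  | 0 => id
  | _.+1 => fun phi => close_sup (FSup phi)
  end.

Fixpoint infs l m : formula R (l + m) -> formula R m :=
  match l with
  | 0 => id
  | l'.+1 => fun phi => @infs l' m (FInf (phi : formula R (l' + m).+1))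
  end.

Section Evaluation.
Variable A : cstarAlgType R.

Definition unit_ball n (v : 'I_n -> A) := forall i, cnorm (v i) <= 1.

(** Suprema and infima of unbounded sets of reals are junk values; keeping all
    values in [0, 1] makes every quantifier mean what it should. *)
Definition unit_valued n (phi : formula R n) :=
  forall v : 'I_n -> A, 0 <= feval phi v <= 1.

Let vals n (phi : formula R n.+1) (v : 'I_n -> A) :=
  [set feval phi (extend v a) | a in [set a | cnorm a <= 1]].

Let vals0 n (phi : formula R n.+1) (v : 'I_n -> A) : vals phi v !=set0.
Proof. by exists (feval phi (extend v 0)), 0 => //=; rewrite cnorm0. Qed.

Let vals_sup n (phi : formula R n.+1) v :
  unit_valued phi -> has_sup (vals phi v).
Proof.
by move=> u; split=> //; exists 1 => _ [a _ <-]; case/andP: (u (extend v a)).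
Qed.

Let vals_inf n (phi : formula R n.+1) v :
  unit_valued phi -> has_inf (vals phi v).
Proof.
by move=> u; split=> //; exists 0 => _ [a _ <-]; case/andP: (u (extend v a)).
Qed.

Lemma FSup_unit n (phi : formula R n.+1) :
  unit_valued phi -> unit_valued (FSup phi).
Proof.
move=> u v; apply/andP; split; last first.
  by apply: (ge_sup (vals0 phi v)) => _ [a _ <-]; case/andP: (u (extend v a)).
have [_ [a a1 _]] := vals0 phi v.
apply: le_trans (proj1 (andP (u (extend v a)))) _.
by apply: ub_le_sup; [case: (vals_sup v u)|exists a].
Qed.

Lemma FInf_unit n (phi : formula R n.+1) :
  unit_valued phi -> unit_valued (FInf phi).
Proof.
move=> u v; apply/andP; split.
  by apply: (lb_le_inf (vals0 phi v)) => _ [a _ <-]; case/andP: (u (extend v a)).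
have [_ [a a1 _]] := vals0 phi v.
apply: le_trans _ (proj2 (andP (u (extend v a)))).
by apply: ge_inf; [case: (vals_inf v u)|exists a].
Qed.

Lemma infs_unit l m (phi : formula R (l + m)) :
  unit_valued phi -> unit_valued (infs phi).
Proof. by elim: l phi => //= l IH phi u; apply: IH; exact: FInf_unit. Qed.

Lemma extend_lift n (w : 'I_n.+1 -> A) :
  extend (fun i => w (lift ord0 i)) (w ord0) = w.
Proof. by apply/funext => i; rewrite /extend; case: unliftP => [j ->|->]. Qed.

Lemma close_sup_le n (phi : formula R n) (c : R) : unit_valued phi ->
  sentence_value A (close_sup phi) <= c <->
  forall v : 'I_n -> A, unit_ball v -> feval phi v <= c.
Proof.
elim: n phi => [|n IH] phi u.
  rewrite /sentence_value /=; split=> [h v _|]; last by apply => -[].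
  by rewrite (_ : v = fun=> 0)//; apply/funext => -[].
rewrite (IH _ (FSup_unit u)); split=> h v bv.
  rewrite -(extend_lift v).
  apply: le_trans (h (fun i => v (lift ord0 i)) (fun i => bv _)).
  apply: ub_le_sup; first by case: (vals_sup (fun i => v (lift ord0 i)) u).
  by exists (v ord0); first exact: bv.
apply: (ge_sup (vals0 phi v)) => _ [a a1 <-]; apply: h => i.
by rewrite /extend; case: unlift.
Qed.

Lemma extend_join l m (y : 'I_l -> A) (x : 'I_m -> A) a :
  extend (join y x) a = join (extend y a) x :> ('I_(l.+1 + m) -> A).
Proof.
apply/funext => i; case: (split_ordP i) => j ->.
  rewrite join_lshift; case: (unliftP ord0 j) => [k|] ->.
    have -> : lshift m (lift ord0 k : 'I_l.+1) =
        lift (ord0 : 'I_(l + m).+1) (lshift m (k : 'I_l)) by exact: val_inj.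
    by rewrite /extend !liftK join_lshift.
  have -> : lshift m (ord0 : 'I_l.+1) = (ord0 : 'I_(l + m).+1) by exact: val_inj.
  by rewrite /extend !unlift_none.
have -> : rshift l.+1 j = lift (ord0 : 'I_(l + m).+1) (rshift l j).
  exact: val_inj.
rewrite [RHS](_ : _ = x j); last first.
  by rewrite -[RHS](join_rshift (extend y a)); congr join; exact: val_inj.
by rewrite /extend liftK join_rshift.
Qed.

Lemma infs_lt l m (phi : formula R (l + m)) (x : 'I_m -> A) (c : R) :
  unit_valued phi ->
  feval (infs phi) x < c <-> exists2 y, unit_ball y & feval phi (join y x) < c.
Proof.
elim: l phi => [|l IH] phi u.
  have E (y : 'I_0 -> A) : join y x = x :> ('I_(0 + m) -> A).
    apply/funext => i; case: (split_ordP i) => [[]//|j ->].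
    by rewrite join_rshift; congr x; exact: val_inj.
  split=> [h|[y _]]; last by rewrite E.
  by exists (fun=> 0) => [[]//|]; rewrite E.
rewrite /= (IH _ (FInf_unit u)); split=> [[y y1 h]|[y y1 h]].
  have [_ [a a1 <-] ha] := inf_lt (vals0 _ _) h.
  exists (extend y a); last by rewrite -extend_join.
  by move=> i; rewrite /extend; case: unlift.
exists (fun i => y (lift ord0 i)); first by move=> i; exact: y1.
apply: le_lt_trans h; apply: ge_inf.
  by case: (vals_inf (join (fun i => y (lift ord0 i)) x) u).
by exists (y ord0); rewrite ?extend_join ?extend_lift//; exact: y1.
Qed.

End Evaluation.

Fixpoint quantifier_free n (phi : formula R n) : Prop :=
  match phi with
  | FNorm _ _ => True
  | FConn _ _ _ _ phis => forall j, quantifier_free (phis j)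
  | _ => False
  end.

Section Los.
Variables (I : Type) (B : I -> cstarAlgType R).
Variables (U : set_system I) (UU : UltraFilter U).
Let ultra : cstarAlgType R := ultraproduct B UU.

Let pfamily n (P : star_polynomial R n) (v : 'I_n -> bfamily B) :
  exists b : bfamily B, (forall i, b i = peval P (fun j => v j i)) /\
    peval P (fun j => uclass UU (v j) : ultra) = uclass UU b.
Proof.
elim: P => [j||P [a [a1 a2]] Q [b [b1 b2]]|P [a [a1 a2]] Q [b [b1 b2]]|
            c P [a [a1 a2]]|P [a [a1 a2]]].
- by exists (v j).
- by exists (bone B).
- exists (badd a b); split=> [i|] /=; first by rewrite a1 b1.
  by rewrite a2 b2; exact: uadd_class.
- exists (bmul a b); split=> [i|] /=; first by rewrite a1 b1.
  by rewrite a2 b2; exact: umul_class.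
- exists (bscale c a); split=> [i|] /=; first by rewrite a1.
  by rewrite a2; exact: uscale_class.
- exists (bstar a); split=> [i|] /=; first by rewrite a1.
  by rewrite a2; exact: ustar_class.
Qed.

(** The quantifier-free case of the theorem of Los: *-polynomials are computed
    coordinatewise, the norm is an ultralimit, and connectives are
    continuous. *)
Lemma los n (phi : formula R n) (v : 'I_n -> bfamily B) : quantifier_free phi ->
  (fun i => feval phi (fun j => v j i)) @ U -->
  feval phi (fun j => uclass UU (v j) : ultra).
Proof.
move=> qf; elim: phi v qf => [{}n P v _|{}n k f cf phis IH v qf|//|//].
  have [b [b1 b2]] := pfamily P v; rewrite /= b2.
  under eq_fun do rewrite -b1.
  exact: unorm_cvg.
rewrite /=; apply: (@cvg_comp _ _ _ _ f); last exact: cf.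
apply/cvg_ballP => eps e0.
have : \forall i \near U, forall j : 'I_k,
    ball (feval (phis j) (fun j => uclass UU (v j) : ultra)) eps
         (feval (phis j) (fun j => v j i)).
  by apply: filter_forall => j; move/cvg_ballP: (IH j v (qf j)) => /(_ _ e0).
by apply: filterS => i h; split=> // a j; rewrite !mxE; exact: h.
Qed.

(** The coordinates of a representative are only asymptotically contractions;
    dividing each by the maximum of 1 and its norm changes them by a null
    family. *)
Lemma unit_ball_lift (a : ultra) : cnorm a <= 1 ->
  exists b : bfamily B, uclass UU b = a /\ forall i, cnorm (b i) <= 1.
Proof.
elim/uclassW: a => r r1.
pose c i := Num.max 1 (cnorm (r i)).
have c1 i : 1 <= c i by rewrite /c le_max lexx.
have c0 i : 0 < c i by rewrite (lt_le_trans _ (c1 i)).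
have nc i : normc ((c i)^-1)%:C = (c i)^-1 by rewrite normc_real ?invr_ge0 ?ltW.
have b1 i : cnorm (((c i)^-1)%:C *: r i) <= 1.
  by rewrite cnormZ nc ler_pdivrMl// mulr1 /c le_max lexx orbT.
exists (BFamily (ex_intro _ 1 b1)); split=> //.
apply/uclassP/bnullP => eps e0.
have /cvgrPdist_lt/(_ _ e0) := @unorm_cvg _ _ _ _ UU r; apply: filterS => i /= h.
have hr : cnorm (r i) < 1 + eps.
  move: h; rewrite distrC => /(le_lt_trans (ler_norm _)) h.
  by rewrite -ltrBlDl (le_lt_trans _ h)// lerB.
have -> : ((c i)^-1)%:C *: r i - r i = ((c i)^-1 - 1)%:C *: r i.
  by rewrite rmorphB/= scalerBl scale1r.
rewrite -cnormN -scaleNr -rmorphN/= opprB cnormZ normc_real; last first.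
  by rewrite subr_ge0 invf_le1.
have [ri|ri] := leP (cnorm (r i)) 1.
  by rewrite /c max_l// invr1 subrr mul0r.
rewrite /c max_r ?(ltW ri)// mulrBl mul1r mulVf ?gt_eqF ?(lt_trans ltr01 ri)//.
by rewrite ltrBlDl.
Qed.

End Los.

Definition clip (x : R) : R := Num.min 1 (Num.max 0 x).

Lemma clip_unit x : 0 <= clip x <= 1.
Proof. by rewrite /clip le_min ler01 le_max lexx ge_min lexx. Qed.

Lemma clip_continuous : continuous clip.
Proof.
move=> x; apply: continuous_min; first exact: cvg_cst.
by apply: continuous_max; [exact: cvg_cst|exact: cvg_id].
Qed.

(** With r 0 0 the error in the conclusion and r 0 1 the error in the hypothesis:
    this is the first one, cut off at 1, damped to 0 as the second one grows from
    0 to delta. *)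
Definition guard (delta : R) (r : 'rV[R]_2) : R :=
  clip (r 0 0) * clip (1 - delta^-1 * r 0 1).

Lemma guard_continuous delta : continuous (guard delta).
Proof.
have cc (j : 'I_2) : continuous (fun r : 'rV[R]_2 => r 0 j).
  exact: coord_continuous.
suff H (r : 'rV[R]_2) : {for r, continuous (guard delta)} by exact: H.
have c1 := continuous_comp (cc 0 r) (@clip_continuous (r 0 0)).
have cM : {for r, continuous (fun s : 'rV[R]_2 => delta^-1 * s 0 1)}.
  by apply: continuousM; [exact: cst_continuous|exact: cc].
have cB : {for r, continuous (fun s : 'rV[R]_2 => 1 - delta^-1 * s 0 1)}.
  by apply: continuousB; [exact: cst_continuous|exact: cM].
have c3 := continuous_comp cB (@clip_continuous (1 - delta^-1 * r 0 1)).
by apply: continuousM; [exact: c1|exact: c3].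
Qed.

(** D measures the failure of a hypothesis on x and E that of a conclusion on x
    and y. For a given eps, the guarded formula built from D and E has sup-inf
    value at most a fixed fraction of eps in all matrix algebras, hence in their
    ultraproduct by choosing the coordinates of y, hence in A by elementary
    equivalence. At an x with D = 0 the guard is inactive and E itself is
    small. *)
Lemma pseudomatricial_transfer l m (D E : formula R (l + m)) :
  quantifier_free D -> quantifier_free E ->
  (forall eps : R, 0 < eps -> exists2 delta : R, 0 < delta &
     forall n (x : 'I_m -> matrix_cstar R n), unit_ball x ->
     exists2 y : 'I_l -> matrix_cstar R n, unit_ball y &
       feval D (join y x) < delta -> feval E (join y x) <= eps) ->
  forall A : cstarAlgType R, pseudomatricial A ->
  forall x : 'I_m -> A, unit_ball x ->
  (forall y, feval D (join y x) = 0) ->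
  forall eps : R, 0 < eps ->
  exists2 y : 'I_l -> A, unit_ball y & feval E (join y x) < eps.
Proof.
move=> qD qE H A [I [U [UU [n AB]]]] x x1 Dx eps eps0.
(* The quarter leaves room for the strict inequality lost at each of the two
   changes of quantifier; staying below 1 makes clip injective there. *)
pose e0 := Num.min eps 1 / 4.
have e00 : 0 < e0 by rewrite divr_gt0// lt_min eps0 ltr01.
have e0_eps : 3 * e0 < eps.
  have : Num.min eps 1 <= eps by rewrite ge_min lexx.
  by move: eps0; rewrite /e0; lra.
have e0_1 : 3 * e0 < 1.
  have : Num.min eps 1 <= 1 by rewrite ge_min lexx orbT.
  by rewrite /e0; lra.
have [delta delta0 Hd] := H _ e00.
pose body : formula R (l + m) := FConn (guard_continuous (delta:=delta))
  (fun j : 'I_2 => if j == 0 then E else D).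
have bodyE (B : cstarAlgType R) (v : 'I_(l + m) -> B) :
    feval body v = clip (feval E v) * clip (1 - delta^-1 * feval D v).
  by rewrite /= /guard !mxE.
have body_unit (B : cstarAlgType R) : @unit_valued B _ body.
  move=> v; rewrite bodyE; have /andP[a0 a1] := clip_unit (feval E v).
  have /andP[b0 b1] := clip_unit (1 - delta^-1 * feval D v).
  by rewrite mulr_ge0//= mulr_ile1.
have body_matrix k (z : 'I_m -> matrix_cstar R k) : unit_ball z ->
    exists2 y, unit_ball y & feval body (join y z) <= e0.
  move=> /Hd[y y1 yD]; exists y => //; rewrite bodyE.
  have /andP[a0 a1] := clip_unit (feval E (join y z)).
  have /andP[b0 b1] := clip_unit (1 - delta^-1 * feval D (join y z)).
  have [/yD Ey|Dy] := ltP (feval D (join y z)) delta.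
    rewrite (le_trans (ler_piMr a0 b1))// /clip ge_min ge_max (ltW e00) Ey.
    by rewrite orbT.
  rewrite [X in _ * X](_ : _ = 0) ?mulr0 ?(ltW e00)//.
  rewrite /clip max_l ?min_r// subr_le0 mulrC ler_pdivlMr// mul1r.
  exact: Dy.
pose ultra : cstarAlgType R := ultraproduct (fun i => matrix_cstar R (n i)) UU.
have body_ultra (z : 'I_m -> ultra) : unit_ball z ->
    exists2 y, unit_ball y & feval body (join y z) <= e0.
  move=> z1; have /choice[b bP] := fun j => unit_ball_lift (z1 j).
  pose w i := cid2 (body_matrix (n i) (fun j => b j i) (fun j => (bP j).2 i)).
  pose y i : 'I_l -> matrix_cstar R (n i) := s2val (w i).
  have y1 i : unit_ball (y i) := s2valP (w i).
  have yle i : feval body (join (y i) (fun j => b j i)) <= e0 := s2valP' (w i).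
  have y_bounded j : exists M : R, forall i, cnorm (y i j) <= M.
    by exists 1 => i; exact: y1.
  pose yb j : bfamily (fun i => matrix_cstar R (n i)) := BFamily (y_bounded j).
  exists (fun j => uclass UU (yb j)).
    by move=> j; apply: unorm_le => i; exact: y1.
  have qb : quantifier_free body by move=> j /=; case: ifP.
  have := @los I _ U UU _ body (join yb b) qb.
  have -> : (fun j => uclass UU (join yb b j) : ultra) =
      join (fun j => uclass UU (yb j)) z.
    apply/funext => j; rewrite /join; case: fintype.split => // k.
    by rewrite (bP k).1.
  set c := feval body (join _ z); move=> /cvgrPdist_lt cl.
  rewrite leNgt; apply/negP; rewrite -subr_gt0 => /cl/filter_ex[i /=].
  have -> : (fun j => join yb b j i) = join (y i) (fun j => b j i).
    by apply/funext => j; rewrite /join; case: fintype.split.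
  move=> /(le_lt_trans (ler_norm _)); rewrite ltrD2l ltrN2 ltNge.
  by rewrite yle.
have inf_unit (B : cstarAlgType R) := infs_unit (body_unit B).
have : sentence_value ultra (close_sup (infs body)) <= 2 * e0.
  apply/(close_sup_le _ (inf_unit _)) => z /body_ultra[y y1 yle].
  apply/ltW/(infs_lt _ _ (body_unit _)); exists y => //.
  by apply: le_lt_trans yle _; lra.
rewrite -AB => /(close_sup_le _ (inf_unit _))/(_ x x1) hx.
have : feval (infs body) x < 3 * e0 by apply: le_lt_trans hx _; lra.
move=> /(infs_lt _ _ (body_unit _))[y y1]; rewrite bodyE Dx mulr0 subr0.
have -> : clip 1 = 1 by rewrite /clip max_r// minxx.
rewrite mulr1 /clip gt_min ltNge (ltW e0_1)/= gt_max => /andP[_ Ey].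
by exists y => //; exact: lt_trans Ey _.
Qed.

End Blocks.

(** * Formulae about matrices *)

Section SymbolicMatrices.
Variables (R : realType) (n k : nat).
Local Notation SM := 'M[star_polynomial R n]_k.

Definition pzero : star_polynomial R n := PScale 0 (POne R n).
(** Matrices of *-polynomials are not a ring, as polynomials are syntactic
    objects; these operations agree with those of matrices after evaluation. *)
Definition smul (P Q : SM) : SM :=
  \matrix_(i, j) \big[@PAdd R n/pzero]_l PMul (P i l) (Q l j).
Definition sadd (P Q : SM) : SM := \matrix_(i, j) PAdd (P i j) (Q i j).
Definition sscale (c : R[i]) (P : SM) : SM := map_mx (PScale c) P.
Definition sadj (P : SM) : SM := (map_mx (@PStar R n) P)^T.
Definition sone : SM := \matrix_(i, j) (if i == j then POne R n else pzero).
Definition ssub (P Q : SM) : SM := sadd P (sscale (-1) Q).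
Definition svar (f : 'I_(k * k) -> 'I_n) : SM :=
  \matrix_(i, j) PVar R (f (mxvec_index i j)).

Definition unvec T (y : 'I_(k * k) -> T) : 'M[T]_k :=
  \matrix_(i, j) y (mxvec_index i j).

Lemma unvecK T (X : 'M[T]_k) : unvec (fun a => mxvec X 0 a) = X.
Proof. by apply/matrixP => i j; rewrite mxE mxvecE. Qed.

Section Eval.
Variables (A : cstarAlgType R) (v : 'I_n -> A).

Definition meval (P : SM) : 'M[A]_k := map_mx (fun t => peval t v) P.

Let peval0 : peval pzero v = 0. Proof. by rewrite /= scale0r. Qed.

Lemma meval_mul P Q : meval (smul P Q) = meval P *m meval Q.
Proof.
apply/matrixP => i j; rewrite !mxE.
rewrite (big_morph (fun t => peval t v) (id1 := 0) (op1 := +%R))//.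
by apply: eq_bigr => l _; rewrite !mxE.
Qed.

Lemma meval_add P Q : meval (sadd P Q) = meval P + meval Q.
Proof. by apply/matrixP => i j; rewrite !mxE. Qed.

Lemma meval_scale c P : meval (sscale c P) = c%:A *: meval P.
Proof. by apply/matrixP => i j; rewrite !mxE mulr_algl. Qed.

Lemma meval_sub P Q : meval (ssub P Q) = meval P - meval Q.
Proof. by rewrite meval_add meval_scale !scaleN1r. Qed.

Lemma meval_adj P : meval (sadj P) = adjmx (meval P).
Proof. by apply/matrixP => i j; rewrite !mxE. Qed.

Lemma meval_one : meval sone = 1%:M.
Proof.
by apply/matrixP => i j; rewrite !mxE; case: eqP => _ //=; rewrite scale0r.
Qed.

Lemma meval_var f : meval (svar f) = unvec (v \o f).
Proof. by apply/matrixP => i j; rewrite !mxE. Qed.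

Definition mevalE := (meval_sub, meval_mul, meval_adj, meval_one).

End Eval.

End SymbolicMatrices.

Section Connectives.
Variables (R : realType) (n : nat).

Lemma sum_continuous d : continuous (fun r : 'rV[R]_d => \sum_j r 0 j).
Proof.
suff H s (r : 'rV[R]_d) :
    continuous_at r (fun r : 'rV[R]_d => \sum_(j <- s) r 0 j) by exact: H.
elim: s => [|j s IH].
  rewrite (_ : (fun _ => _) = fun=> 0); first exact: cst_continuous.
  by apply/funext => x; rewrite big_nil.
rewrite (_ : (fun _ => _) = fun x : 'rV[R]_d => x 0 j + \sum_(j <- s) x 0 j).
  by apply: continuousD => //; exact: coord_continuous.
by apply/funext => x; rewrite big_cons.
Qed.

Lemma min2_continuous :
  continuous (fun r : 'rV[R]_2 => Num.min (r 0 0) (r 0 1)).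
Proof.
suff H (r : 'rV[R]_2) :
    {for r, continuous (fun r : 'rV[R]_2 => Num.min (r 0 0) (r 0 1))}.
  exact: H.
by apply: continuous_min; exact: coord_continuous.
Qed.

Definition pair_formula (phi psi : formula R n) (j : 'I_2) : formula R n :=
  if j == 0 then phi else psi.

Definition fplus (phi psi : formula R n) : formula R n :=
  FConn (@sum_continuous 2) (pair_formula phi psi).

Definition fmin (phi psi : formula R n) : formula R n :=
  FConn min2_continuous (pair_formula phi psi).

Definition fnorm k (P : 'M[star_polynomial R n]_k) : formula R n :=
  FConn (@sum_continuous (k * k)) (fun a => FNorm (mxvec P 0 a)).

Lemma quantifier_free_fplus phi psi : quantifier_free phi ->
  quantifier_free psi -> quantifier_free (fplus phi psi).
Proof. by move=> qphi qpsi j; rewrite /pair_formula; case: ifP. Qed.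

Lemma quantifier_free_fmin phi psi : quantifier_free phi ->
  quantifier_free psi -> quantifier_free (fmin phi psi).
Proof. by move=> qphi qpsi j; rewrite /pair_formula; case: ifP. Qed.

Lemma quantifier_free_fnorm k (P : 'M[star_polynomial R n]_k) :
  quantifier_free (fnorm P).
Proof. by []. Qed.

Variables (A : cstarAlgType R) (v : 'I_n -> A).

Lemma feval_fplus phi psi : feval (fplus phi psi) v = feval phi v + feval psi v.
Proof. by rewrite /= big_ord_recl big_ord1 !mxE. Qed.

Lemma feval_fmin phi psi :
  feval (fmin phi psi) v = Num.min (feval phi v) (feval psi v).
Proof. by rewrite /= !mxE. Qed.

Lemma feval_fnorm k (P : 'M[star_polynomial R n]_k) :
  feval (fnorm P) v = mxnorm (meval v P).
Proof.
rewrite /= /mxnorm pair_bigA (reindex _ (curry_mxvec_bij _ _)) /=.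
by apply: eq_bigr => -[i j] _; rewrite !mxE -/(mxvec P) mxvecE.
Qed.

End Connectives.

Lemma mxnorm_unit_ball (R : realType) (A : cstarAlgType R) k
    (y : 'I_(k * k) -> A) :
  unit_ball y -> mxnorm (unvec y) <= (k * k)%:R.
Proof.
move=> y1; rewrite /mxnorm.
apply: (@le_trans _ _ (\sum_(i < k) \sum_(j < k) 1)).
  by apply: ler_sum => i _; apply: ler_sum => j _; rewrite mxE.
by rewrite !sumr_const !card_ord -mulrnA.
Qed.

(** * Projections in matrices over a full matrix algebra *)

Section ScalarProjections.
Variable C : numClosedFieldType.
Local Notation "M ^*t" := (map_mx Num.conj M^T) (at level 30).

Lemma ctmul m n p (X : 'M[C]_(m, n)) (Y : 'M_(n, p)) :
  (X *m Y)^*t = Y^*t *m X^*t.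
Proof. by rewrite trmx_mul map_mxM. Qed.

(** A projection is determined by its range, so an orthonormal basis [U] of
    its row space, obtained by Gram-Schmidt, writes it as U^* U. *)
Lemma projection_factor n (P : 'M[C]_n) : P^*t = P -> P *m P = P ->
  exists U : 'M[C]_(\rank P, n), U *m U^*t = 1%:M /\ U^*t *m U = P.
Proof.
move=> Ps PP; pose U := schmidt (row_base P); exists U.
have /unitarymxP U1 : U \is unitarymx.
  by apply: schmidt_unitarymx; exact: rank_leq_row.
split=> //; set E := U^*t *m U.
have UP : (U :=: P)%MS.
  by apply: eqmx_trans (eqmx_schmidt_free (row_base_free P)) (eq_row_base P).
have PE : P *m E = P.
  have /submxP[D PD] : (P <= U)%MS by rewrite UP.
  by rewrite PD /E mulmxA -(mulmxA D) U1 mulmx1.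
have EP : E *m P = E.
  have /submxP[D ->] : (E <= P)%MS by rewrite -UP submxMl.
  by rewrite -mulmxA PP.
have Es : E^*t = E by rewrite /E ctmul trmxCK.
by rewrite -[RHS]Ps -PE ctmul Es Ps.
Qed.

(** Send the orthonormal basis of the range of P to an initial part of that of
    the range of Q. *)
Lemma scalar_subequivalence n (P Q : 'M[C]_n) :
  P^*t = P -> P *m P = P -> Q^*t = Q -> Q *m Q = Q ->
  (\rank P <= \rank Q)%N -> exists V : 'M[C]_n, V^*t *m V = P /\ Q *m V = V.
Proof.
move=> Ps PP Qs QQ PQ; have [U [U1 UP]] := projection_factor Ps PP.
have [W [W1 WQ]] := projection_factor Qs QQ.
pose J : 'M[C]_(\rank Q, \rank P) := pid_mx (\rank P).
have JJ : J^*t *m J = 1%:M.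
  by rewrite /J tr_pid_mx map_pid_mx pid_mx_id// pid_mx_1.
exists (W^*t *m J *m U); split.
  rewrite !ctmul trmxCK !mulmxA -(mulmxA _ W) W1 mulmx1.
  by rewrite -(mulmxA _ _ J) JJ mulmx1.
transitivity (W^*t *m W *m (W^*t *m J *m U)); first by rewrite WQ.
by rewrite !mulmxA -(mulmxA _ W) W1 mulmx1.
Qed.

End ScalarProjections.

Section Flattening.
Variables (R : realType) (n k : nat).
Local Notation C := R[i].
Local Notation B := (matrix_cstar R n).
Local Notation N := (k * n.+1)%N.

(** The isomorphism of M_k(M_n(C)) with M_kn(C). *)
Definition flat (X : 'M[B]_k) : 'M[C]_N :=
  \matrix_(a, b) mxvec (\matrix_(i < k, x < n.+1)
    mxvec (\matrix_(j < k, y < n.+1) (X i j : 'M[C]_n.+1) x y) 0 b) 0 a.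

Definition unflat (M : 'M[C]_N) : 'M[B]_k :=
  \matrix_(i, j) ((\matrix_(x, y) M (mxvec_index i x) (mxvec_index j y)) : B).

Lemma flatE X i x j y :
  flat X (mxvec_index i x) (mxvec_index j y) = (X i j : 'M[C]_n.+1) x y.
Proof. by rewrite mxE mxvecE mxE mxvecE mxE. Qed.

Lemma unflatK M : flat (unflat M) = M.
Proof.
apply/matrixP => a b; case/mxvec_indexP: a => i x; case/mxvec_indexP: b => j y.
by rewrite flatE !mxE.
Qed.

Lemma flat_inj : injective flat.
Proof.
move=> X Y XY; apply/matrixP => i j; apply/matrixP => x y.
by rewrite -!flatE XY.
Qed.

Lemma sum_mxvec_index (V : nmodType) (F : 'I_N -> V) :
  \sum_a F a = \sum_i \sum_x F (mxvec_index i x).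
Proof.
rewrite pair_bigA (reindex _ (curry_mxvec_bij _ _)) /=.
by apply: eq_bigr => -[].
Qed.

Lemma flatM X Y : flat (X *m Y) = flat X *m flat Y.
Proof.
apply/matrixP => a b; case/mxvec_indexP: a => i x; case/mxvec_indexP: b => j y.
rewrite flatE !mxE summxE sum_mxvec_index; apply: eq_bigr => l _.
rewrite [LHS]mxE; apply: eq_bigr => z _.
by rewrite !flatE.
Qed.

Lemma flat_adj X : flat (adjmx X) = map_mx Num.conj (flat X)^T.
Proof.
apply/matrixP => a b; case/mxvec_indexP: a => i x; case/mxvec_indexP: b => j y.
rewrite flatE mxE [in RHS]mxE [X in _ = X^*%R]mxE flatE.
by rewrite [X in (X : 'M[C]_n.+1) x y]mxE [LHS]mxE [LHS]mxE.
Qed.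

Lemma flat1 : flat 1%:M = 1%:M.
Proof.
apply/matrixP => a b; case/mxvec_indexP: a => i x; case/mxvec_indexP: b => j y.
rewrite flatE [X in (X : 'M[C]_n.+1) x y]mxE [RHS]mxE.
rewrite /mxvec_index (inj_eq (@cast_ord_inj _ _ _)) (inj_eq enum_rank_inj).
by rewrite xpair_eqE; case: (i == j); rewrite ?mulr1n ?mulr0n mxE.
Qed.

(** Compressing to a corner does not increase the operator norm. *)
Lemma cnorm_le_flat (X : 'M[B]_k) i j : cnorm (X i j) <= opnorm (flat X).
Proof.
apply: opnorm_le => [|u]; first exact: opnorm_ge0.
(* u placed in the j-th block of a vector that is zero elsewhere. *)
pose u' : 'cV[C]_N := (\row_a mxvec
  (\matrix_(l < k, y < n.+1) (if l == j then u y 0 else 0)) 0 a)^T.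
have u'E l y : u' (mxvec_index l y) 0 = if l == j then u y 0 else 0.
  by rewrite !mxE mxvecE mxE.
have <- : enorm u' = enorm u.
  rewrite /enorm sum_mxvec_index (bigD1 j)//= [X in _ + X]big1 ?addr0.
    by congr Num.sqrt; apply: eq_bigr => y _; rewrite u'E eqxx.
  by move=> l /negPf lj; apply: big1 => y _; rewrite u'E lj normc0 expr0n.
apply: le_trans (enorm_le_opnorm _ _).
rewrite /enorm ler_sqrt; last by apply: sumr_ge0 => a _; exact: sqr_ge0.
rewrite sum_mxvec_index (bigD1 i)//=.
have -> : \sum_x normc ((X i j *m u) x 0) ^+ 2 =
    \sum_x normc ((flat X *m u') (mxvec_index i x) 0) ^+ 2.
  apply: eq_bigr => x _; rewrite !mxE; congr (normc _ ^+ 2).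
  rewrite sum_mxvec_index (bigD1 j)//= [X in _ + X]big1 ?addr0.
    by apply: eq_bigr => y _; rewrite flatE u'E eqxx.
  by move=> l /negPf lj; apply: big1 => y _; rewrite u'E lj mulr0.
by rewrite lerDl; do 2!apply: sumr_ge0 => ? _; exact: sqr_ge0.
Qed.

Lemma opnorm_projection_le1 m (P : 'M[C]_m) :
  mxadj P = P -> P *m P = P -> opnorm P <= 1.
Proof.
move=> Ps PP; have := opnorm_adjM P; rewrite Ps PP => /eqP.
rewrite expr2 -subr_eq0 -{1}[opnorm P]mulr1 -mulrBr mulf_eq0 subr_eq0.
by case/orP => /eqP; [move=> ->; exact: ler01|move=> <-].
Qed.

(** By rank. The entries of the partial isometry are contractions, uniformly in
    n, so that quantifiers over the unit ball reach them. *)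
Lemma matrix_comparison (p q : 'M[B]_k) :
  adjmx p = p -> p *m p = p -> adjmx q = q -> q *m q = q ->
  exists v : 'M[B]_k, (forall i j, cnorm (v i j) <= 1) /\
    (adjmx v *m v = p /\ q *m v = v \/ adjmx v *m v = q /\ p *m v = v).
Proof.
wlog pq : p q / (\rank (flat p) <= \rank (flat q))%N => [H ps pp qs qq|].
  have [pq|/ltnW qp] := leqP (\rank (flat p)) (\rank (flat q)).
    exact: H.
  by have [v [v1 []]] := H _ _ qp qs qq ps pp; exists v; split=> //; [right|left].
move=> ps pp qs qq.
have [V [VV QV]] : exists V : 'M_N,
    map_mx Num.conj V^T *m V = flat p /\ flat q *m V = V.
  by apply: scalar_subequivalence; rewrite -?flat_adj -?flatM ?ps ?pp ?qs ?qq.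
exists (unflat V); split=> [i j|].
  rewrite (le_trans (cnorm_le_flat _ _ _))// unflatK.
  rewrite -(@expr_le1 _ 2)// ?opnorm_ge0// -opnorm_adjM.
  have -> : mxadj V *m V = flat p by rewrite /mxadj map_trmx VV.
  apply: opnorm_projection_le1.
    by rewrite /mxadj map_trmx -flat_adj ps.
  by rewrite -flatM pp.
by left; split; apply: flat_inj; rewrite flatM ?flat_adj unflatK.
Qed.

Lemma matrix_isometry_unitary (u : 'M[B]_k) :
  adjmx u *m u = 1%:M -> u *m adjmx u = 1%:M.
Proof.
move=> /(congr1 flat); rewrite flatM flat1 => /mulmx1C; rewrite -flatM -flat1.
exact: flat_inj.
Qed.

End Flattening.

(** * Comparison and stable finiteness in pseudomatricial algebras *)

Section Transferred.
Variables (R : realType) (k : nat).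

Let k2 : R := (k * k)%:R.
Let k20 : 0 <= k2. Proof. exact: ler0n. Qed.

(** Quantifiers range over the unit ball, so a matrix with larger entries is
    represented as T times a matrix of variables; T is fixed before the
    sentence is written. *)
Section Finite.
Variable T : R.

Let V : 'M[star_polynomial R (0 + k * k)]_k :=
  sscale T%:C (svar R (fun a => rshift 0 a)).
Let D := fnorm (ssub (sone R _ k) (smul (sadj V) V)).
Let E := fnorm (ssub (sone R _ k) (smul V (sadj V))).

Let mevalV (A : cstarAlgType R) y (x : 'I_(k * k) -> A) :
  meval (join y x) V = (T%:C)%:A *: unvec x.
Proof.
rewrite meval_scale meval_var; congr (_ *: unvec _).
by apply/funext => a /=; rewrite join_rshift.
Qed.

Let evalD (A : cstarAlgType R) y (x : 'I_(k * k) -> A)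
    (v := (T%:C)%:A *: unvec x) :
  feval D (join y x) = mxnorm (1%:M - adjmx v *m v).
Proof. by rewrite feval_fnorm !mevalE mevalV. Qed.

Let evalE (A : cstarAlgType R) y (x : 'I_(k * k) -> A)
    (v := (T%:C)%:A *: unvec x) :
  feval E (join y x) = mxnorm (1%:M - v *m adjmx v).
Proof. by rewrite feval_fnorm !mevalE mevalV. Qed.

Hypothesis T0 : 0 <= T.

Let bound (A : cstarAlgType R) (x : 'I_(k * k) -> A) : unit_ball x ->
  mxnorm ((T%:C)%:A *: unvec x) <= T * k2.
Proof.
by move=> x1; rewrite mxnormZ normc_real// ler_wpM2l// mxnorm_unit_ball.
Qed.

Lemma finite_scaled (A : cstarAlgType R) : pseudomatricial A ->
  forall x : 'I_(k * k) -> A, unit_ball x -> let v := (T%:C)%:A *: unvec x in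
  adjmx v *m v = 1%:M -> v *m adjmx v = 1%:M.
Proof.
move=> pA x x1 v vv.
suff : forall eps, 0 < eps -> mxnorm (1%:M - v *m adjmx v) < eps.
  move=> h; apply/eqP; rewrite eq_sym -subr_eq0; apply/eqP/mxnorm_eq0.
  by rewrite leNgt; apply/negP => /h; rewrite ltxx.
move=> eps eps0.
have [||eps' eps'0|y|y _] :=
  @pseudomatricial_transfer R 0 (k * k) D E _ _ _ A pA x x1 _ _ eps0.
- by [].
- by [].
- have e8 : 8^-1 <= 1 :> R by rewrite invf_le1 ?ltr0n// ler1n.
  (* S bounds the norm of w, L d the distance from w to the isometry u, and
     hence S + L the norm of u. *)
  pose S := T * k2; pose L := k2 * (2 * S).
  have S0 : 0 <= S by rewrite mulr_ge0.
  have L0 : 0 <= L by rewrite !mulr_ge0.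
  pose Q := L * (2 * S + L) + 1.
  have Q0 : 0 < Q by rewrite ltr_wpDl// mulr_ge0// addr_ge0// mulr_ge0.
  exists (Num.min 8^-1 (eps' / Q)).
    by rewrite lt_min invr_gt0 ltr0n divr_gt0.
  move=> n z z1; exists (fun=> 0); first by case.
  rewrite evalD evalE lt_min => /andP[/ltW d8 dQ].
  have zS := bound z1; set w := _ *: _ in d8 dQ zS *.
  have [u [uu wu]] := isometry_perturbation d8.
  rewrite -(matrix_isometry_unitary uu).
  set d := mxnorm _ in d8 dQ wu.
  have d0 : 0 <= d by exact: mxnorm_ge0.
  have {}wu : mxnorm (w - u) <= L * d.
    have -> : L * d = k2 * (2 * (S * d)) by rewrite /L !mulrA.
    by rewrite (le_trans wu)// ler_wpM2l// ler_wpM2l// ler_wpM2r.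
  have uS : mxnorm u <= S + L.
    rewrite -[u](subKr w) (le_trans (mxnormB _ _))// lerD// (le_trans wu)//.
    exact: ler_piMr L0 (le_trans d8 e8).
  have -> : u *m adjmx u - w *m adjmx w =
      (u - w) *m adjmx u + w *m adjmx (u - w).
    by rewrite adjmxB mulmxBl mulmxBr addrA subrK.
  rewrite (le_trans (mxnormD _ _))//.
  have a1 := mxnormM (u - w) (adjmx u); have a2 := mxnormM w (adjmx (u - w)).
  rewrite !mxnorm_adj [mxnorm (u - w)]mxnorm_sym in a1 a2.
  have b1 : mxnorm (w - u) * mxnorm u <= L * d * (S + L).
    exact: ler_pM (mxnorm_ge0 _) (mxnorm_ge0 _) wu uS.
  have b2 : mxnorm w * mxnorm (w - u) <= S * (L * d).
    exact: ler_pM (mxnorm_ge0 _) (mxnorm_ge0 _) zS wu.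
  apply: le_trans (lerD (le_trans a1 b1) (le_trans a2 b2)) _.
  apply: (@le_trans _ _ (d * Q)); last by rewrite -ler_pdivlMr// ltW.
  rewrite (_ : d * Q = L * d * (S + L) + S * (L * d) + d).
    by rewrite lerDl.
  by rewrite /Q; ring.
- by rewrite evalD -/v vv subrr mxnorm0.
- by rewrite evalE.
Qed.

End Finite.

Lemma rescale (A : cstarAlgType R) (T : R) (X : 'M[A]_k) : 0 < T ->
  mxnorm X <= T -> exists2 x : 'I_(k * k) -> A, unit_ball x &
    (T%:C)%:A *: unvec x = X.
Proof.
move=> T0 XT; exists (fun a => mxvec (((T^-1)%:C)%:A *: X) 0 a); last first.
  rewrite unvecK scalerA mulr_algl scalerA -rmorphM/= divff ?gt_eqF//.
  by rewrite !scale1r.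
move=> a; case/mxvec_indexP: a => i j; rewrite mxvecE scale_algE cnormZ.
rewrite normc_real ?invr_ge0 ?(ltW T0)// ler_pdivrMl// mulr1.
exact: le_trans (cnorm_le_mxnorm X i j) XT.
Qed.

(** Stable finiteness. It is robust in matrix algebras: an almost isometry is
    close to an isometry, which is unitary by dimension. *)
Lemma isometry_unitary (A : cstarAlgType R) (v : 'M[A]_k) : pseudomatricial A ->
  adjmx v *m v = 1%:M -> v *m adjmx v = 1%:M.
Proof.
move=> pA; have T0 : 0 < mxnorm v + 1 by rewrite ltr_wpDl ?mxnorm_ge0.
have [|x x1 <-] := rescale T0 (X := v); first by rewrite lerDl.
exact: finite_scaled (ltW T0) _ pA _ x1.
Qed.

Let h : R[i] := (2^-1)%:C.

(** The correspondence between symmetries s and projections (1 + s) / 2. *)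
Definition half_plus (A : cstarAlgType R) (s : 'M[A]_k) : 'M[A]_k :=
  h%:A *: (1%:M + s).

Section HalfPlus.
Variables (A : cstarAlgType R) (s : 'M[A]_k).
Hypothesis ss : adjmx s = s.

Lemma half_plus_adj : adjmx (half_plus s) = half_plus s.
Proof.
by rewrite /half_plus adjmxZ conj_Creal ?complex_real// adjmxD adjmx1 ss.
Qed.

Lemma half_plus_idem :
  s *m s = 1%:M -> half_plus s *m half_plus s = half_plus s.
Proof.
move=> s1; rewrite /half_plus -scalemxAl scale_algAr; congr (_ *: _).
rewrite mulmxDl !mulmxDr !mul1mx mulmx1 s1 [s + _]addrC.
exact: scale_half2.
Qed.

End HalfPlus.

Lemma mxnorm_half_plusB (A : cstarAlgType R) (s t : 'M[A]_k) :
  mxnorm (half_plus s - half_plus t) = 2^-1 * mxnorm (s - t).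
Proof.
rewrite /half_plus -scalerBr mxnormZ normc_real ?invr_ge0//.
by rewrite opprD addrACA subrr add0r.
Qed.

(** How far v is from implementing a subequivalence of p to q. *)
Definition subequiv_error (A : cstarAlgType R) (p q v : 'M[A]_k) : R :=
  mxnorm (adjmx v *m v - p) + mxnorm (q *m v - v).

Lemma subequiv_error_perturb (A : cstarAlgType R) (p q p' q' v : 'M[A]_k)
    (c : R) :
  adjmx v *m v = p' -> q' *m v = v -> mxnorm v <= k2 ->
  mxnorm (p - p') <= c -> mxnorm (q - q') <= c ->
  subequiv_error p q v <= c * (1 + k2).
Proof.
move=> vp qv v2 pp qq; rewrite /subequiv_error vp mulrDr mulr1 lerD//.
  by rewrite mxnorm_sym.
rewrite -{2}qv -mulmxBl (le_trans (mxnormM _ _))// ler_pM ?mxnorm_ge0//.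
Qed.

(** Comparison is robust in matrix algebras: almost symmetries are close to
    symmetries, and the corresponding projections are comparable by rank. The
    choice of delta depends on the bound S but not on n. *)
Lemma matrix_approx_comparison (S : R) : 0 <= S ->
  forall eps : R, 0 < eps -> exists2 delta : R, 0 < delta &
  forall n (s t : 'M[matrix_cstar R n]_k), adjmx s = s -> adjmx t = t ->
    mxnorm s <= S -> mxnorm t <= S ->
    mxnorm (1%:M - s *m s) + mxnorm (1%:M - t *m t) < delta ->
    exists2 v : 'M_k, forall i j, cnorm (v i j) <= 1 &
      Num.min (subequiv_error (half_plus s) (half_plus t) v)
              (subequiv_error (half_plus t) (half_plus s) v) <= eps.
Proof.
move=> S0 eps eps0.
have e8 : 8^-1 <= 1 :> R by rewrite invf_le1 ?ltr0n// ler1n.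
pose Q := k2 * S * (1 + k2) + 1.
have Q0 : 0 < Q by rewrite ltr_wpDl// !mulr_ge0// addr_ge0.
exists (Num.min 8^-1 (eps / Q)).
  by rewrite lt_min invr_gt0 ltr0n divr_gt0.
move=> n s t ss tt sS tS.
have [d ds [dt ->]] : exists2 d, mxnorm (1%:M - s *m s) <= d &
    mxnorm (1%:M - t *m t) <= d /\
    mxnorm (1%:M - s *m s) + mxnorm (1%:M - t *m t) = d.
  move: (mxnorm_ge0 (1%:M - s *m s)) (mxnorm_ge0 (1%:M - t *m t)).
  move: (mxnorm (1%:M - s *m s)) (mxnorm (1%:M - t *m t)) => a b a0 b0.
  by exists (a + b); [rewrite lerDl|rewrite lerDr].
have d0 := le_trans (mxnorm_ge0 _) ds.
rewrite lt_min => /andP[/ltW d8 dQ].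
have near (x : 'M[matrix_cstar R n]_k) : adjmx x = x -> mxnorm x <= S ->
    mxnorm (1%:M - x *m x) <= d ->
    exists u, [/\ adjmx u = u, u *m u = 1%:M &
      mxnorm (half_plus x - half_plus u) <= k2 * (S * d)].
  move=> xx xS dx.
  have [u [us uu xu]] := symmetry_perturbation xx (le_trans dx d8).
  exists u; split=> //; rewrite mxnorm_half_plusB.
  rewrite ler_pdivrMl// mulrCA; apply: le_trans xu _.
  rewrite ler_wpM2l// ler_wpM2l//.
  by apply: ler_pM => //; exact: mxnorm_ge0.
have [u [us uu su]] := near s ss sS ds.
have [w [ws ww tw]] := near t tt tS dt.
have [v [v1 vpq]] := matrix_comparison (half_plus_adj us) (half_plus_idem uu)
  (half_plus_adj ws) (half_plus_idem ww).
exists v => //.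
have v2 : mxnorm v <= k2.
  rewrite -(unvecK v) mxnorm_unit_ball// => a.
  by case/mxvec_indexP: a => i j; rewrite mxvecE.
have small : k2 * (S * d) * (1 + k2) <= eps.
  apply: (@le_trans _ _ (d * Q)); last by rewrite -ler_pdivlMr// ltW.
  rewrite (_ : d * Q = k2 * (S * d) * (1 + k2) + d); first by rewrite lerDl.
  by rewrite /Q; ring.
rewrite ge_min; case: vpq => -[vp qv]; apply/orP; [left|right];
  apply: le_trans small.
  exact: subequiv_error_perturb vp qv v2 su tw.
exact: subequiv_error_perturb vp qv v2 tw su.
Qed.

Section Comparison.
Variable T : R.
Hypothesis T0 : 0 <= T.

Let nvar := (k * k + (k * k + k * k))%N.
Let X1 : 'M[star_polynomial R nvar]_k :=
  svar R (fun a => rshift (k * k) (lshift (k * k) a)).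
Let X2 : 'M[star_polynomial R nvar]_k :=
  svar R (fun a => rshift (k * k) (rshift (k * k) a)).
Let V : 'M[star_polynomial R nvar]_k :=
  svar R (fun a => lshift (k * k + k * k) a).
Let sym (X : 'M[star_polynomial R nvar]_k) := sscale T%:C (sadd X (sadj X)).
Let half (X : 'M[star_polynomial R nvar]_k) := sscale h (sadd (sone R _ k) X).
Let serror P Q :=
  fplus (fnorm (ssub (smul (sadj V) V) P)) (fnorm (ssub (smul Q V) V)).
Let D := fplus (fnorm (ssub (sone R _ k) (smul (sym X1) (sym X1))))
               (fnorm (ssub (sone R _ k) (smul (sym X2) (sym X2)))).
Let E := fmin (serror (half (sym X1)) (half (sym X2)))
              (serror (half (sym X2)) (half (sym X1))).

(** A parametrization of selfadjoint matrices, which leaves s^2 = 1 as the only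
    condition to be approximated. *)
Definition scaled_sym (A : cstarAlgType R) (x : 'I_(k * k) -> A) : 'M[A]_k :=
  (T%:C)%:A *: (unvec x + adjmx (unvec x)).

Lemma scaled_sym_adj (A : cstarAlgType R) (x : 'I_(k * k) -> A) :
  adjmx (scaled_sym x) = scaled_sym x.
Proof.
rewrite /scaled_sym adjmxZ conj_Creal ?complex_real// adjmxD adjmxK.
by rewrite [X in _ *: X]addrC.
Qed.

Lemma mxnorm_scaled_sym (A : cstarAlgType R) (x : 'I_(k * k) -> A) :
  unit_ball x -> mxnorm (scaled_sym x) <= T * (2 * k2).
Proof.
move=> x1; rewrite mxnormZ normc_real// ler_wpM2l//.
rewrite (le_trans (mxnormD _ _))// mxnorm_adj mulrDl mul1r.
by rewrite lerD// mxnorm_unit_ball.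
Qed.

Section Eval.
Variables (A : cstarAlgType R) (y : 'I_(k * k) -> A).
Variable x : 'I_(k * k + k * k) -> A.
Let x1 a := x (lshift (k * k) a).
Let x2 a := x (rshift (k * k) a).

Let meval_sym1 : meval (join y x) (sym X1) = scaled_sym x1.
Proof.
rewrite meval_scale meval_add meval_adj meval_var /scaled_sym.
rewrite (_ : _ \o _ = x1)//.
by apply/funext => a; rewrite /= join_rshift.
Qed.

Let meval_sym2 : meval (join y x) (sym X2) = scaled_sym x2.
Proof.
rewrite meval_scale meval_add meval_adj meval_var /scaled_sym.
rewrite (_ : _ \o _ = x2)//.
by apply/funext => a; rewrite /= join_rshift.
Qed.

Let meval_V : meval (join y x) V = unvec y.
Proof.
rewrite meval_var (_ : _ \o _ = y)//.
by apply/funext => a; rewrite /= join_lshift.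
Qed.

Let meval_half X : meval (join y x) (half X) = half_plus (meval (join y x) X).
Proof. by rewrite meval_scale meval_add meval_one. Qed.

Let eval_serror P Q : feval (serror P Q) (join y x) =
  subequiv_error (meval (join y x) P) (meval (join y x) Q) (unvec y).
Proof.
by rewrite feval_fplus !feval_fnorm !meval_sub !meval_mul meval_adj meval_V.
Qed.

Lemma eval_compD : feval D (join y x) =
  mxnorm (1%:M - scaled_sym x1 *m scaled_sym x1) +
  mxnorm (1%:M - scaled_sym x2 *m scaled_sym x2).
Proof.
rewrite feval_fplus !feval_fnorm !meval_sub !meval_mul meval_one.
by rewrite meval_sym1 meval_sym2.
Qed.

Lemma eval_compE : feval E (join y x) =
  let p := half_plus (scaled_sym x1) in let q := half_plus (scaled_sym x2) in
  Num.min (subequiv_error p q (unvec y)) (subequiv_error q p (unvec y)).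
Proof. by rewrite feval_fmin !eval_serror !meval_half meval_sym1 meval_sym2. Qed.

End Eval.

Lemma scaled_comparison (A : cstarAlgType R) : pseudomatricial A ->
  forall x1 x2 : 'I_(k * k) -> A, unit_ball x1 -> unit_ball x2 ->
  let s := scaled_sym x1 in let t := scaled_sym x2 in
  s *m s = 1%:M -> t *m t = 1%:M ->
  forall eps : R, 0 < eps -> exists2 v : 'M[A]_k, mxnorm v <= k2 &
    Num.min (subequiv_error (half_plus s) (half_plus t) v)
            (subequiv_error (half_plus t) (half_plus s) v) < eps.
Proof.
move=> pA x1 x2 b1 b2 s t ss tt eps eps0.
have xE1 : (fun a => join x1 x2 (lshift (k * k) a)) = x1.
  by apply/funext => a; rewrite join_lshift.
have xE2 : (fun a => join x1 x2 (rshift (k * k) a)) = x2.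
  by apply/funext => a; rewrite join_rshift.
have qD : quantifier_free D.
  by apply: quantifier_free_fplus; exact: quantifier_free_fnorm.
have qE : quantifier_free E.
  by apply: quantifier_free_fmin; apply: quantifier_free_fplus;
    exact: quantifier_free_fnorm.
have [||y|y y1] :=
  @pseudomatricial_transfer R _ _ D E qD qE _ A pA (join x1 x2) _ _ _ eps0.
- move=> eps' eps'0.
  have S0 : 0 <= T * (2 * k2) by rewrite !mulr_ge0.
  have [delta delta0 H] := matrix_approx_comparison S0 eps'0.
  exists delta => // n z z1.
  have z11 : unit_ball (fun a => z (lshift (k * k) a)) by move=> a; exact: z1.
  have z12 : unit_ball (fun a => z (rshift (k * k) a)) by move=> a; exact: z1.
  have {}H := H n _ _ (scaled_sym_adj _) (scaled_sym_adj _)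
    (mxnorm_scaled_sym z11) (mxnorm_scaled_sym z12).
  have [Ddelta|Ddelta] := ltP (feval D (join (fun=> 0) z)) delta; last first.
    exists (fun=> 0); first by move=> a; rewrite cnorm0.
    by rewrite ltNge Ddelta.
  move: Ddelta; rewrite eval_compD => /H[v v1 hv].
  exists (fun a => mxvec v 0 a).
    by move=> a; case/mxvec_indexP: a => i j; rewrite mxvecE.
  by rewrite eval_compE unvecK.
- by move=> a; rewrite /join; case: fintype.split.
- by rewrite eval_compD xE1 xE2 -/s -/t ss tt subrr mxnorm0 addr0.
- rewrite eval_compE xE1 xE2 => h1; exists (unvec y) => //.
  exact: mxnorm_unit_ball.
Qed.

End Comparison.

Lemma projection_symmetry (A : cstarAlgType R) (p : 'M[A]_k) :
  adjmx p = p -> p *m p = p ->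
  exists s, [/\ adjmx s = s, s *m s = 1%:M & half_plus s = p].
Proof.
move=> ps pp; exists (p + p - 1%:M); split.
- by rewrite adjmxB adjmxD adjmx1 ps.
- rewrite mulmxBl !mulmxBr mulmxDl !mulmxDr pp !mulmx1 !mul1mx.
  by rewrite addrK subKr.
- by rewrite /half_plus addrC subrK scale_half2.
Qed.

(** Transfer yields an approximate subequivalence, to any precision; the
    precision 1 / (8 c) is what [approx_subequivalence] asks for, with c bounding
    its constant for both orders of p and q. *)
Lemma projection_comparison (A : cstarAlgType R) (p q : 'M[A]_k) :
  pseudomatricial A ->
  adjmx p = p -> p *m p = p -> adjmx q = q -> q *m q = q ->
  exists w : 'M[A]_k, [/\ adjmx w *m w = p, w *m p = w & q *m w = w] \/
                      [/\ adjmx w *m w = q, w *m q = w & p *m w = w].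
Proof.
move=> pA ps pp qs qq.
have [s [ss s1 sp]] := projection_symmetry ps pp.
have [t [ts t1 tq]] := projection_symmetry qs qq.
pose T := mxnorm s + mxnorm t + 1.
have T0 : 0 < T by rewrite ltr_wpDl// addr_ge0 ?mxnorm_ge0.
have sym (x : 'M[A]_k) : adjmx x = x -> mxnorm x <= T ->
    exists2 y : 'I_(k * k) -> A, unit_ball y & scaled_sym T y = x.
  move=> xx xT; have [|y y1 yx] := rescale T0 (X := h%:A *: x).
    rewrite mxnormZ normc_real ?invr_ge0// (le_trans _ xT)//.
    by rewrite ler_piMl ?mxnorm_ge0// invf_le1// ler1n.
  exists y => //; rewrite /scaled_sym scalerDr yx.
  have -> : (T%:C)%:A *: adjmx (unvec y) = adjmx ((T%:C)%:A *: unvec y).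
    by rewrite adjmxZ conj_Creal ?complex_real.
  by rewrite yx adjmxZ conj_Creal ?complex_real// xx -scalerDr scale_half2.
have sT : mxnorm s <= T by rewrite /T -addrA lerDl addr_ge0 ?mxnorm_ge0.
have tT : mxnorm t <= T by rewrite /T addrAC lerDr addr_ge0 ?mxnorm_ge0.
have [x1 b1 e1] := sym _ ss sT; have [x2 b2 e2] := sym _ ts tT.
pose c := mxnorm p * (1 + k2) * mxnorm p + mxnorm q * (1 + k2) * mxnorm q + 1.
have p0 : 0 <= mxnorm p * (1 + k2) * mxnorm p.
  by rewrite !mulr_ge0 ?addr_ge0 ?mxnorm_ge0.
have q0 : 0 <= mxnorm q * (1 + k2) * mxnorm q.
  by rewrite !mulr_ge0 ?addr_ge0 ?mxnorm_ge0.
have c0 : 0 < c by rewrite ltr_wpDl// addr_ge0.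
have e0 : 0 < 8^-1 / c by rewrite divr_gt0 ?invr_gt0 ?ltr0n.
have [||v v2] := @scaled_comparison T (ltW T0) A pA x1 x2 b1 b2 _ _ _ e0.
- by rewrite e1.
- by rewrite e2.
rewrite e1 e2 sp tq gt_min => /orP hv.
have small (r : 'M[A]_k) : mxnorm r * (1 + k2) * mxnorm r <= c ->
    mxnorm r * (8^-1 / c + mxnorm v * (8^-1 / c)) * mxnorm r <= 8^-1.
  move=> rc; have r0 := mxnorm_ge0 r.
  apply: (@le_trans _ _ (mxnorm r * (1 + k2) * mxnorm r * (8^-1 / c))).
    rewrite [leRHS]mulrAC ler_wpM2r// -mulrA ler_wpM2l// mulrDl mul1r lerD2l.
    by rewrite ler_wpM2r// ltW.
  by rewrite mulrCA ler_piMr ?invr_ge0// ler_pdivrMr// mul1r.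
have approx (a b : 'M[A]_k) : adjmx a = a -> a *m a = a -> adjmx b = b ->
    b *m b = b -> mxnorm a * (1 + k2) * mxnorm a <= c ->
    subequiv_error a b v < 8^-1 / c ->
    exists w : 'M[A]_k, [/\ adjmx w *m w = a, w *m a = w & b *m w = w].
  move=> aa a2 bb b3 /small ac /ltW er.
  apply: approx_subequivalence ac => //; apply: le_trans er.
    by rewrite /subequiv_error lerDl mxnorm_ge0.
  by rewrite /subequiv_error lerDr mxnorm_ge0.
case: hv => [/(approx p q ps pp qs qq)|/(approx q p qs qq ps pp)] [|w hw].
- by rewrite /c -addrA lerDl addr_ge0.
- by exists w; left.
- by rewrite /c addrAC lerDr addr_ge0.
- by exists w; right.
Qed.

End Transferred.

(** * The order on K_0 *)

Section ClassArithmetic.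
Variables (R : realType) (A : cstarAlgType R).
Implicit Types p q r : projection A.

Lemma adjmx_col m1 m2 n (a : 'M[A]_(m1, n)) (b : 'M[A]_(m2, n)) :
  adjmx (col_mx a b) = row_mx (adjmx a) (adjmx b).
Proof. by rewrite /adjmx map_col_mx tr_col_mx. Qed.

Lemma K0_class_dsum p q : K0_class (dsum p q) = K0_class p + K0_class q.
Proof.
by rewrite /K0_class -groth_inD; congr groth_in; rewrite -Vadd_class.
Qed.

Lemma K0_class_mvn p q (v : 'M[A]_(pdim q, pdim p)) :
  adjmx v *m v = p -> v *m adjmx v = q -> K0_class p = K0_class q.
Proof. by move=> vp vq; congr groth_in; apply/VclassP; exists v. Qed.

Lemma K0_class0 p : pmx p = 0 -> K0_class p = 0.
Proof.
by move=> p0; rewrite (@K0_class_mvn p (projection0 A) 0) ?mulmx0 ?mul0mx.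
Qed.

Lemma K0_classB (g : K0 A) : exists p q, g = K0_class p - K0_class q.
Proof.
elim/groth_classW: g => x; exists (Vrepr x.1), (Vrepr x.2).
by rewrite groth_classE /K0_class !VreprK.
Qed.

(** q is the orthogonal sum of the range projection e of v, which is equivalent
    to p, and of q - e. *)
Lemma K0_class_sub p q (v : 'M[A]_(pdim q, pdim p)) :
  adjmx v *m v = p -> v *m p = v -> q *m v = v ->
  exists r, K0_class q = K0_class p + K0_class r.
Proof.
move=> vv vp qv; have [qs qq] := pmxP q.
pose e := v *m adjmx v.
have es : adjmx e = e by rewrite /e adjmxM adjmxK.
have ee : e *m e = e by rewrite /e mulmxA -(mulmxA v) vv vp.
have qe : q *m e = e by rewrite /e mulmxA qv.
have eq_ : e *m q = e by rewrite -[LHS]adjmxK adjmxM es qs qe.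
pose f := pmx q - e.
have ef : e *m f = 0 by rewrite mulmxBr eq_ ee subrr.
have fe : f *m e = 0 by rewrite mulmxBl qe ee subrr.
have fs : adjmx f = f by rewrite adjmxB qs es.
have ff : f *m f = f.
  by rewrite [LHS]mulmxBl ef subr0 mulmxBr qq qe.
have eP : is_projection e by [].
have fP : is_projection f by [].
exists (Projection fP).
rewrite (@K0_class_mvn p (Projection eP) v)// -K0_class_dsum.
apply: (@K0_class_mvn q (dsum (Projection eP) (Projection fP))
  (col_mx e f)).
  by rewrite adjmx_col mul_row_col es fs ee ff addrC subrK.
by rewrite adjmx_col mul_col_row es fs /= ee ff ef fe.
Qed.

Hypothesis pA : pseudomatricial A.

Definition subequivalence p q (v : 'M[A]_(pdim q, pdim p)) : Prop :=
  [/\ adjmx v *m v = p, v *m p = v & q *m v = v].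

(** Two projections of different sizes are compared inside matrices of the sum
    of the sizes, where p fills the upper and q the lower corner. *)
Lemma subequivalence_total p q :
  (exists v, @subequivalence p q v) \/ (exists v, @subequivalence q p v).
Proof.
have [ps pp] := pmxP p; have [qs qq] := pmxP q.
pose p' : 'M[A]_(pdim p + pdim q) := block_mx (p : 'M_(pdim p)) 0 0 0.
pose q' : 'M[A]_(pdim p + pdim q) := block_mx 0 0 0 (q : 'M_(pdim q)).
have [||||w] := @projection_comparison _ _ A p' q' pA.
- by rewrite adjmx_block ps !adjmx0.
- by rewrite mulmx_block !mulmx0 !mul0mx !addr0 pp.
- by rewrite adjmx_block qs !adjmx0.
- by rewrite mulmx_block !mulmx0 !mul0mx !add0r qq.
rewrite -(submxK w) adjmx_block !mulmx_block !mulmx0 !mul0mx !addr0 !add0r.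
case=> -[/eq_block_mx[e1 e2 e3 e4] /eq_block_mx[f1 f2 f3 f4]
         /eq_block_mx[g1 g2 g3 g4]].
  left; exists (dlsubmx w); split=> //.
  by rewrite -[RHS]e1 -g1 mulmx0 add0r.
right; exists (ursubmx w); split=> //.
by rewrite -[RHS]e4 -g4 mulmx0 addr0.
Qed.

Lemma K0_class_comparison p q :
  (exists r, K0_class q = K0_class p + K0_class r) \/
  (exists r, K0_class p = K0_class q + K0_class r).
Proof.
by have [[v [vv vp qv]]|[v [vv vp qv]]] := subequivalence_total p q;
  [left|right]; exact: K0_class_sub vv vp qv.
Qed.

(** If the class is zero, p + r is equivalent to r for some r. The equivalence u
    maps p + r onto the lower corner r, so that adding the identity on the
    complement of p + r gives an isometry with range projection 1 - p; it is
    unitary by stable finiteness. *)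
Lemma K0_class_eq0 p : K0_class p = 0 -> pmx p = 0.
Proof.
move=> /groth_classP[x] /=; rewrite !addr0 add0r -(VreprK x).
set r := Vrepr x; rewrite -[Vclass p + _]/(Vadd _ _) Vadd_class.
move=> /VclassP[v [vv vv']].
have [ps pp] := pmxP p; have [rs rr] := pmxP r.
have [Ps PP] := pmxP (dsum p r); set P := pmx (dsum p r) in vv Ps PP.
(* Compressing v makes the relations w P = w and r w = w available. *)
pose w := (r : 'M_(pdim r)) *m v *m P.
have ws : adjmx w = P *m adjmx v *m r by rewrite /w !adjmxM Ps rs mulmxA.
have ww : adjmx w *m w = P.
  rewrite ws /w !mulmxA -(mulmxA _ (r : 'M_(pdim r)) r) rr -vv'.
  by rewrite !mulmxA -(mulmxA P) vv PP -(mulmxA P) vv PP PP.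
have vPv : v *m P *m adjmx v = r by rewrite -vv !mulmxA vv' -mulmxA vv' rr.
have ww' : w *m adjmx w = r.
  have -> : w *m adjmx w = pmx r *m (v *m P *m adjmx v) *m pmx r.
    by rewrite ws /w !mulmxA -(mulmxA _ P P) PP.
  by rewrite vPv rr rr.
have wP : w *m P = w by rewrite /w -mulmxA PP.
have rw : (r : 'M_(pdim r)) *m w = w by rewrite /w !mulmxA rr.
pose u : 'M[A]_(pdim p + pdim r) := col_mx 0 w.
have uu : adjmx u *m u = P by rewrite adjmx_col mul_row_col adjmx0 mul0mx add0r.
have uP : u *m P = u by rewrite mul_col_mx mul0mx wP.
have Pu : P *m u = u.
  by rewrite /P /= mul_block_col !mul0mx mulmx0 !add0r rw.
have Pu' : adjmx u *m P = adjmx u by rewrite -[LHS]adjmxK adjmxM adjmxK Ps Pu.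
have uP' : P *m adjmx u = adjmx u by rewrite -[LHS]adjmxK adjmxM adjmxK Ps uP.
pose z := 1%:M - P.
have zs : adjmx z = z by rewrite /z adjmxB adjmx1 Ps.
have zz : z *m z = z.
  by rewrite {2}/z mulmxBr mulmx1 /z mulmxBl mul1mx PP subrr subr0.
have zu : z *m u = 0 by rewrite /z mulmxBl mul1mx Pu subrr.
have uz : u *m z = 0 by rewrite /z mulmxBr mulmx1 uP subrr.
have zu' : z *m adjmx u = 0 by rewrite /z mulmxBl mul1mx uP' subrr.
have uz' : adjmx u *m z = 0 by rewrite /z mulmxBr mulmx1 Pu' subrr.
have Pz : P + z = 1%:M by rewrite /z addrC subrK.
clearbody z.
have : (u + z) *m adjmx (u + z) = 1%:M.
  apply: isometry_unitary => //.
  rewrite adjmxD zs mulmxDl !mulmxDr uu zz zu uz' addr0 add0r.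
  exact: Pz.
rewrite adjmxD zs mulmxDl !mulmxDr zz zu' uz addr0 add0r -Pz => /addIr.
rewrite adjmx_col mul_col_row !mul0mx adjmx0 mulmx0 ww'.
by case/eq_block_mx.
Qed.

Definition K0_pos : set (K0 A) := [set g | exists p, g = K0_class p].

(** Antisymmetry is stable finiteness, totality is comparison. *)
Lemma K0_total_cone : total_cone K0_pos.
Proof.
split=> [_ _ [p ->] [q ->]|_ [p ->] [q pq]|g].
- by exists (dsum p q); rewrite K0_class_dsum.
- have /K0_class_eq0 : K0_class (dsum p q) = 0.
    by rewrite K0_class_dsum -pq subrr.
  by rewrite -[0]block_mx0 => /eq_block_mx[/K0_class0].
- have [p [q ->]] := K0_classB g.
  have [[r ->]|[r ->]] := K0_class_comparison p q; [right|left]; exists r.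
    by rewrite opprB addrAC subrr add0r.
  by rewrite addrAC subrr add0r.
Qed.

End ClassArithmetic.

(** * The kernel of the trace on K_0 *)

Section TraceKernel.
Variables (R : realType) (A : cstarAlgType R) (tr : tracial_state A).

Lemma K0_tr0 : K0_tr tr 0 = 0.
Proof. by apply: (addrI (K0_tr tr 0)); rewrite -K0_trD !addr0. Qed.

Lemma K0_trN g : K0_tr tr (- g) = - K0_tr tr g.
Proof. by apply: (addrI (K0_tr tr g)); rewrite -K0_trD !subrr K0_tr0. Qed.

Lemma projection_tr_ge0 (p : projection A) : 0 <= projection_tr tr p.
Proof.
have [ps pp] := pmxP p.
have : 0 <= \sum_i tr (p i i).
  apply: sumr_ge0 => i _; rewrite -pp mxE linear_sum/=; apply: sumr_ge0 => j _.
  by rewrite -{1}ps !mxE tr_ge0.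
by rewrite lecE => /andP[].
Qed.

Lemma K0_tr_elt (p : A) (hp : is_elt_projection p) :
  K0_tr tr (K0_class (elt_projection hp)) = complex.Re (tr p).
Proof. by rewrite K0_tr_class /projection_tr big_ord1 mxE mulr1n. Qed.

Lemma tr_elt_eq0 (p : A) (hp : is_elt_projection p) :
  complex.Re (tr p) = 0 -> tr p = 0.
Proof.
have := tr_ge0 tr p; have [-> ->] := hp; rewrite lecE => /andP[/eqP].
by case: (tr p) => a b /= -> _ ->.
Qed.

Hypothesis pA : pseudomatricial A.

(** Compare p with the unit of A. If the unit were subequivalent to p, the trace
    of p would be at least 1; so p is equivalent to a subprojection of the unit,
    which is an element of A. *)
Lemma K0_class_trace_zero (p : projection A) :
  projection_tr tr p = 0 -> trace_zero_class tr (K0_class p).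
Proof.
move=> p0.
have h1 : is_elt_projection (1 : A) by split; rewrite ?star1 ?mulr1.
have [[v [vv vp _]]|[v [vv vp qv]]] :=
    subequivalence_total pA p (elt_projection h1); last first.
  have [r] := K0_class_sub vv vp qv.
  move=> /(congr1 (K0_tr tr)); rewrite K0_trD K0_tr_elt !K0_tr_class p0 tr_1 /=.
  have := projection_tr_ge0 r; move: (projection_tr tr r) => x x0 /eqP.
  by rewrite eq_sym gt_eqF// ltr_wpDr.
pose e : 'M[A]_1 := v *m adjmx v.
have es : adjmx e = e by rewrite /e adjmxM adjmxK.
have ee : e *m e = e by rewrite /e mulmxA -(mulmxA v) vv vp.
have hp : is_elt_projection (e 0 0).
  split; first by rewrite -{2}es !mxE.
  have e00 : (e *m e) 0 0 = e 0 0 by rewrite ee.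
  by rewrite -[RHS]e00 [RHS]mxE big_ord1.
have pe : K0_class p = K0_class (elt_projection hp).
  apply: (@K0_class_mvn _ _ p (elt_projection hp) v) => //=.
  by rewrite -/e [LHS]mx11_scalar.
exists (e 0 0), hp; split=> //; apply: tr_elt_eq0 => //.
by rewrite -(K0_tr_elt hp) -pe K0_tr_class.
Qed.

Let ker : set (K0 A) := [set g | K0_tr tr g = 0].

Lemma trace_zero_ker : trace_zero_class tr `<=` ker.
Proof. by move=> _ [p [hp [p0 ->]]]; rewrite /ker/= K0_tr_elt p0. Qed.

Lemma ker_pos (g : K0 A) : ker g -> K0_pos g -> trace_zero_class tr g.
Proof.
move=> /[swap] -[p ->]; rewrite /ker/= K0_tr_class; exact: K0_class_trace_zero.
Qed.

Lemma ker_subgroup : is_subgroup ker.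
Proof.
split; first exact: K0_tr0.
by rewrite /ker/= => g h g0 h0; rewrite K0_trD K0_trN g0 h0 subr0.
Qed.

Lemma ker_generated :
  ker = smallest (@is_subgroup (K0 A)) (trace_zero_class tr).
Proof.
apply/seteqP; split=> [g kg H [[H0 HB] HT]|g]; last first.
  by apply; split; [exact: ker_subgroup|exact: trace_zero_ker].
have [pg|pg] := cone_total (K0_total_cone pA) g; first exact/HT/ker_pos.
rewrite -[g]opprK -sub0r; apply: HB => //; apply/HT/ker_pos => //.
by rewrite /ker/= K0_trN kg oppr0.
Qed.

Lemma nonzero_class (g : K0 A) :
  nonzero_trace_zero_class tr g <-> [/\ ker g, K0_pos g & g != 0].
Proof.
split=> [[p [hp [p0 tp ->]]]|[kg pg g0]].
  split; [by apply: trace_zero_ker; exists p, hp|by eexists|].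
  apply: contra p0 => /eqP/(K0_class_eq0 pA)/matrixP/(_ 0 0) /=.
  by rewrite !mxE mulr1n => ->.
have [p [hp [tp gp]]] := ker_pos kg pg; exists p, hp; split=> //.
apply: contra g0 => /eqP p0; rewrite gp; apply/eqP/K0_class0 => /=.
by rewrite p0; apply/matrixP => i j; rewrite !mxE mul0rn.
Qed.

Lemma K0_abs_pos (g : K0 A) : K0_pos g -> K0_abs g = g.
Proof. by move=> pg; rewrite /K0_abs asboolT// /K0_le subr0. Qed.

Let posC := K0_total_cone pA.
Local Notation cle := (cle (@K0_pos R A)).

Lemma arch_equiv_pos (g h : K0 A) : K0_pos g -> K0_pos h -> arch_equiv g h <->
  (exists n, cle h (g *+ n)) /\ (exists n, cle g (h *+ n)).
Proof.
move=> pg ph; rewrite /arch_equiv !K0_abs_pos//.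
split=> [[n [m [? ?]]]|[[n ?] [m ?]]]; last by exists n, m.
by split; [exists n|exists m].
Qed.

Lemma cle_mulrn_trans (a b c : K0 A) : (exists n, cle a (b *+ n)) ->
  (exists n, cle b (c *+ n)) -> exists n, cle a (c *+ n).
Proof.
move=> [n ab] [m bc]; exists (m * n)%N; apply: (cle_trans posC ab).
by rewrite mulrnA; exact: cle_mulrn.
Qed.

Lemma eta_repr_ex (C : eta tr) : exists g, nonzero_trace_zero_class tr g /\
  eta_members C = [set h | nonzero_trace_zero_class tr h /\ arch_equiv g h].
Proof. by have [g hg gE] := eta_membersP C; exists g. Qed.

Definition eta_repr (C : eta tr) : K0 A := projT1 (cid (eta_repr_ex C)).

Lemma eta_repr_class C : nonzero_trace_zero_class tr (eta_repr C).
Proof. by rewrite /eta_repr; case: cid => g []. Qed.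

Lemma eta_repr_pos C : K0_pos (eta_repr C).
Proof. by have /nonzero_class[] := eta_repr_class C. Qed.

Lemma eta_repr_neq0 C : eta_repr C != 0.
Proof. by have /nonzero_class[] := eta_repr_class C. Qed.

Lemma eta_membersE C h : eta_members C h <->
  nonzero_trace_zero_class tr h /\
  ((exists n, cle h (eta_repr C *+ n)) /\
   (exists n, cle (eta_repr C) (h *+ n))).
Proof.
have pg := eta_repr_pos C.
have [_ ->] : nonzero_trace_zero_class tr (eta_repr C) /\ eta_members C =
    [set h | nonzero_trace_zero_class tr h /\ arch_equiv (eta_repr C) h].
  exact: projT2 (cid (eta_repr_ex C)).
split=> -[nh gh]; split=> //; have /nonzero_class[_ ph _] := nh.
  exact/arch_equiv_pos.
exact/arch_equiv_pos.
Qed.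

Lemma eta_members_repr C : eta_members C (eta_repr C).
Proof.
apply/eta_membersE; split; first exact: eta_repr_class.
by split; exists 1%N; rewrite mulr1n; exact: cle_refl.
Qed.

Lemma eta_lt_repr C D :
  eta_lt C D <-> forall n, cle (eta_repr D *+ n) (eta_repr C).
Proof.
split=> [[h [g [/eta_membersE[/nonzero_class[_ ph h0] [[n hn] _]]]]]|H].
  move=> /eta_membersE[/nonzero_class[_ pg g0] [_ [m gm]]] gh k.
  apply: (@cle_mulrn_cancel _ _ posC _ _ n); rewrite -mulrnA.
  apply: (@cle_trans _ _ posC h); last first.
    apply: (cle_trans posC hn); apply: cle_mulrn_mono => //.
    exact: eta_repr_pos.
  apply: (cle_trans posC (cle_mulrn posC (k * n.+1) gm)); rewrite -mulrnA.
  by have := gh (m * (k * n.+1))%N; rewrite !K0_abs_pos.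
exists (eta_repr C), (eta_repr D); split; [exact: eta_members_repr..|].
by move=> n; rewrite !K0_abs_pos; [exact: H|exact: eta_repr_pos..].
Qed.

Lemma eta_repr_inj C D : (exists n, cle (eta_repr C) (eta_repr D *+ n)) ->
  (exists n, cle (eta_repr D) (eta_repr C *+ n)) -> C = D.
Proof.
move=> CD DC; have MM : eta_members C = eta_members D.
  apply/seteqP; split=> h /eta_membersE[nh [h1 h2]];
    apply/eta_membersE; split=> //.
    by split; [exact: cle_mulrn_trans CD|exact: cle_mulrn_trans h2].
  by split; [exact: cle_mulrn_trans DC|exact: cle_mulrn_trans h2].
case: C D MM {CD DC} => [M MP] [M' MP'] /= MM.
by case: _ / MM MP' => MP'; rewrite (Prop_irrelevance MP MP').
Qed.

(** A positive nonzero element of the kernel is itself the class of a nonzero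
    trace-zero projection, hence belongs to a point of eta. *)
Lemma eta_cover h : ker h -> K0_pos h -> h != 0 -> exists C,
  (exists n, cle h (eta_repr C *+ n)) /\ (exists n, cle (eta_repr C) (h *+ n)).
Proof.
move=> kh ph h0; have nh : nonzero_trace_zero_class tr h by exact/nonzero_class.
pose C : eta tr := Eta (ex_intro2 _ _ h nh erefl).
exists C; suff /eta_membersE[] : eta_members C h by [].
split=> //; apply/arch_equiv_pos => //.
by split; exists 1%N; rewrite mulr1n; exact: cle_refl.
Qed.

End TraceKernel.

Theorem proposition6p10 (R : realType) (A : cstarAlgType R)
    (tr : tracial_state A) :
  pseudomatricial A ->
  let ker : set (K0 A) := [set g | K0_tr tr g = 0] in
  ker = smallest (@is_subgroup (K0 A)) (trace_zero_class tr) /\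
  exists (S : set (eta tr -> R)) (phi : K0 A -> (eta tr -> R)),
    [/\ is_subgroup S,
        S `<=` hahn_group (@eta_lt R A tr),
        set_bij ker S phi,
        forall g h, ker g -> ker h -> phi (g + h) = phi g + phi h &
        forall g h, ker g -> ker h ->
          (K0_le g h <-> hahn_le (@eta_lt R A tr) (phi g) (phi h))].
Proof.
move=> pA ker; split; first exact: ker_generated.
have posC := K0_total_cone pA.
have [kB0 kB] : is_subgroup ker := ker_subgroup tr.
(* phi is built on all of K_0(A); its values determine the order only on the
   kernel, where every class is represented in eta. *)
have [phi [phiD phiC]] := total_embedding R posC (eta_repr_pos pA (tr:=tr))
  (eta_repr_neq0 pA (tr:=tr)) (eta_lt_repr pA (tr:=tr))
  (eta_repr_inj pA (tr:=tr)).
have phi0 : phi 0 = 0 by apply: (addrI (phi 0)); rewrite -phiD !addr0.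
have phiN g : phi (- g) = - phi g.
  by apply: (addrI (phi g)); rewrite -phiD !subrr phi0.
have phi_pos g :
    ker g -> K0_pos g -> g != 0 -> hahn_pos (@eta_lt R A tr) (phi g).
  move=> kg pg g0; have [C [C1 C2]] := eta_cover pA kg pg g0.
  exact: (hahn_pos_conform posC (eta_repr_pos pA (tr:=tr))
    (eta_repr_neq0 pA (tr:=tr)) (eta_lt_repr pA (tr:=tr))
    (eta_repr_inj pA (tr:=tr)) (phiC g) pg C1 C2).
have phi_neg g :
    ker g -> K0_pos (- g) -> g != 0 -> ~ hahn_pos (@eta_lt R A tr) (phi g).
  move=> kg pg g0.
  have kg' : ker (- g) by rewrite -sub0r; exact: kB.
  have [|C [C1 C2]] := eta_cover pA kg' pg; first by rewrite oppr_eq0.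
  exact: (hahn_pos_conformN posC (eta_repr_pos pA (tr:=tr))
    (eta_repr_neq0 pA (tr:=tr)) (eta_lt_repr pA (tr:=tr))
    (phiC g) pg C1 C2).
have phi_inj g : ker g -> phi g = 0 -> g = 0.
  move=> kg g0; apply: contrapT => /eqP gn0.
  have n0 : ~ hahn_pos (@eta_lt R A tr) (0 : eta tr -> R).
    by case=> t [/negP[]].
  have [pg|pg] := cone_total posC g.
    by apply: n0; rewrite -g0; exact: phi_pos.
  apply: n0; rewrite -[0]oppr0 -g0 -phiN; apply: phi_pos => //.
    by rewrite -sub0r; exact: kB.
  by rewrite oppr_eq0.
exists (phi @` ker), phi; split.
- split; first by exists 0.
  move=> _ _ [g kg <-] [h kh <-]; exists (g - h); first exact: kB.
  by rewrite phiD phiN.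
- by move=> _ [g _ <-]; have [] := phiC g.
- split; first by move=> g kg; exists g.
    move=> g h /set_mem kg /set_mem kh gh; apply/eqP; rewrite -subr_eq0.
    by apply/eqP/phi_inj; [exact: kB|rewrite phiD phiN gh subrr].
  by move=> _ [g kg <-]; exists g.
- by move=> g h _ _; exact: phiD.
- move=> g h kg kh; have khg := kB _ _ kh kg.
  rewrite -[K0_le g h]/(K0_pos (h - g)) /hahn_le -phiN -phiD.
  split=> [|[gh|hp]].
  + move=> pgh; have [/eqP|gh] := eqVneq (h - g) 0.
      by rewrite subr_eq0 => /eqP ->; left.
    by right; exact: phi_pos.
  + have : h - g = 0 by apply: phi_inj => //; rewrite phiD phiN gh subrr.
    by move=> ->; exact: (cone0 posC).
  + have [//|pgh] := cone_total posC (h - g).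
    have [->|gh] := eqVneq (h - g) 0; first exact: (cone0 posC).
    by case: (phi_neg _ khg pgh gh hp).
Qed.
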